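(* Assume that $S$ is injective on $\Pi^0(\Omega)$ and that $R:L^\infty((0,d))\to[0,\infty)$ is weak$^*$ sequentially lower semicontinuous. Then the bilevel problem $$\min_{\sigma\in W_{ad},\,u\in H^s(\Omega)}\ \tfrac12\|u-u^\dagger\|_{L^2(\Omega)}^2+R(\sigma)\quad\text{subject to}\quad(\sigma,u)\in\mathcal F$$ has a solution.
   Context: Let $s\in(0,1)$, $N\in\mathbb N$, and let $\Omega\subset\mathbb R^N$ be a nonempty, open, connected and bounded Lipschitz domain with diameter $d=\sup_{x,y\in\Omega}|x-y|$. $H^s(\Omega)$ is the usual fractional Sobolev (Sobolev–Slobodeckij) space. Fix constants $0<\gamma_1\le\gamma_2$ and $\delta>0$. The set $W_{ad}$ of feasible weights consists of all $\sigma\in L^\infty((0,d))$ with $0\le\sigma(t)\le\gamma_2$ for a.e. $t\in(0,d)$ and $\gamma_1\le\sigma(t)$ for a.e. $t\in(0,d)$ with $t<\delta$. For $\sigma\in W_{ad}$ and $u\in L^2(\Omega)$, $$|u|_{\sigma,s}=\Big(\iint_{\Omega\times\Omega}\frac{|u(x)-u(y)|^2}{|x-y|^{N+2s}}\sigma(|x-y|)\,dx\,dy\Big)^{1/2}.$$ $\Pi^0(\Omega)\subset L^2(\Omega)$ is the space of functions that are a.e. constant on $\Omega$. $S:L^2(\Omega)\to L^2(\Omega)$ is a bounded linear operator and $y_\delta,u^\dagger\in L^2(\Omega)$ are given. The lower level problem with weight $\sigma$ is $$\min_{u\in H^s(\Omega)}\|Su-y_\delta\|_{L^2(\Omega)}^2+|u|_{\sigma,s}^2,\qquad(P(\sigma))$$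 and $\mathcal F=\{(\sigma,u)\in W_{ad}\times H^s(\Omega): u\text{ solves }(P(\sigma))\}$. *)

(* Defs.v *)
From HB Require Import structures.
From mathcomp Require Import all_boot all_order all_algebra.
From mathcomp Require Import all_classical all_reals all_analysis.
From mathcomp Require Import measurable_realfun.

Set Implicit Arguments.
Unset Strict Implicit.
Unset Printing Implicit Defensive.

Import Order.TTheory GRing.Theory Num.Theory.
Import numFieldNormedType.Exports.

Local Open Scope classical_set_scope.
Local Open Scope ring_scope.

(* The Borel sigma-algebra of 'rV[R]_n. *)
Section borel_rV.
Context {R : realType} (n : nat).

Let borel : set_system 'rV[R]_n := <<s [set A | open A] >>.

Let borel0 : borel set0. Proof. exact: sigma_algebra0. Qed.
Let borelC A : borel A -> borel (~` A). Proof. exact: sigma_algebraC. Qed.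
Let borel_bigcup (F : (set 'rV[R]_n)^nat) :
  (forall i, borel (F i)) -> borel (\bigcup_i F i).
Proof. exact: sigma_algebra_bigcup. Qed.

HB.instance Definition _ := @isMeasurable.Build default_measure_display
  'rV[R]_n borel borel0 borelC borel_bigcup.

Lemma open_measurable_rV (A : set 'rV[R]_n) : open A -> measurable A.
Proof. by move=> oA; exact: sub_sigma_algebra. Qed.

Lemma measurable_rV_coord (i : 'I_n) :
  measurable_fun [set: 'rV[R]_n] (fun x => x ord0 i).
Proof.
apply: (measurability (@RGenOpens.G R)) => //=.
  exact: RGenOpens.measurableE.
move=> _ [_ [a [b ->]] <-]; rewrite setTI; apply: open_measurable_rV.
apply: open_comp; last exact: interval_open.
by move=> x _; exact: coord_continuous.
Qed.

Lemma measurable_fun_rV d (T : measurableType d) (f : T -> 'rV[R]_n) :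
  (forall i, measurable_fun [set: T] (fun t => f t ord0 i)) ->
  measurable_fun [set: T] f.
Proof.
move=> mf; pose box (a b : 'rV[rat]_n) := [set x : 'rV[R]_n |
  forall i, x ord0 i \in `](ratr (a ord0 i)), (ratr (b ord0 i))[].
apply: (measurability [set A : set 'rV[R]_n | open A]) => //.
move=> _ [U oU <-]; rewrite setTI.
rewrite (_ : f @^-1` U = \bigcup_(ab : 'rV[rat]_n * 'rV[rat]_n)
    (if pselect (box ab.1 ab.2 `<=` U) then f @^-1` (box ab.1 ab.2) else set0)).
  apply: countable_bigcupT_measurable; first exact: countableP.
  move=> [a b] /=; case: (pselect (box a b `<=` U)) => ? //=.
  rewrite (_ : _ @^-1` _ = \bigcap_(i : 'I_n)
     ((fun t => f t ord0 i) @^-1` `](ratr (a ord0 i)), (ratr (b ord0 i))[)).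
    apply: fin_bigcap_measurable => [|i _]; first exact: finite_finset.
    rewrite -[X in measurable X]setTI; exact: mf.
  by apply/seteqP; split => t /= ft i; [move=> _|]; exact: ft.
apply/seteqP; split => [t Ut|t [[a b] _] /=]; last first.
  by case: (pselect (box a b `<=` U)) => //= abU /abU.
have /nbhs_ballP[e /= e0 eU] : nbhs (f t) U by exact: open_nbhs_nbhs.
have lt_rat (x y : R) : x < y -> {q : rat | x < ratr q < y}.
  move=> xy; apply: cid; have [q] := rat_in_itvoo xy.
  by rewrite /= in_itv /= => ?; exists q.
have lo i : f t ord0 i - e < f t ord0 i by rewrite ltrBlDr ltrDl.
have hi i : f t ord0 i < f t ord0 i + e by rewrite ltrDl.
exists (\row_i sval (lt_rat _ _ (lo i)), \row_i sval (lt_rat _ _ (hi i))) => //=.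
case: pselect => /= [_ i|[]].
  rewrite !mxE in_itv /=.
  by have /andP[_ ->] := svalP (lt_rat _ _ (lo i));
     have /andP[-> _] := svalP (lt_rat _ _ (hi i)).
move=> x xab; apply: eU; split => // i j; rewrite ord1.
have := xab j; rewrite !mxE in_itv /= => /andP[ax xb].
have /andP[la _] := svalP (lt_rat _ _ (lo j)).
have /andP[_ hb] := svalP (lt_rat _ _ (hi j)).
rewrite /ball /= ltr_distlC; apply/andP; split.
  exact: lt_trans la ax.
exact: lt_trans xb hb.
Qed.

End borel_rV.

(* Product measures have no canonical sigma-finite instance. *)
Lemma sigma_finite_prod d1 d2 (T1 : measurableType d1) (T2 : measurableType d2)
    (R : realType) (m1 : {sigma_finite_measure set T1 -> \bar R})
    (m2 : {sigma_finite_measure set T2 -> \bar R}) :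
  sigma_finite setT (m1 \x m2)%E.
Proof.
have /sigma_finiteP[F [TF ndF Foo]] := sigma_finiteT m1.
have /sigma_finiteP[G [TG ndG Goo]] := sigma_finiteT m2.
exists (fun k => F k `*` G k).
  rewrite -setXTT TF TG; apply/seteqP; split => [[x y]|[x y] [k _ []]]; last first.
    by move=> /= ? ?; split; exists k.
  move=> [/= [k _ Fkx] [l _ Gly]]; exists (maxn k l) => //; split.
  - by move: x Fkx; exact/subsetPset/ndF/leq_maxl.
  - by move: y Gly; exact/subsetPset/ndG/leq_maxr.
move=> k; have [mF ?] := Foo k; have [mG ?] := Goo k.
split; first exact: measurableX.
by rewrite product_measure1E// lte_mul_pinfty// ge0_fin_numE.
Qed.

Section lebesgue_rV.
Context {R : realType}.

Definition rV_cons n (z : measurableTypeR R * 'rV[R]_n) : 'rV[R]_n.+1 :=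
  \row_i oapp (z.2 ord0) (z.1 : R) (unlift ord0 i).

Definition rV_uncons n (x : 'rV[R]_n.+1) : measurableTypeR R * 'rV[R]_n :=
  (x ord0 ord0, \row_j x ord0 (lift ord0 j)).

Lemma rV_consK n : cancel (@rV_cons n) (@rV_uncons n).
Proof.
move=> [a y]; rewrite /rV_uncons/= mxE unlift_none/=; congr pair.
by apply/rowP => j; rewrite !mxE liftK.
Qed.

Lemma measurable_rV_uncons n : measurable_fun setT (@rV_uncons n).
Proof.
apply: measurable_fun_pair; first exact: measurable_rV_coord.
apply: measurable_fun_rV => i.
under eq_fun do rewrite mxE.
exact: measurable_rV_coord.
Qed.

Lemma measurable_rV_cons n : measurable_fun setT (@rV_cons n).
Proof.
apply: measurable_fun_rV => i; under eq_fun do rewrite mxE.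
case: (unlift ord0 i) => [j|] /=; last exact: measurable_fst.
apply: (measurableT_comp (measurable_rV_coord j)) => //.
Qed.

Section lebesgue_rVS.
Variables (n : nat) (mu : {sigma_finite_measure set 'rV[R]_n -> \bar R}).

Definition lebesgue_rVS : set 'rV[R]_n.+1 -> \bar R :=
  pushforward (lebesgue_measure \x mu)%E (@rV_cons n).

Let pushforward_lebesgue_rV : {measure set 'rV[R]_n.+1 -> \bar R} :=
  measure_function_pushforward__canonical__measure_function_Measure
    (lebesgue_measure \x mu)%E (@measurable_rV_cons n).

HB.instance Definition _ := isMeasure.Build _ _ _ lebesgue_rVS
  (measure0 pushforward_lebesgue_rV)
  (measure_ge0 pushforward_lebesgue_rV)
  (@measure_semi_sigma_additive _ _ _ pushforward_lebesgue_rV).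

Let lebesgue_rVS_sigma_finite : sigma_finite setT lebesgue_rVS.
Proof.
have [F FT Ffin] := sigma_finite_prod lebesgue_measure mu.
exists (fun k => @rV_uncons n @^-1` (F k)).
  by rewrite -preimage_bigcup -FT preimage_setT.
move=> k; have [mF muF] := Ffin k; split.
  by rewrite -[X in measurable X]setTI; exact: measurable_rV_uncons.
rewrite /lebesgue_rVS /pushforward -comp_preimage.
by rewrite (_ : _ \o _ = id) //; apply/funext => z; exact: rV_consK.
Qed.

HB.instance Definition _ := Measure_isSigmaFinite.Build _ _ _ lebesgue_rVS
  lebesgue_rVS_sigma_finite.

End lebesgue_rVS.

(* 'rV[R]_n.+1 is identified with R * 'rV[R]_n by rV_cons. *)
Fixpoint lebesgue_rV (n : nat) :
    {sigma_finite_measure set 'rV[R]_n -> \bar R} :=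
  if n is m.+1 then lebesgue_rVS (lebesgue_rV m)
  else dirac (0 : 'rV[R]_0).

End lebesgue_rV.
(* The norm `|x| of 'rV[R]_n is the sup norm; it induces the same topology,
   bounded sets and Lipschitz functions as the Euclidean norm. *)
Definition enorm (R : realType) n (x : 'rV[R]_n) : R :=
  Num.sqrt (\sum_i x ord0 i ^+ 2).

Definition diameter (R : realType) n (A : set 'rV[R]_n) : R :=
  sup [set enorm (z.1 - z.2) | z in A `*` A].

(* Near each boundary point, up to the orthogonal change of coordinates
   x |-> x *m Q, A is the region above the graph of a Lipschitz function of the
   coordinates other than the i-th one. *)
Definition lipschitz_boundary (R : realType) n (A : set 'rV[R]_n) :=
  forall p, (closure A `\` interior A) p ->
  exists (Q : 'M[R]_n) (i : 'I_n) (g : 'rV[R]_n.-1 -> R),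
    [/\ Q *m Q^T = 1%:M, lipschitz g &
        \forall x \near p, A x <-> g (col' i (x *m Q)) < (x *m Q) ord0 i].

Section weights.
Context {R : realType} (d : R).

(* Lebesgue measure on ]0, d[, as a measure on R: functions are identified when
   they agree a.e. on ]0, d[, whatever their values outside. *)
Definition lebesgue_oo : {measure set (measurableTypeR R) -> \bar R} :=
  mrestr lebesgue_measure (measurable_itv `]0, d[).

Definition Linfty := LspaceType lebesgue_oo (leey 1).
Definition L1 := LspaceType1 lebesgue_oo.

Definition admissible (gamma1 gamma2 delta : R) : set Linfty :=
  [set sigma | (\forall t \ae lebesgue_oo, 0 <= sigma t <= gamma2) /\
               (\forall t \ae lebesgue_oo, t < delta -> gamma1 <= sigma t)].

Definition weak_star_cvg (sigma_ : nat -> Linfty) (sigma : Linfty) :=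
  forall g : L1,
    (\int[lebesgue_oo]_t (sigma_ k t * g t)%:E)%E @[k --> \oo] -->
    (\int[lebesgue_oo]_t (sigma t * g t)%:E)%E.

Definition weak_star_seq_lsc (F : Linfty -> R) :=
  forall sigma_ sigma, weak_star_cvg sigma_ sigma ->
    ((F sigma)%:E <= limn_einf (fun k => (F (sigma_ k))%:E))%E.

End weights.

Section bilevel.
Context {R : realType} {N : nat} {Omega : set 'rV[R]_N}
  (oOmega : open Omega).

(* Lebesgue measure on Omega, as a measure on 'rV[R]_N. *)
Definition lebesgue_dom : {measure set 'rV[R]_N -> \bar R} :=
  mrestr (lebesgue_rV N) (open_measurable_rV oOmega).

Definition L2 := LspaceType2 lebesgue_dom.

Definition L2dist (u v : L2) : \bar R :=
  'N[lebesgue_dom]_2%:E[(fun x => (u x - v x)%:E)]%E.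

(* LspaceType is not equipped with a vector space structure: linearity is
   stated on representatives. *)
Definition L2linear (S : L2 -> L2) :=
  forall (a : R) (u v w : L2),
    (\forall x \ae lebesgue_dom, w x = a * u x + v x) ->
    \forall x \ae lebesgue_dom, S w x = a * S u x + S v x.

Definition L2bounded (S : L2 -> L2) :=
  exists C : R, forall u : L2,
    ('N[lebesgue_dom]_2%:E[EFin \o S u] <=
     C%:E * 'N[lebesgue_dom]_2%:E[EFin \o u])%E.

Definition ae_constant : set L2 :=
  [set u | exists c : R, \forall x \ae lebesgue_dom, u x = c].

(* The diagonal, where the quotient is 0 / 0 = 0, is negligible. *)
Definition weighted_seminorm (sigma : R -> R) (s : R) (u : L2) : \bar R :=
  ((\int[lebesgue_rV N \x lebesgue_rV N]_(z in Omega `*` Omega)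
     (`|u z.1 - u z.2| ^+ 2 / enorm (z.1 - z.2) `^ (N%:R + 2 * s)
      * sigma (enorm (z.1 - z.2)))%:E) `^ 2^-1)%E.

Definition Hs (s : R) : set L2 :=
  [set u | (weighted_seminorm (cst 1%R) s u < +oo)%E].

Section problem.
Variables (s gamma1 gamma2 delta : R) (S : L2 -> L2) (ydelta udag : L2).
Variable reg : Linfty (diameter Omega) -> R.

Definition lower_objective (sigma : Linfty (diameter Omega)) (u : L2) : \bar R :=
  (L2dist (S u) ydelta ^+ 2 + weighted_seminorm sigma s u ^+ 2)%E.

(* Objectives take values in \bar R; they are finite on Hs for
   admissible weights. *)
Definition solves_lower (sigma : Linfty (diameter Omega)) (u : L2) :=
  Hs s u /\
  forall v, Hs s v -> (lower_objective sigma u <= lower_objective sigma v)%E.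

Definition feasible : set (Linfty (diameter Omega) * L2) :=
  [set p | admissible gamma1 gamma2 delta p.1 /\ solves_lower p.1 p.2].

Definition upper_objective (p : Linfty (diameter Omega) * L2) : \bar R :=
  (2^-1%:E * L2dist p.2 udag ^+ 2 + (reg p.1)%:E)%E.

Definition solves_bilevel (p : Linfty (diameter Omega) * L2) :=
  feasible p /\
  forall q, feasible q -> (upper_objective p <= upper_objective q)%E.

End problem.
End bilevel.

Arguments Hs {R N Omega} oOmega s.
Arguments ae_constant {R N Omega} oOmega.

(* Main.v *)
Require Import Defs.
From HB Require Import structures.
From mathcomp Require Import all_boot all_order all_algebra.
From mathcomp Require Import all_classical all_reals all_analysis.
From mathcomp Require Import measurable_realfun ess_sup_inf.
From mathcomp Require Import ring lra.

Set Implicit Arguments.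
Unset Strict Implicit.
Unset Printing Implicit Defensive.

Import Order.TTheory GRing.Theory Num.Theory.
Import numFieldNormedType.Exports.

Local Open Scope classical_set_scope.
Local Open Scope ring_scope.

(** The upper level objective is minimized by the direct method: along a
    minimizing sequence of feasible pairs, a subsequence of the weights converges
    weakly-star, and the matter is to show that the associated states converge
    strongly in L2 to the state of the limit weight ([feasible_subsequence]). The
    regularization term then passes to the limit by lower semicontinuity and the
    tracking term by continuity.

    Fix a weight w. The lower level problem is quadratic, with the form
    a_w(u, v) = (S u, S v) + the weighted energy of the pair u, v. This form is
    coercive on L2 with a constant that is the same for all admissible weights
    ([coercivity]): weights are bounded below on distances smaller than delta, and
    such short range differences control the distance of u to the constants
    ([nonlocal_poincare], by chaining small balls inside the connected domain),
    while the constants are controlled by S, which does not annihilate them.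
    Functions of finite energy thus form a Hilbert space for a_w, in which Riesz'
    theorem yields the minimizers, characterized by their Euler-Lagrange equation
    ([euler_lagrange_exists], [minimizer_euler_lagrange]).

    Let now w_k converge weakly-star to w, with solutions u_k and u, and let
    v_k = u - u_k. Subtracting the equations, a_(w_k)(v_k, v_k) is the integral of
    kappa(|x - y|) (w - w_k)(|x - y|) (u(x) - u(y)) (v_k(x) - v_k(y)), where kappa
    is the singular kernel. On the pairs at distance less than e, Young's inequality
    absorbs the factor v_k and leaves a multiple of the energy of u on these pairs,
    which is small with e. On the other pairs kappa is bounded and the integral is
    twice the scalar product of v_k with
      h_k(x) = the integral in y of kappa (w - w_k)(|x - y|) (u(x) - u(y)).
    The distance to x has an absolutely continuous law, so that h_k(x) is the
    pairing of w - w_k with an integrable function of the distance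
    ([disintegration]) and tends to 0; by domination h_k tends to 0 in L2. Hence
    a_(w_k)(v_k, v_k) tends to 0, and so does v_k in L2 by uniform coercivity
    ([stability]).

    All this is carried out for functions, semi-inner products and weights that
    satisfy their bounds everywhere; representatives of the classes are chosen at
    the end. *)

(** * Hilbert space arguments for semi-inner products *)

Lemma discriminant_le (R : realFieldType) (a b c : R) : 0 <= c ->
  (forall t, 0 <= a + 2 * t * b + t ^+ 2 * c) -> b ^+ 2 <= a * c.
Proof.
rewrite le_eqVlt => /orP[/eqP <-|c0] abc.
  have [->|b0] := eqVneq b 0; first by rewrite expr0n mulr0.
  have := abc (- (a + 1) / (2 * b)).
  have -> : 2 * (- (a + 1) / (2 * b)) * b = - (a + 1).
    by field.
  by lra.
have := abc (- b / c).
have -> : a + 2 * (- b / c) * b + (- b / c) ^+ 2 * c = (a * c - b ^+ 2) / c.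
  by field; rewrite gt_eqF.
by rewrite pmulr_lge0 ?invr_gt0// subr_ge0.
Qed.

Lemma le_cvg0_eq0 (R : realType) (x : R) (u : R^nat) :
  u @ \oo --> 0 -> (forall n, `|x| <= u n) -> x = 0.
Proof.
move=> u0 xu; apply/normr0_eq0/eqP; rewrite eq_le normr_ge0 andbT.
rewrite -(cvg_lim (@Rhausdorff R) u0); apply: limr_ge.
  by apply/cvg_ex; exists 0.
exact: nearW.
Qed.

Lemma cvg0_le (R : realType) (b u : R^nat) :
  b @ \oo --> 0 -> (forall n, `|u n| <= b n) -> u @ \oo --> 0.
Proof.
move=> b0 ub; apply: (@norm_cvg0 _ R^o).
apply: (@squeeze_cvgr _ _ _ _ (fun=> 0) b) => //; last exact: cvg_cst.
by apply: nearW => n; rewrite normr_ge0 ub.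
Qed.

Section riesz.
Context {R : realType} {V : Type}.
Variables (lin : R -> V -> V -> V) (P : V -> Prop) (a : V -> V -> R) (l : V -> R).

(** The form is only semidefinite, and vectors are the elements of a bare type that
    satisfy [P], with [lin c u v] standing for c u + v: this suits functions that
    are not identified almost everywhere. *)
Record semi_inner_product : Prop := SemiInnerProduct {
  sip_lin : forall c u v, P u -> P v -> P (lin c u v) ;
  sipC : forall u v, P u -> P v -> a u v = a v u ;
  sipD : forall c u v w, P u -> P v -> P w ->
    a (lin c u v) w = c * a u w + a v w ;
  sip_ge0 : forall u, P u -> 0 <= a u u }.

Definition sqdist u v := a (lin (-1) u v) (lin (-1) u v).

(** Completeness is tested on sequences whose increments have norm at most 4^-n:
    the rate leaves room for a factor 2^n in sums of increments. *)
Definition sip_complete : Prop := forall u_ : nat -> V,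
  (forall n, P (u_ n)) -> (forall n, sqdist (u_ n) (u_ n.+1) <= 16^-1 ^+ n) ->
  exists u, P u /\ sqdist u (u_ n) @[n --> \oo] --> 0.

Hypothesis aP : semi_inner_product.

Lemma sip_linr c u v w : P u -> P v -> P w ->
  a w (lin c u v) = c * a w u + a w v.
Proof.
move=> Pu Pv Pw; rewrite (sipC aP) ?(sipD aP)//; last exact: sip_lin.
by rewrite (sipC aP Pu Pw) (sipC aP Pv Pw).
Qed.

Lemma sip_quad c u v : P u -> P v ->
  a (lin c u v) (lin c u v) = a v v + 2 * c * a u v + c ^+ 2 * a u u.
Proof.
move=> Pu Pv; rewrite (sipD aP)// ?sip_linr//; last exact: sip_lin.
by rewrite (sipC aP Pv Pu); ring.
Qed.

Lemma sqdistE u v : P u -> P v -> sqdist u v = a v v - 2 * a u v + a u u.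
Proof. by move=> Pu Pv; rewrite /sqdist sip_quad//; ring. Qed.

Lemma cauchy_schwarz u v : P u -> P v -> a u v ^+ 2 <= a u u * a v v.
Proof.
move=> Pu Pv; rewrite mulrC; apply: discriminant_le; first exact: sip_ge0.
by move=> t; rewrite -sip_quad//; exact/(sip_ge0 aP)/sip_lin.
Qed.

Hypothesis P_nonempty : exists v, P v.
Hypothesis aC : sip_complete.
Hypothesis l_lin : forall c u v, P u -> P v -> l (lin c u v) = c * l u + l v.
Hypothesis l_bounded : exists C : R, forall v, P v -> l v ^+ 2 <= C * a v v.

(** The representative minimizes a v v - 2 l v. Midpoints show that a minimizing
    sequence is Cauchy, and comparing with its translates along [v] that the limit
    represents [l] at [v]. *)
Theorem riesz_representation : exists u, P u /\ forall v, P v -> a u v = l v.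
Proof.
pose Phi v := a v v - 2 * l v.
have [C lC] := l_bounded.
have Phi_ge v : P v -> - `|C| <= Phi v.
  move=> Pv; have a0 := sip_ge0 aP Pv; have := lC _ Pv => lv.
  have lv' : l v ^+ 2 <= `|C| * a v v.
    by apply: (le_trans lv); rewrite ler_wpM2r// ler_norm.
  have : `|2 * l v| <= a v v + `|C|.
    rewrite -ler_sqr ?nnegrE ?addr_ge0// real_normK ?num_real//.
    by have := sqr_ge0 (a v v - `|C|); nra.
  by move/(le_trans (ler_norm _)); rewrite /Phi; lra.
pose A := [set Phi v | v in P].
have [v0 Pv0] := P_nonempty.
have iA : has_inf A.
  split; first by exists (Phi v0), v0.
  by exists (- `|C|) => _ [v Pv <-]; exact: Phi_ge.
pose I := inf A.
have IPhi v : P v -> I <= Phi v.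
  by move=> Pv; apply: ge_inf; [exact: iA.2|exists v].
have minseq n : {v | P v /\ Phi v < I + 16^-1 ^+ n / 4}.
  apply: cid; have e0 : 0 < 16^-1 ^+ n / 4 :> R.
    by rewrite divr_gt0// exprn_gt0// invr_gt0.
  by have [_ [v Pv <-] ?] := inf_adherent e0 iA; exists v.
pose u_ n := sval (minseq n).
have Pu n : P (u_ n) by have [] := svalP (minseq n).
have Phiu n : Phi (u_ n) < I + 16^-1 ^+ n / 4 by have [] := svalP (minseq n).
(* the values at two terms and at their midpoint [w] bound the distance of the
   terms by the parallelogram identity *)
have [n||u [Puu du0]] := @aC u_.
- exact: Pu.
- move=> n; pose w := lin 2^-1 (lin (-1) (u_ n) (u_ n.+1)) (u_ n).
  have Pd : P (lin (-1) (u_ n) (u_ n.+1)) by exact: sip_lin.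
  have : I <= Phi w by apply: IPhi; exact: sip_lin.
  rewrite /Phi sip_quad// (sipD aP)// !l_lin// sip_quad//.
  have := Phiu n; have := Phiu n.+1; rewrite /Phi sqdistE// exprS.
  have := sipC aP (Pu n) (Pu n.+1).
  have : 0 <= 16^-1 ^+ n :> R by rewrite exprn_ge0.
  by lra.
exists u; split => // v Pv.
have avv0 := sip_ge0 aP Pv.
pose e n := 2 * (16^-1 ^+ n + sqdist u (u_ n)) * a v v.
have e0 : e @ \oo --> 0.
  rewrite -[X in _ --> X](_ : 2 * (0 + 0) * a v v = 0); last by ring.
  apply: cvgMl; apply: cvgMr; apply: cvgD => //.
  by apply: cvg_expr; rewrite ger0_norm// invf_lt1// ltr1n.
apply/eqP; rewrite -subr_eq0 -sqrf_eq0; apply/eqP.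
apply: (le_cvg0_eq0 e0) => n; rewrite ger0_norm ?sqr_ge0//.
have Pw : P (lin (-1) u (u_ n)) by exact: sip_lin.
have CS := cauchy_schwarz Pw Pv; rewrite -/(sqdist _ _) in CS.
have FV : (a v (u_ n) - l v) ^+ 2 <= 16^-1 ^+ n / 4 * a v v.
  apply: discriminant_le => // t.
  have : I <= Phi (lin t v (u_ n)) by apply: IPhi; exact: sip_lin.
  rewrite /Phi sip_quad// l_lin//; have := Phiu n; rewrite /Phi; lra.
have := sqr_ge0 ((a v (u_ n) - l v) + (a (lin (-1) u (u_ n)) v)).
have q0 : 0 <= 16^-1 ^+ n * a v v by rewrite mulr_ge0// exprn_ge0.
rewrite (sipD aP)// in CS *; rewrite (sipC aP (Pu n) Pv) in CS *.
rewrite /e; move: FV CS q0; set b := a u v; set c := a v (u_ n); set L := l v.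
by nra.
Qed.

End riesz.

(** * Square integrable functions *)

Definition lcomb (R : pzRingType) (T : Type) (c : R) (f g : T -> R) : T -> R :=
  fun x => c * f x + g x.

Section sqint.
Context d (T : measurableType d) (R : realType) (m : {measure set T -> \bar R}).
Implicit Types f g h : T -> R.

Definition sqint f := measurable_fun setT f /\
  m.-integrable setT (EFin \o (fun x => f x ^+ 2)).

Definition ip f g : R := \int[m]_x (f x * g x).

Lemma integrable_lcomb c f g : m.-integrable setT (EFin \o f) ->
  m.-integrable setT (EFin \o g) -> m.-integrable setT (EFin \o lcomb c f g).
Proof.
move=> mf mg; have := integrableD measurableT (integrableZl measurableT c mf) mg.
by apply: eq_integrable => // x _ /=; rewrite EFinD EFinM.
Qed.

Lemma Rintegral_lcomb c f g : m.-integrable setT (EFin \o f) ->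
  m.-integrable setT (EFin \o g) ->
  \int[m]_x lcomb c f g x = c * (\int[m]_x f x) + \int[m]_x g x.
Proof.
move=> mf mg; rewrite /lcomb RintegralD//; first by rewrite RintegralZl.
have := integrableZl measurableT c mf.
by apply: eq_integrable => // x _ /=; rewrite EFinM.
Qed.

Lemma measurable_lcomb c f g : measurable_fun setT f -> measurable_fun setT g ->
  measurable_fun setT (lcomb c f g).
Proof.
by move=> mf mg; apply: measurable_funD => //; exact: measurable_funM.
Qed.

Lemma sqint_integrableM f g : sqint f -> sqint g ->
  m.-integrable setT (EFin \o (fun x => f x * g x)).
Proof.
move=> [mf f2] [mg g2]; have := integrable_lcomb 1 f2 g2.
apply: le_integrable => //.
  by apply/measurable_EFinP; exact: measurable_funM.
move=> x _; rewrite /= lee_fin /lcomb normrM mul1r [leRHS]ger0_norm; last first.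
  by rewrite addr_ge0 ?sqr_ge0.
rewrite -(real_normK (num_real (f x))) -(real_normK (num_real (g x))).
have := sqr_ge0 (`|f x| - `|g x|); have := sqr_ge0 (`|f x| + `|g x|); nra.
Qed.

Lemma le_sqint f g : measurable_fun setT f -> (forall x, `|f x| <= `|g x|) ->
  sqint g -> sqint f.
Proof.
move=> mf fg [mg g2]; split => //; move: g2; apply: le_integrable => //.
  by apply/measurable_EFinP; exact: measurable_funX.
move=> x _ /=; rewrite lee_fin !normrX ler_sqr ?nnegrE//.
Qed.

Lemma sqint_lcomb c f g : sqint f -> sqint g -> sqint (lcomb c f g).
Proof.
move=> Lf Lg; split; first exact: measurable_lcomb Lf.1 Lg.1.
have := integrable_lcomb 1 (integrable_lcomb (c ^+ 2) Lf.2 Lg.2)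
  (integrable_lcomb (2 * c) (sqint_integrableM Lf Lg) (integrable0 m setT)).
by apply: eq_integrable => // x _ /=; rewrite /lcomb/=; congr EFin; ring.
Qed.

Lemma sqint0 : sqint (fun=> 0).
Proof.
split => //; rewrite (_ : _ \o _ = cst 0%E); first exact: integrable0.
by apply/funext => x /=; rewrite expr0n.
Qed.

Lemma sqintZ c f : sqint f -> sqint (fun x => c * f x).
Proof.
move=> Lf; have := sqint_lcomb c Lf sqint0; rewrite /lcomb.
by under eq_fun do rewrite addr0.
Qed.

Lemma ip_sip : semi_inner_product (@lcomb R T) sqint ip.
Proof.
split=> [c u v Lu Lv|u v _ _|c u v w Lu Lv Lw|u Lu].
- exact: sqint_lcomb.
- by rewrite /ip; under eq_Rintegral do rewrite mulrC.
- rewrite /ip -Rintegral_lcomb ?sqint_integrableM//.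
  by apply: eq_Rintegral => x _; rewrite /lcomb; ring.
- by apply: Rintegral_ge0 => x _; rewrite -expr2 sqr_ge0.
Qed.

Lemma ae_eq_Rintegral f g : measurable_fun setT f -> measurable_fun setT g ->
  (\forall x \ae m, f x = g x) -> \int[m]_x f x = \int[m]_x g x.
Proof.
move=> mf mg fg; rewrite /Rintegral; congr fine.
apply: ae_eq_integral => //; [exact/measurable_EFinP..|].
by apply: filterS fg => x -> _.
Qed.

Lemma ip_ae f f' g : sqint f -> sqint f' -> sqint g ->
  (\forall x \ae m, f x = f' x) -> ip f g = ip f' g.
Proof.
move=> Lf Lf' Lg ff'; apply: ae_eq_Rintegral.
- exact: measurable_funM Lf.1 Lg.1.
- exact: measurable_funM Lf'.1 Lg.1.
- by apply: filterS ff' => x ->.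
Qed.

Lemma ip_ae_sq f f' : sqint f -> sqint f' ->
  (\forall x \ae m, f x = f' x) -> ip f f = ip f' f'.
Proof.
move=> Lf Lf' ff'; rewrite (ip_ae Lf Lf' Lf ff').
by rewrite (sipC ip_sip)// (ip_ae Lf Lf' Lf' ff').
Qed.

Lemma EFin_ip f : sqint f -> (ip f f)%:E = (\int[m]_x (f x ^+ 2)%:E)%E.
Proof.
move=> Lf; rewrite /ip /Rintegral; under eq_integral do rewrite -expr2.
by rewrite fineK//; exact: integrable_fin_num Lf.2.
Qed.

Lemma sqintE f : measurable_fun setT f ->
  (\int[m]_x (f x ^+ 2)%:E < +oo)%E -> sqint f.
Proof.
move=> mf f2; split => //; apply/integrableP; split.
  by apply/measurable_EFinP; exact: measurable_funX.
by under eq_integral do rewrite /= ger0_norm ?sqr_ge0//.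
Qed.

Lemma ip_lcombD c f g : sqint f -> sqint g ->
  ip (lcomb c f g) (lcomb c f g) <= 2 * (c ^+ 2 * ip f f) + 2 * ip g g.
Proof.
move=> Lf Lg; have := sip_ge0 ip_sip (sqint_lcomb (- c) Lf Lg).
by rewrite !(sip_quad ip_sip)//; lra.
Qed.

End sqint.

Lemma cvg_ip d (T : measurableType d) (R : realType) (m : {measure set T -> \bar R})
    (f : T -> R) (f_ : (T -> R)^nat) : sqint m f -> (forall n, sqint m (f_ n)) ->
  sqdist (@lcomb R T) (ip m) f (f_ n) @[n --> \oo] --> 0 ->
  ip m (f_ n) (f_ n) @[n --> \oo] --> ip m f f.
Proof.
move=> Lf Lf_ ff_; set e := sqdist _ _ _ in ff_ *.
have se n : 0 <= e (f_ n) by exact/(sip_ge0 (ip_sip m))/sqint_lcomb.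
pose b n := 2 * Num.sqrt (ip m f f * e (f_ n)) + e (f_ n).
have b0 : b @ \oo --> 0.
  rewrite -[X in _ --> X](_ : 2 * Num.sqrt (ip m f f * 0) + 0 = 0); last first.
    by rewrite mulr0 sqrtr0; ring.
  apply: cvgD => //; apply: cvgMr.
  have ce : ip m f f * e (f_ n) @[n --> \oo] --> ip m f f * 0 by exact: cvgMr.
  exact: (cvg_comp _ _ ce (@sqrt_continuous R _)).
apply/subr_cvg0/(cvg0_le b0) => n.
have Lw : sqint m (lcomb (-1) f (f_ n)) by exact: sqint_lcomb.
have := cauchy_schwarz (ip_sip m) Lf Lw; rewrite -/(e _) => CS.
have h : `|ip m f (lcomb (-1) f (f_ n))| <= Num.sqrt (ip m f f * e (f_ n)).
  by rewrite -sqrtr_sqr ler_wsqrtr.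
rewrite (_ : _ - _ = 2 * ip m f (lcomb (-1) f (f_ n)) + e (f_ n)); last first.
  rewrite /e (sqdistE (ip_sip m))// (sip_linr (ip_sip m))//; ring.
rewrite (le_trans (ler_normD _ _))// lerD//; last by rewrite ger0_norm.
by rewrite normrM ger0_norm// ler_wpM2l.
Qed.

(** * Completeness *)

(** Correcting each term by the bound on the remaining increments gives a monotone
    sequence. *)
Lemma geometric_cvg (R : realType) (u : R^nat) (B : R) :
  (forall n, `|u n - u n.+1| <= B * 2^-1 ^+ n) ->
  cvgn u /\ forall n, `|limn u - u n| <= 2 * B * 2^-1 ^+ n.
Proof.
move=> uB; have q0 n : 0 < 2^-1 ^+ n :> R by rewrite exprn_gt0// invr_gt0.
have B0 : 0 <= B.
  by rewrite -(pmulr_lge0 _ (q0 0%N)) (le_trans _ (uB 0%N)).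
have q_ n : 2^-1 ^+ n.+1 = 2^-1 * 2^-1 ^+ n :> R by rewrite exprS.
have lo n k : u n - 2 * B * 2^-1 ^+ n <= u (n + k)%N - 2 * B * 2^-1 ^+ (n + k).
  elim: k => [|k IH]; first by rewrite addn0.
  apply: (le_trans IH); rewrite addnS q_.
  by have := le_trans (ler_norm _) (uB (n + k)%N); nra.
have hi n k : u (n + k)%N + 2 * B * 2^-1 ^+ (n + k) <= u n + 2 * B * 2^-1 ^+ n.
  elim: k => [|k IH]; first by rewrite addn0.
  apply: le_trans IH; rewrite addnS q_.
  have := uB (n + k)%N; rewrite distrC => /(le_trans (ler_norm _)); nra.
pose v n := u n - 2 * B * 2^-1 ^+ n.
have g0 : 2 * B * 2^-1 ^+ n @[n --> \oo] --> 0.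
  rewrite -[X in _ --> X](mulr0 (2 * B)); apply: cvgMr; apply: cvg_expr.
  by rewrite ger0_norm// invf_lt1// ltr1n.
have vc : cvgn v.
  apply: nondecreasing_is_cvgn => [n k /subnK <-|].
    by rewrite addnC; exact: lo.
  exists (u 0%N + 2 * B) => _ [n _ <-]; have := hi 0%N n; rewrite add0n expr0.
  have : 0 <= B * 2^-1 ^+ n by rewrite mulr_ge0// ltW.
  by rewrite /v; lra.
have uc : cvgn u.
  have : cvgn (v \+ (fun n => 2 * B * 2^-1 ^+ n)).
    by apply: is_cvgD => //; apply/cvg_ex; exists 0.
  by rewrite (_ : _ \+ _ = u)//; apply/funext => n; rewrite /v/=; ring.
split => // n.
have un k : `|u (k + n)%N - u n| <= 2 * B * 2^-1 ^+ n.
  have := lo n k; have := hi n k; rewrite addnC => h1 h2.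
  have : 0 <= B * 2^-1 ^+ (k + n) by rewrite mulr_ge0// ltW.
  by rewrite ler_norml => h3; apply/andP; split; lra.
have cn : `|u (k + n)%N - u n| @[k --> \oo] --> `|limn u - u n|.
  apply: cvg_norm; apply: cvgB; last exact: cvg_cst.
  by rewrite (cvg_shiftn n u).
rewrite -(cvg_lim (@Rhausdorff R) cn); apply: limr_le; last exact: nearW.
by apply/cvg_ex; eexists; exact: cn.
Qed.

Section riesz_fischer.
Context d (T : measurableType d) (R : realType) (m : {measure set T -> \bar R}).

(** The series of the 4^n |u_n - u_(n+1)|^2 has a finite integral; where its sum is
    finite, the sequence converges at the speed 2^-n, with a constant that is the
    square root of the sum, hence square integrable. *)
Lemma riesz_fischer (u_ : (T -> R)^nat) : (forall n, sqint m (u_ n)) ->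
  (forall n, sqdist (@lcomb R T) (ip m) (u_ n) (u_ n.+1) <= 16^-1 ^+ n) ->
  exists u, [/\ sqint m u,
    sqdist (@lcomb R T) (ip m) u (u_ n) @[n --> \oo] --> 0 &
    \forall x \ae m, u_ n x @[n --> \oo] --> u x].
Proof.
move=> Lu_ du_.
pose D n x := 4 ^+ n * (u_ n x - u_ n.+1 x) ^+ 2.
have Ldn n : sqint m (lcomb (-1) (u_ n) (u_ n.+1)) by exact: sqint_lcomb.
have mu_ n : measurable_fun setT (u_ n) by have [] := Lu_ n.
have mD n : measurable_fun setT (D n).
  by apply: measurable_funM => //; apply: measurable_funX; exact: measurable_funB.
have D0 n x : 0 <= D n x by rewrite mulr_ge0 ?sqr_ge0 ?exprn_ge0.
have iD n : (\int[m]_x (D n x)%:E <= (2 / (2 ^ n.+1)%:R)%:E)%E.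
  under eq_integral do rewrite EFinM.
  rewrite ge0_integralZl//=; last 2 first.
  - by apply/measurable_EFinP; apply: measurable_funX; exact: measurable_funB.
  - by move=> x _; rewrite lee_fin sqr_ge0.
  have -> : (\int[m]_x ((u_ n x - u_ n.+1 x) ^+ 2)%:E =
      (sqdist (@lcomb R T) (ip m) (u_ n) (u_ n.+1))%:E)%E.
    rewrite /sqdist EFin_ip//; apply: eq_integral => x _.
    by rewrite /lcomb; congr EFin; ring.
  rewrite -EFinM lee_fin.
  apply: (@le_trans _ _ (4 ^+ n * 16^-1 ^+ n)); first by rewrite ler_wpM2l ?exprn_ge0.
  rewrite -exprMn natrX exprS invfM mulrA divff// mul1r -exprVn.
  apply: lerXn2r; rewrite ?nnegrE//; lra.
pose G x := (\sum_(n <oo) (D n x)%:E)%E.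
have G0 x : (0 <= G x)%E by apply: nneseries_ge0 => n _ _; rewrite lee_fin.
have mG : measurable_fun setT G.
  apply: ge0_emeasurable_sum => [n x _ _|n]; first by rewrite lee_fin.
  by move=> _; apply/measurable_EFinP; exact: mD.
have iG : m.-integrable setT G.
  apply/integrableP; split => //.
  under eq_integral do rewrite gee0_abs//.
  rewrite integral_nneseries//; last 2 first.
    by move=> n; exact/measurable_EFinP.
    by move=> n x _; rewrite lee_fin.
  apply: (@le_lt_trans _ _ (2%:E)); last by rewrite ltry.
  apply: le_trans (epsilon_trick0 xpredT _) => //.
  apply: lee_nneseries => [n _ _|n _]; last exact: iD.
  by apply: integral_ge0 => x _; rewrite lee_fin.
pose u x := fine (limn_esup (fun n => (u_ n x)%:E)).
pose g x := Num.sqrt (fine (G x)).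
have conv x : G x \is a fin_num ->
    u_ n x @[n --> \oo] --> u x /\ forall n, `|u x - u_ n x| <= 2 * g x * 2^-1 ^+ n.
  move=> Gx; have [cu hu] : cvgn (u_ ^~ x) /\
      forall n, `|limn (u_ ^~ x) - u_ n x| <= 2 * g x * 2^-1 ^+ n.
    apply: geometric_cvg => n; rewrite -ler_sqr ?nnegrE//; last first.
      by rewrite mulr_ge0 ?sqrtr_ge0// exprn_ge0.
    rewrite exprMn sqr_sqrtr ?fine_ge0// real_normK ?num_real//.
    have : D n x <= fine (G x).
      rewrite -lee_fin fineK// /G (@nneseriesD1 _ _ n)//; last first.
        by move=> k _; rewrite lee_fin.
      by rewrite leeDl// nneseries_ge0// => k _ _; rewrite lee_fin.
    rewrite /D mulrC -ler_pdivlMr ?exprn_gt0// -exprVn -!exprM mulnC exprM.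
    by rewrite (_ : 4^-1 = 2^-1 ^+ 2)//; field.
  have uE : limn (u_ ^~ x) = u x.
    have ecu : (u_ n x)%:E @[n --> \oo] --> (limn (u_ ^~ x))%:E.
      by apply: cvg_EFin; [exact: nearW|exact: cu].
    by rewrite /u; have [_ ->] := cvg_limn_einf_sup ecu.
  by rewrite -uE.
have mu : measurable_fun setT u.
  apply: (measurableT_comp (fine_measurable measurableT)); apply: measurable_fun_limn_esup => n.
  exact/measurable_EFinP.
have mg : measurable_fun setT g.
  apply: (measurableT_comp (continuous_measurable_fun (@sqrt_continuous R))).
  exact: (measurableT_comp (fine_measurable measurableT)).
have Gfin : \forall x \ae m, G x \is a fin_num.
  by apply: filterS (integrable_ae measurableT iG) => x; exact.
have Lg : sqint m g.
  apply: sqintE => //; apply: le_lt_trans (integrable_lty measurableT iG).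
  apply: ae_ge0_le_integral => //.
  - by move=> x _; rewrite lee_fin sqr_ge0.
  - by apply/measurable_EFinP; exact: measurable_funX.
  - by apply: filterS Gfin => x Gx _; rewrite sqr_sqrtr ?fine_ge0// fineK.
pose b n x := 2 * 2^-1 ^+ n * g x.
have Lb n : sqint m (b n) by exact: sqintZ.
have le_b n : (\int[m]_x (lcomb (-1) u (u_ n) x ^+ 2)%:E <=
    \int[m]_x (b n x ^+ 2)%:E)%E.
  apply: ae_ge0_le_integral => //.
  - by move=> x _; rewrite lee_fin sqr_ge0.
  - by apply/measurable_EFinP; apply: measurable_funX; exact: measurable_lcomb.
  - by move=> x _; rewrite lee_fin sqr_ge0.
  - by apply/measurable_EFinP; apply: measurable_funX; exact: (Lb n).1.
  apply: filterS Gfin => x /conv[_ /(_ n) h] _; rewrite lee_fin.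
  rewrite -(real_normK (num_real (lcomb _ _ _ _))) lerXn2r ?nnegrE//.
    by rewrite /b !mulr_ge0 ?exprn_ge0// sqrtr_ge0.
  by rewrite /lcomb mulN1r addrC distrC (le_trans h)// /b mulrAC.
have Ld n : sqint m (lcomb (-1) u (u_ n)).
  apply: sqintE; first exact: measurable_lcomb.
  by apply: (le_lt_trans (le_b n)); exact: integrable_lty (Lb n).2.
exists u; split.
- have := sqint_lcomb (-1) (Ld 0%N) (Lu_ 0%N).
  by congr sqint; apply/funext => x; rewrite /lcomb; ring.
- apply: (@cvg0_le _ (fun n => 4 * ip m g g * 4^-1 ^+ n)).
    rewrite -[X in _ --> X](mulr0 (4 * ip m g g)); apply: cvgMr; apply: cvg_expr.
    by rewrite ger0_norm// invf_lt1// ltr1n.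
  move=> n; rewrite ger0_norm; last exact: (sip_ge0 (ip_sip m)).
  have -> : 4 * ip m g g * 4^-1 ^+ n = ip m (b n) (b n).
    rewrite mulrAC /ip -RintegralZl//; last exact: sqint_integrableM.
    apply: eq_Rintegral => x _; rewrite /b (_ : 4^-1 = 2^-1 ^+ 2); last by field.
    by rewrite -exprM mulnC exprM; ring.
  by rewrite -lee_fin /sqdist !EFin_ip.
- by apply: filterS Gfin => x /conv[].
Qed.

End riesz_fischer.

(** * Weak sequential compactness *)

Lemma ultra_cvg (R : realType) (U : set_system nat) (UU : UltraFilter U)
    (u : nat -> R) (B : R) : (forall n, `|u n| <= B) ->
  exists l : R, u n @[n --> U] --> l.
Proof.
move=> uB; have := @segment_compact R (- B) B; rewrite compact_ultra.
move=> /(_ (u n @[n --> U])) [].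
- split=> [|G PG FG]; first exact: fmap_proper_filter.
  apply/funext => A; apply/propext; split => [GA|]; last exact: FG.
  have [//|UA] := in_ultra_setVsetC (u @^-1` A) UU.
  have GnA : G (~` A) by exact: FG.
  by have [x [/[swap]]] := filter_ex (filterI GA GnA).
- by apply: (@filterE _ U) => n /=; rewrite in_itv/= -ler_norml.
by move=> l [_ ul]; exists l.
Qed.

Section weak_compact.
Context {R : realType} {V : Type}.
Variables (lin : R -> V -> V -> V) (P : V -> Prop) (a : V -> V -> R).
Hypothesis aP : semi_inner_product lin P a.
Hypothesis aC : sip_complete lin P a.

(** The limits along an ultrafilter define a bounded functional, represented by
    some [x]. A subsequence realizes these limits on the test vectors [x_ i]. The
    test vectors for which it converges weakly to [x] form a closed subspace, and a
    vector orthogonal to this subspace is orthogonal to all [x_ i] and to [x]. *)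
Theorem bounded_weak_cvg (x_ : nat -> V) (M : R) : (forall n, P (x_ n)) ->
  (forall n, a (x_ n) (x_ n) <= M) ->
  exists x (k : nat -> nat), [/\ P x, forall j, (j <= k j)%N &
    forall v, P v -> a (x_ (k j)) v @[j --> \oo] --> a x v].
Proof.
move=> Px_ xM.
have [U [UU ooU]] := @ultraFilterLemma nat (nbhs \oo) _.
have M0 : 0 <= M by rewrite (le_trans _ (xM 0%N))// (sip_ge0 aP).
have CS v n : P v -> `|a (x_ n) v| <= Num.sqrt (M * a v v).
  move=> Pv; rewrite -sqrtr_sqr ler_wsqrtr// (le_trans (cauchy_schwarz aP _ _))//.
  by rewrite ler_wpM2r// (sip_ge0 aP).
pose l v := lim (a (x_ n) v @[n --> U]).
have lP v : P v -> a (x_ n) v @[n --> U] --> l v.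
  move=> Pv; have [r ur] := ultra_cvg UU (fun n => CS v n Pv).
  by apply/cvg_ex; exists r.
have [|||x [Px xl]] := @riesz_representation _ _ lin P a l aP _ aC.
- by exists (x_ 0%N).
- move=> c u v Pu Pv; apply/cvg_lim => //.
  rewrite (_ : (fun n => _) = (fun n => c * a (x_ n) u + a (x_ n) v)); last first.
    by apply/funext => n; rewrite (sip_linr aP).
  by apply: cvgD; [apply: cvgMr|]; exact: lP.
- exists M => v Pv; rewrite -[leLHS]real_normK ?num_real//.
  rewrite -(sqr_sqrtr (_ : 0 <= M * a v v)); last by rewrite mulr_ge0// (sip_ge0 aP).
  rewrite ler_sqr ?nnegrE ?sqrtr_ge0//.
  have nl : `|a (x_ n) v| @[n --> U] --> `|l v| by apply: cvg_norm; exact: lP.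
  rewrite -(cvg_lim (@Rhausdorff R) nl); apply: limr_le.
    by apply/cvg_ex; eexists; exact: nl.
  by apply: nearW => n; exact: CS.
(* every finite set of test vectors is controlled on a set of the ultrafilter *)
have sel j : exists k, (j <= k)%N /\
    forall i : 'I_j.+1, `|a x (x_ i) - a (x_ k) (x_ i)| < j.+1%:R^-1.
  have : U [set k | (j <= k)%N /\
    forall i : 'I_j.+1, `|a x (x_ i) - a (x_ k) (x_ i)| < j.+1%:R^-1].
    apply: filterI; first by apply: ooU; exact: nbhs_infty_ge.
    apply: filter_forall => i.
    have := lP _ (Px_ i); rewrite -xl// => /cvgrPdist_lt; apply.
    by rewrite invr_gt0.
  by move=> /filter_ex[k]; exists k.
have [k kP] := choice sel; exists x, k; split => [//|j|v Pv].
  by have [] := kP j.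
pose tau j := lin (-1) x (x_ (k j)).
have Ptau j : P (tau j) by exact: (sip_lin aP).
have tauE j v' : P v' -> a (tau j) v' = a (x_ (k j)) v' - a x v'.
  by move=> Pv'; rewrite (sipD aP)//; ring.
pose B := 2 * M + 2 * a x x.
have tauB j : a (tau j) (tau j) <= B.
  have := sip_ge0 aP (sip_lin aP 1 Px (Px_ (k j))).
  by rewrite /tau !(sip_quad aP)//; have := xM (k j); rewrite /B; lra.
pose W v := P v /\ a (tau j) v @[j --> \oo] --> 0.
have Wlin c u v' : W u -> W v' -> W (lin c u v').
  move=> [Pu u0] [Pv' v'0]; split; first exact: (sip_lin aP).
  rewrite (_ : (fun n => _) = (fun n => c * a (tau n) u + a (tau n) v')); last first.
    by apply/funext => n; rewrite (sip_linr aP).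
  rewrite -[X in _ --> X](_ : c * 0 + 0 = 0); last by rewrite mulr0 addr0.
  by apply: cvgD => //; exact: cvgMr.
have WP : semi_inner_product lin W a.
  split => [//|u w [Pu _] [Pw _]|c u w z [Pu _] [Pw _] [Pz _]|u [Pu _]].
  - exact: (sipC aP).
  - exact: (sipD aP).
  - exact: (sip_ge0 aP).
have B0 : 0 <= B by rewrite (le_trans _ (tauB 0%N))// (sip_ge0 aP).
have WC : sip_complete lin W a.
  move=> u_ Wu_ du_; have [u [Pu du0]] := aC (fun n => (Wu_ n).1) du_.
  exists u; split => //; split => //; apply/cvgr0Pnorm_lt => e e0.
  pose e' := (e / 2) ^+ 2 / (B + 1).
  have e'0 : 0 < e' by rewrite divr_gt0 ?exprn_gt0 ?divr_gt0// ltr_pwDr.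
  have /cvgr0Pnorm_lt/(_ _ e'0)[n _ /(_ n (leqnn n)) /= dn] := du0.
  have Pd : P (lin (-1) u (u_ n)) by apply: (sip_lin aP) => //; exact: (Wu_ n).1.
  have e2 : 0 < e / 2 by rewrite divr_gt0.
  have /cvgr0Pnorm_lt/(_ _ e2) := (Wu_ n).2; apply: filterS => j aj.
  have d1 : `|a (tau j) (lin (-1) u (u_ n))| < e / 2.
    rewrite -ltr_sqr ?nnegrE ?(ltW e2)// real_normK ?num_real//.
    apply: (le_lt_trans (cauchy_schwarz aP _ Pd)) => //.
    apply: (@le_lt_trans _ _ (B * sqdist lin a u (u_ n))).
      by rewrite ler_wpM2r// (sip_ge0 aP).
    apply: (@le_lt_trans _ _ ((B + 1) * sqdist lin a u (u_ n))).
      by rewrite ler_wpM2r ?(sip_ge0 aP)// lerDl.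
    rewrite mulrC -ltr_pdivlMr ?ltr_pwDr//.
    exact: le_lt_trans (ler_norm _) dn.
  rewrite (_ : a (tau j) u = a (tau j) (u_ n) - a (tau j) (lin (-1) u (u_ n))).
    by rewrite (le_lt_trans (ler_normB _ _))// [e]splitr ltrD.
  by rewrite (sip_linr aP)//; [ring|exact: (Wu_ n).1].
have Wx i : W (x_ i).
  split => //; apply/cvgr0Pnorm_lt => e e0.
  near=> j; have [_ kj] := kP j.
  have ij : (i < j.+1)%N by rewrite ltnS; near: j; exact: nbhs_infty_ge.
  have := kj (Ordinal ij); rewrite /= tauE// distrC => /lt_trans; apply.
  by near: j; exact: near_infty_natSinv_lt (PosNum e0).
have [|c u w [Pu _] [Pw _]||w [Ww wE]] :=
  @riesz_representation _ _ lin W a (a v) WP _ WC.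
- by exists (x_ 0%N).
- exact: (sip_linr aP).
- by exists (a v v) => w [Pw _]; exact: (cauchy_schwarz aP).
pose d := lin (-1) w v; have Pd : P d by apply: (sip_lin aP) => //; exact: Ww.1.
have dx i : a (x_ i) d = 0.
  rewrite (sip_linr aP)//; last exact: Ww.1.
  rewrite (sipC aP)//; last exact: Ww.1.
  by rewrite wE// (sipC aP Pv)//; ring.
have xd : a x d = 0.
  rewrite xl// /l; under eq_fun do rewrite dx.
  exact: lim_cst.
apply/subr_cvg0.
rewrite (_ : (fun j => _) = (fun j => a (tau j) w)); first exact: Ww.2.
apply/funext => j; rewrite -tauE//.
rewrite (_ : a (tau j) v = a (tau j) d + a (tau j) w); last first.
  by rewrite (sip_linr aP)//; [ring|exact: Ww.1].
by rewrite tauE// xd dx; ring.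
Unshelve. all: by end_near. Qed.

End weak_compact.

(** * Weak-star compactness of bounded sets of functions *)

Section weak_star.
Context d (T : measurableType d) (R : realType) (m : {measure set T -> \bar R}).

Lemma sqint_complete : sip_complete (@lcomb R T) (sqint m) (ip m).
Proof. by move=> u_ Lu du; have [u [Lu' du' _]] := riesz_fischer Lu du; exists u. Qed.

Lemma ip_eq0 (g : T -> R) : sqint m g -> ip m g g <= 0 ->
  \forall x \ae m, g x = 0.
Proof.
move=> Lg g0; have g2 : ip m g g = 0.
  by apply/eqP; rewrite eq_le g0/= (sip_ge0 (ip_sip m)).
have /ae_eq_integral_abs : measurable_fun setT (EFin \o (fun x => g x ^+ 2)).
  by apply/measurable_EFinP; apply: measurable_funX; exact: Lg.1.
move=> /(_ m measurableT)[+ _].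
have -> : (\int[m]_x `|(EFin \o (fun x => g x ^+ 2)%R) x| = 0)%E.
  rewrite -[RHS](_ : (ip m g g)%:E = 0%E); last by rewrite g2.
  rewrite EFin_ip//; apply: eq_integral => x _ /=.
  by rewrite ger0_norm ?sqr_ge0.
move=> /(_ erefl); apply: filterS => x /(_ I)[/eqP].
by rewrite sqrf_eq0 => /eqP.
Qed.

(** Tested against the positive part of [h - f], the differences [f_ n - h] have a
    nonnegative pairing, whereas [f - h] has a nonpositive one. *)
Lemma weak_cvg_ge (f : T -> R) (f_ : (T -> R)^nat) (h : T -> R) :
  sqint m f -> sqint m h -> (forall n, sqint m (f_ n)) ->
  (forall g, sqint m g -> ip m (f_ n) g @[n --> \oo] --> ip m f g) ->
  (forall n x, h x <= f_ n x) -> \forall x \ae m, h x <= f x.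
Proof.
move=> Lf Lh Lf_ wf hf; pose g x := Num.max 0 (h x - f x).
have g0 x : 0 <= g x by rewrite /g le_max lexx.
have Lg : sqint m g.
  apply: (@le_sqint _ _ _ _ _ (lcomb (-1) f h)).
  - apply: measurable_maxr => //.
    by apply: measurable_funB; [exact: Lh.1|exact: Lf.1].
  - move=> x; rewrite ger0_norm// /lcomb mulN1r addrC ge_max normr_ge0/=.
    exact: ler_norm.
  - exact: sqint_lcomb.
have Lhf : ip m (lcomb (-1) f h) g = ip m g g.
  apply: eq_Rintegral => x _; rewrite /lcomb mulN1r addrC /g.
  by case: (leP 0 (h x - f x)) => // _; rewrite !mulr0.
have : ip m (lcomb (-1) f h) g <= 0.
  have cv : - 1 * ip m (f_ n) g + ip m h g @[n --> \oo] -->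
      - 1 * ip m f g + ip m h g.
    by apply: cvgD; [apply: cvgMr; exact: wf|exact: cvg_cst].
  rewrite (sipD (ip_sip m))// -(cvg_lim (@Rhausdorff R) cv); apply: limr_le.
    by apply/cvg_ex; eexists; exact: cv.
  apply: nearW => n; rewrite -(sipD (ip_sip m))//.
  have Lw : sqint m (lcomb (-1) (f_ n) h) by exact: sqint_lcomb.
  rewrite -oppr_ge0 -[leRHS]mulN1r /ip -RintegralZl//; last exact: sqint_integrableM.
  apply: Rintegral_ge0 => x _; rewrite mulN1r oppr_ge0 mulr_le0_ge0// /lcomb.
  by rewrite mulN1r addrC subr_le0.
rewrite Lhf => /(ip_eq0 Lg); apply: filterS => x.
rewrite /g; case: (leP 0 (h x - f x)) => [_ /eqP|+ _]; first by rewrite subr_eq0 => /eqP ->.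
by rewrite subr_lt0 => /ltW.
Qed.

Lemma integrable_bddM (tau g : T -> R) (M : R) : measurable_fun setT tau ->
  (forall x, `|tau x| <= M) -> m.-integrable setT (EFin \o g) ->
  m.-integrable setT (EFin \o (fun x => tau x * g x)).
Proof.
move=> mtau tauM ig; move: (integrableZl measurableT M ig).
apply: le_integrable => //.
  apply/measurable_EFinP; apply: measurable_funM => //.
  by apply/measurable_EFinP; exact: measurable_int ig.
move=> x _; rewrite [leRHS]/= lee_fin !normrM ler_wpM2r//.
exact: le_trans (ler_norm _).
Qed.

(** The pairing with an integrable [g] is approximated, uniformly on bounded
    functions, by the pairing with the truncations of [g], which are square
    integrable. *)
Lemma weak_cvg_L1 (tau : (T -> R)^nat) (M : R) (g : T -> R) :
  (forall n, measurable_fun setT (tau n)) -> (forall n x, `|tau n x| <= M) ->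
  (forall h, sqint m h -> \int[m]_x (tau n x * h x) @[n --> \oo] --> 0) ->
  m.-integrable setT (EFin \o g) ->
  \int[m]_x (tau n x * g x) @[n --> \oo] --> 0.
Proof.
move=> mtau tauM w ig.
have mg : measurable_fun setT g.
  by apply/measurable_EFinP; exact: measurable_int ig.
pose g_ k x := if `|g x| <= k%:R then g x else 0.
have mg_ k : measurable_fun setT (g_ k).
  apply: measurable_fun_ifT => //.
  by apply: measurable_fun_ler => //; exact: measurableT_comp.
have gg x : (g_ k x)%:E @[k --> \oo] --> (g x)%:E.
  apply: cvg_EFin; first exact: nearW.
  apply: cvg_near_cst.
  near=> k; rewrite /= /g_ ifT//.
  by near: k; exact: nbhs_infty_ger.
have g_le k x : `|g_ k x| <= `|g x|.
  by rewrite /g_; case: ifP => // _; rewrite normr0.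
have ig_ k : m.-integrable setT (EFin \o g_ k).
  move: ig; apply: le_integrable => //; first exact/measurable_EFinP.
  by move=> x _; rewrite /= lee_fin.
have [|||||_ gk0 _] := @dominated_convergence _ _ _ m setT measurableT
  (fun k x => (g_ k x)%:E) (EFin \o g) (abse \o (EFin \o g)).
- by move=> k; exact/measurable_EFinP.
- exact/measurable_EFinP.
- by apply: aeW => x _; exact: gg.
- exact: integrable_abse.
- by apply: aeW => x k _; rewrite /= lee_fin.
have Lg_ k : sqint m (g_ k).
  apply: sqintE => //; apply: (@le_lt_trans _ _ (\int[m]_x (k%:R%:E * `|(g x)%:E|))%E).
    apply: ge0_le_integral => //.
    - by move=> x _; rewrite lee_fin sqr_ge0.
    - by apply/measurable_EFinP; exact: measurable_funX.
    - apply/measurable_EFinP; apply: measurable_funM => //; exact: measurableT_comp.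
    move=> x _; rewrite -EFinM lee_fin /g_; case: ifPn => gk.
      by rewrite -real_normK ?num_real// expr2 ler_wpM2r.
    by rewrite expr0n mulr_ge0.
  rewrite integralZl//; last exact: integrable_abse.
  by rewrite lte_mul_pinfty//; have /integrableP[] := ig.
have itau h n : m.-integrable setT (EFin \o h) ->
    m.-integrable setT (EFin \o (fun x => tau n x * h x)).
  by move=> ih; apply: (integrable_bddM (mtau n) (tauM n)).
apply/cvgr0Pnorm_lt => e e0; pose C := `|M| + 1.
have C0 : 0 < C by rewrite ltr_pwDr.
have e2 : 0 < e / 2 by rewrite divr_gt0.
have ek : (0 < (e / 2 / C)%:E)%E by rewrite lte_fin divr_gt0.
have igk k : m.-integrable setT (EFin \o lcomb (-1) (g_ k) g).
  exact: integrable_lcomb.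
have [k gk] : exists k, \int[m]_x `|lcomb (-1) (g_ k) g x| < e / 2 / C.
  have /fine_cvgP[_ /cvgr0Pnorm_lt/(_ _ (divr_gt0 e2 C0))] := gk0.
  move=> [k _ /(_ k (leqnn k)) /= h]; exists k; apply: le_lt_trans h.
  apply: le_trans (ler_norm _); rewrite /Rintegral le_eqVlt; apply/orP; left.
  apply/eqP; congr fine; apply: eq_integral => x _.
  by rewrite /lcomb -normrN; congr (`|_|%:E); ring.
have := w _ (Lg_ k) => /cvgr0Pnorm_lt/(_ _ e2); apply: filterS => n tn.
have -> : \int[m]_x (tau n x * g x) = \int[m]_x (tau n x * g_ k x) +
    \int[m]_x (tau n x * lcomb (-1) (g_ k) g x).
  rewrite -[X in X + _]mul1r -Rintegral_lcomb ?itau//.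
  by apply: eq_Rintegral => x _; rewrite /lcomb; ring.
rewrite (le_lt_trans (ler_normD _ _))// [e]splitr ltrD//.
apply: (le_lt_trans (le_normr_Rintegral _ _)) => //; first exact: itau.
apply: (@le_lt_trans _ _ (\int[m]_x (C * `|lcomb (-1) (g_ k) g x|))).
  apply: le_Rintegral => //.
  - exact/integrable_norm/itau.
  - have := integrableZl measurableT C (integrable_norm (igk k)).
    by apply: eq_integrable => // x _; rewrite /= EFinM.
  - move=> x _; rewrite normrM ler_wpM2r// (le_trans (tauM _ _))//.
    by rewrite (le_trans (ler_norm _))// lerDl.
rewrite RintegralZl//; last exact: integrable_norm.
by rewrite mulrC -ltr_pdivlMr.
Unshelve. all: by end_near. Qed.

(** An order interval is bounded and closed for the weak convergence of square
    integrable functions; truncating the weak limit makes the bounds hold at every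
    point. *)
Theorem weak_star_compact (lo hi : T -> R) (sigma : (T -> R)^nat) :
  sqint m lo -> sqint m hi -> (forall x, lo x <= hi x) ->
  (forall n, measurable_fun setT (sigma n)) ->
  (forall n x, lo x <= sigma n x <= hi x) ->
  exists s (k : nat -> nat), [/\ measurable_fun setT s,
    forall x, lo x <= s x <= hi x, forall j, (j <= k j)%N &
    forall g, sqint m g -> ip m (sigma (k j)) g @[j --> \oo] --> ip m s g].
Proof.
move=> Llo Lhi lohi ms sP.
have Lbetween f : measurable_fun setT f -> (forall x, lo x <= f x <= hi x) ->
    sqint m f.
  move=> mf fP; have L2 : sqint m (fun x => `|lo x| + `|hi x|).
    have Ln g : sqint m g -> sqint m (fun x => `|g x|).
      move=> Lg; apply: (le_sqint _ _ Lg) => [|x]; last by rewrite normr_id.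
      by apply: measurableT_comp => //; exact: Lg.1.
    have := sqint_lcomb 1 (Ln _ Llo) (Ln _ Lhi).
    by rewrite /lcomb; under eq_fun do rewrite mul1r.
  apply: (le_sqint mf _ L2) => x; rewrite [leRHS]ger0_norm ?addr_ge0//.
  have /andP[l1 l2] := fP x; rewrite ler_norml; apply/andP; split.
    by rewrite (le_trans _ l1)// lerNl (le_trans (ler_norm _))// normrN lerDl.
  by rewrite (le_trans l2)// (le_trans (ler_norm _))// lerDr.
have Ls n : sqint m (sigma n) by exact: Lbetween.
have sM n : ip m (sigma n) (sigma n) <= ip m lo lo + ip m hi hi.
  rewrite -[ip m lo lo]mul1r /ip -Rintegral_lcomb ?sqint_integrableM//.
  apply: le_Rintegral; rewrite ?sqint_integrableM//.
    by apply: integrable_lcomb; exact: sqint_integrableM.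
  move=> x _; rewrite /lcomb mul1r; have /andP[l1 l2] := sP n x.
  by case: (leP 0 (sigma n x)) => [|/ltW]; nra.
have [s [k [Lsw kj ws]]] := bounded_weak_cvg (ip_sip m) sqint_complete Ls sM.
have slo : \forall x \ae m, lo x <= s x.
  apply: (weak_cvg_ge Lsw Llo (fun j => Ls (k j)) ws) => n x.
  by have /andP[] := sP (k n) x.
have shi : \forall x \ae m, - hi x <= - s x.
  have LN f : sqint m f -> sqint m (fun x => - f x).
    by move=> Lf; have := sqintZ (-1) Lf; under eq_fun do rewrite mulN1r.
  have ipN f g : sqint m f -> sqint m g -> ip m (fun x => - f x) g = - ip m f g.
    move=> Lf Lg; rewrite -[RHS]mulN1r /ip -RintegralZl//; last exact: sqint_integrableM.
    by apply: eq_Rintegral => x _; rewrite mulN1r mulNr.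
  apply: (weak_cvg_ge (LN _ Lsw) (LN _ Lhi) (fun j => LN _ (Ls (k j)))).
    move=> g Lg; rewrite ipN//; under eq_fun do rewrite ipN//.
    by apply: cvgN; exact: ws.
  by move=> n x; rewrite lerN2; have /andP[] := sP (k n) x.
pose s' x := Num.min (hi x) (Num.max (lo x) (s x)).
have ms' : measurable_fun setT s'.
  apply: measurable_minr; first exact: Lhi.1.
  by apply: measurable_maxr; [exact: Llo.1|exact: Lsw.1].
have ss' : \forall x \ae m, s x = s' x.
  apply: filterS2 slo shi => x l1; rewrite lerN2 => l2.
  by rewrite /s' (max_idPr l1) (min_idPr l2).
have s'P x : lo x <= s' x <= hi x.
  by rewrite /s' le_min lohi le_max lexx/= ge_min lexx.
have Ls' : sqint m s' by exact: Lbetween.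
exists s', k; split => //.
by move=> g Lg; rewrite -(ip_ae Lsw Ls' Lg ss'); exact: ws.
Qed.

End weak_star.

(** * Lebesgue measure on row vectors *)

Section product_null.
Local Open Scope ereal_scope.
Context d1 d2 (T1 : measurableType d1) (T2 : measurableType d2) (R : realType).
Variables (m1 : {sigma_finite_measure set T1 -> \bar R})
  (m2 : {sigma_finite_measure set T2 -> \bar R}).

Lemma product_measure_eq0 (A : set (T1 * T2)) : measurable A ->
  (m1 \x m2) A = 0 <-> \forall x \ae m1, m2 (xsection A x) = 0.
Proof.
move=> mA; have -> : (m1 \x m2) A = \int[m1]_x `|m2 (xsection A x)|.
  by apply: eq_integral => x _; rewrite gee0_abs.
rewrite ae_eq_integral_abs//; last exact: measurable_fun_xsection.
by split; apply: filterS => x; [exact|move=> ? _].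
Qed.

Lemma ysection_product_measure_eq0 (A : set (T1 * T2)) : measurable A ->
  (forall y, m1 (ysection A y) = 0) -> (m1 \x m2) A = 0.
Proof.
move=> mA A0; rewrite -[A]setIT -integral_indic// indic_fubini_tonelli1//.
rewrite indic_fubini_tonelli// integral0_eq// => y _.
by rewrite indic_fubini_tonelli_GE//=.
Qed.

End product_null.

(** The image of the Lebesgue measure by the affine map, multiplied by [t], agrees
    with the Lebesgue measure on intervals. *)
Lemma lebesgue_null_affine (R : realType) (t b : R) (A : set R) : 0 < t ->
  measurable A -> lebesgue_measure A = 0%E ->
  lebesgue_measure [set x | A (t * x + b)] = 0%E.
Proof.
move=> t0 mA A0; pose f : measurableTypeR R -> measurableTypeR R := fun x => t * x + b.
have mf : measurable_fun setT f.
  by apply: measurable_funD => //; exact: measurable_funM.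
pose m : {measure set (measurableTypeR R) -> \bar R} :=
  measure_function_pushforward__canonical__measure_function_Measure
    lebesgue_measure mf.
have t0' : 0 <= t by exact: ltW.
have := @lebesgue_measure_unique R (mscale (NngNum t0') m) _ A mA.
rewrite A0 => /(_ _)/esym/eqP; rewrite mule_eq0 => H.
have /H : forall X, ocitv X -> lebesgue_measure X = mscale (NngNum t0') m X.
  move=> _ [[x y] _ <-]; rewrite /mscale/= /pushforward.
  rewrite (_ : f @^-1` _ = `](x - b) / t, (y - b) / t]%classic); last first.
    apply/seteqP; split => z /=; rewrite !in_itv/= ltr_pdivrMr// ler_pdivlMr//;
    by rewrite ltrBlDr lerBrDr ![z * t]mulrC.
  rewrite !lebesgue_measure_itv/= !lte_fin ltr_pM2r ?invr_gt0// ltrD2r.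
  case: ifP => // _; last by rewrite mule0.
  by rewrite -!EFinD -EFinM; congr EFin; field; rewrite gt_eqF.
by rewrite eqe gt_eqF//= => /eqP.
Qed.

Lemma subset_null d (T : measurableType d) (R : realType)
    (m : {measure set T -> \bar R}) (A B : set T) : measurable A -> measurable B ->
  A `<=` B -> m B = 0%E -> m A = 0%E.
Proof.
move=> mA mB AB B0; apply/eqP; rewrite eq_le measure_ge0 andbT -B0.
by apply: le_measure; rewrite ?inE.
Qed.

Section lebesgue_rV_theory.
Context {R : realType}.

Lemma lebesgue_rVSE n (A : set 'rV[R]_n.+1) : lebesgue_rV n.+1 A =
  ((lebesgue_measure : {sigma_finite_measure set (measurableTypeR R) -> \bar R})
     \x (lebesgue_rV n))%E (@rV_cons R n @^-1` A).
Proof. by []. Qed.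

Lemma measurable_rV_cons_preimage n (A : set 'rV[R]_n.+1) :
  measurable A -> measurable (@rV_cons R n @^-1` A).
Proof.
by move=> mA; rewrite -[X in measurable X]setTI; exact: measurable_rV_cons.
Qed.

Lemma measurable_affine n (t : R) (b : 'rV[R]_n) :
  measurable_fun setT (fun x : 'rV[R]_n => t *: x + b).
Proof.
apply: measurable_fun_rV => i; under eq_fun do rewrite !mxE.
by apply: measurable_funD => //; apply: measurable_funM => //; exact: measurable_rV_coord.
Qed.

(** By induction on the dimension: almost all sections of the set are null, and the
    affine map acts on sections by affine maps. *)
Lemma lebesgue_rV_null_affine n (t : R) (b : 'rV[R]_n) (E : set 'rV[R]_n) :
  0 < t -> measurable E -> lebesgue_rV n E = 0%E ->
  lebesgue_rV n [set x | E (t *: x + b)] = 0%E.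
Proof.
move=> t0; elim: n b E => [|n IH] b E mE.
  by rewrite (_ : [set x | _] = E)//; apply/seteqP; split => x /=;
    rewrite [t *: x + b]thinmx0 [x]thinmx0.
have mE' : measurable [set x | E (t *: x + b)].
  by rewrite -[X in measurable X]setTI; exact: measurable_affine.
rewrite !lebesgue_rVSE product_measure_eq0; last exact: measurable_rV_cons_preimage.
move=> [Z [mZ Z0 hZ]]; apply/product_measure_eq0.
  exact: measurable_rV_cons_preimage.
pose b' : 'rV[R]_n := \row_j b ord0 (lift ord0 j).
exists [set a : measurableTypeR R | Z (t * a + b ord0 ord0)]; split => //.
- rewrite -[X in measurable X]setTI.
  have : measurable_fun setT (fun a : measurableTypeR R => t * a + b ord0 ord0).
    by apply: measurable_funD => //; exact: measurable_funM.
  exact.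
- exact: lebesgue_null_affine.
move=> a /= na; apply: hZ => /= /IH h; apply: na.
rewrite -[RHS](h b'); last first.
  by apply: measurable_xsection; exact: measurable_rV_cons_preimage.
congr (lebesgue_rV n _); apply/seteqP; split => y /=; rewrite !xsectionE /=;
  congr E; apply/rowP => i; rewrite !mxE; case: unliftP => [j|] -> /=; rewrite ?mxE//;
  rewrite ?liftK ?unlift_none /= ?mxE//.
Qed.

Lemma rV_ball_cons n (x : 'rV[R]_n.+1) (e : R) : 0 < e ->
  @rV_cons R n @^-1` ball x e =
  ball (x ord0 ord0) e `*` ball (\row_j x ord0 (lift ord0 j) : 'rV_n) e.
Proof.
move=> e0; apply/seteqP; split => [[a y] /= [_ h]|[a y] /= [h1 [_ h2]]].
  split => /=; first by have := h ord0 ord0; rewrite !mxE unlift_none.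
  by split => // i j; have := h i (lift ord0 j); rewrite !mxE liftK ord1.
split => // i j; rewrite !mxE ord1; case: unliftP => [k|] -> //=.
by have := h2 ord0 k; rewrite !mxE.
Qed.

Lemma lebesgue_rV_ball n (x : 'rV[R]_n) (e : R) : 0 < e ->
  lebesgue_rV n (ball x e) = ((e *+ 2) ^+ n)%:E.
Proof.
move=> e0; elim: n x => [|n IH] x.
  rewrite /= /dirac indicE mem_set// ; split => // i j; exfalso.
  by case: j.
rewrite lebesgue_rVSE rV_ball_cons// product_measure1E//; last 2 first.
- exact: measurable_ball.
- by apply: open_measurable_rV; exact: ball_open.
by rewrite [X in (X * _)%E]lebesgue_measure_ball ?ltW// [X in (_ * X)%E]IH -EFinM exprS.
Qed.

Lemma lebesgue_rV_open_gt0 n (U : set 'rV[R]_n) : open U -> U !=set0 ->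
  (0 < lebesgue_rV n U)%E.
Proof.
move=> oU [x Ux]; have /nbhs_ballP[e /= e0 eU] : nbhs x U by exact: open_nbhs_nbhs.
apply: (@lt_le_trans _ _ (lebesgue_rV n (ball x e))).
  by rewrite lebesgue_rV_ball// lte_fin exprn_gt0// pmulrn_lgt0.
by apply: le_measure; rewrite ?inE//; apply: open_measurable_rV => //; exact: ball_open.
Qed.

Lemma lebesgue_rV_bounded n (A : set 'rV[R]_n) : measurable A -> bounded_set A ->
  (lebesgue_rV n A < +oo)%E.
Proof.
move=> mA [M [_ AM]]; have M1 : M < `|M| + 1 by rewrite ltr_pwDr// ler_norm.
have r0 : 0 < `|M| + 2 by rewrite ltr_wpDl.
apply: (@le_lt_trans _ _ (lebesgue_rV n (ball 0 (`|M| + 2)))).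
  apply: le_measure; rewrite ?inE//; first by apply: open_measurable_rV; exact: ball_open.
  move=> y Ay; rewrite -ball_normE /= sub0r normrN.
  by apply: (le_lt_trans (AM _ M1 _ Ay)); rewrite ltrD2l ltr1n.
by rewrite lebesgue_rV_ball// ltry.
Qed.

Lemma measurable_enorm n : measurable_fun setT (@enorm R n).
Proof.
apply: (measurableT_comp (continuous_measurable_fun (@sqrt_continuous R))).
apply: measurable_sum => i; apply: measurable_funX; exact: measurable_rV_coord.
Qed.

Lemma enormZ n (c : R) (x : 'rV[R]_n) : enorm (c *: x) = `|c| * enorm x.
Proof.
rewrite /enorm -sqrtr_sqr -sqrtrM ?sqr_ge0// mulr_sumr.
by congr Num.sqrt; apply: eq_bigr => i _; rewrite mxE exprMn.
Qed.

Lemma enorm_ge0 n (x : 'rV[R]_n) : 0 <= enorm x.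
Proof. exact: sqrtr_ge0. Qed.

Lemma le_enorm n (x : 'rV[R]_n) i : `|x ord0 i| <= enorm x.
Proof.
rewrite -sqrtr_sqr ler_wsqrtr// (bigD1 i)//= lerDl sumr_ge0// => j _.
exact: sqr_ge0.
Qed.

Lemma enorm0_eq0 n (x : 'rV[R]_n) : enorm x = 0 -> x = 0.
Proof.
move=> x0; apply/rowP => i; rewrite mxE; apply: normr0_eq0.
by apply/eqP; rewrite eq_le normr_ge0 andbT -x0 le_enorm.
Qed.

Lemma enormN n (x : 'rV[R]_n) : enorm (- x) = enorm x.
Proof. by rewrite -scaleN1r enormZ normrN1 mul1r. Qed.

Lemma measurable_enormB n (x : 'rV[R]_n) :
  measurable_fun setT (fun y : 'rV[R]_n => enorm (x - y)).
Proof.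
apply: (measurableT_comp (@measurable_enorm n)).
have := @measurable_affine n (-1) x; apply: eq_measurable_fun => y _.
by rewrite scaleN1r addrC.
Qed.

Lemma measurable_rV_set1 n (x : 'rV[R]_n) : measurable [set x].
Proof.
rewrite (_ : [set x] = [set: 'rV[R]_n] `&` (fun y => enorm (x - y)) @^-1` [set 0]).
  exact: measurable_enormB.
rewrite setTI; apply/seteqP; split => y /=.
  by move=> ->; rewrite subrr -(scale0r 0) enormZ normr0 mul0r.
by move=> /enorm0_eq0/eqP; rewrite subr_eq0 => /eqP.
Qed.

Lemma lebesgue_rV_set1 n (x : 'rV[R]_n) : (0 < n)%N -> lebesgue_rV n [set x] = 0%E.
Proof.
case: n x => // n x _; have mx := measurable_rV_set1 x.
rewrite lebesgue_rVSE product_measure_eq0; last exact: measurable_rV_cons_preimage.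
exists [set x ord0 ord0]; split => //; first exact: lebesgue_measure_set1.
move=> a /= /eqP; apply: contra_neqP => /eqP ax; rewrite xsectionE.
rewrite (_ : _ @^-1` _ = set0) ?measure0//; apply/seteqP; split => // y /= xy.
by move: ax; rewrite -xy mxE unlift_none/= eqxx.
Qed.

(** Null sets of radii yield null sets of points: dilating the radii by a
    factor [s], Tonelli's theorem shows that almost every dilation of the set is
    null, and one dilation being null suffices. *)
Lemma lebesgue_rV_null_radii n (x : 'rV[R]_n) (A : set R) : (0 < n)%N ->
  measurable A -> lebesgue_measure A = 0%E ->
  lebesgue_rV n [set y | A (enorm (x - y))] = 0%E.
Proof.
move=> n0 mA A0; pose A' := A `\ 0.
have mA' : measurable A' by exact: measurableD.
have A'0 : lebesgue_measure A' = 0%E.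
  by apply: (subset_null _ _ _ A0) => //; exact: subDsetl.
pose G := [set z : measurableTypeR R * 'rV[R]_n | A' (z.1 * enorm (x - z.2))].
have mG : measurable G.
  rewrite -[X in measurable X]setTI.
  have : measurable_fun setT
      (fun z : measurableTypeR R * 'rV[R]_n => z.1 * enorm (x - z.2) : measurableTypeR R).
    apply: measurable_funM => //.
    by apply: (measurableT_comp (measurable_enormB x)).
  exact.
have G0 : ((lebesgue_measure : {sigma_finite_measure set (measurableTypeR R) -> \bar R})
     \x (lebesgue_rV n))%E G = 0%E.
  apply: ysection_product_measure_eq0 => // y; rewrite ysectionE.
  have := enorm_ge0 (x - y); rewrite le_eqVlt => /orP[/eqP r0|r0].
    rewrite (_ : _ @^-1` _ = set0) ?measure0//; apply/seteqP; split => // s /=.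
    by rewrite /G /A'/= -r0 mulr0 => -[].
  rewrite (_ : _ @^-1` _ = [set s | A' (enorm (x - y) * s + 0)]).
    exact: lebesgue_null_affine.
  by apply/seteqP; split => s /=; rewrite /G/= addr0 mulrC.
have [s s0 Gs] : exists2 s : R, 0 < s & lebesgue_rV n (xsection G s) = 0%E.
  have /product_measure_eq0-/(_ mG)[Z [mZ Z0 hZ]] := G0.
  apply: contrapT => ns.
  have : (lebesgue_measure [set` `]0%R, 1%R[] <= lebesgue_measure Z)%E.
    apply: le_measure; rewrite ?inE// => s /=; rewrite in_itv/= => /andP[s0 _].
    by apply: hZ => /= Gs; apply: ns; exists s.
  by rewrite Z0 lebesgue_measure_itv/= lte_fin ltr01 oppr0 adde0 lee_fin ler10.
have mxG : measurable (xsection G s) by exact: measurable_xsection.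
have si : 0 < s^-1 by rewrite invr_gt0.
have := @lebesgue_rV_null_affine n s^-1 (x - s^-1 *: x) _ si mxG Gs.
set B := [set y | _] => B0.
have mB : measurable B.
  by rewrite -[X in measurable X]setTI; exact: measurable_affine.
have m1 := measurable_rV_set1 x.
have mr : measurable [set y | A (enorm (x - y))].
  by rewrite -[X in measurable X]setTI; exact: measurable_enormB.
apply: (@subset_null _ _ _ (lebesgue_rV n) _ (B `|` [set x])) => //.
- exact: measurableU.
- move=> y Ay; have [->|yx] := eqVneq y x; [by right|left].
  rewrite /B/= xsectionE/= /G/= /A'/=.
  have -> : x - (s^-1 *: y + (x - s^-1 *: x)) = s^-1 *: (x - y).
    by apply/rowP => i; rewrite !mxE; ring.
  rewrite enormZ ger0_norm ?ltW// mulrA mulfV ?gt_eqF// mul1r; split => //.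
  by move/enorm0_eq0/eqP; rewrite subr_eq0 eq_sym; exact/negP.
- rewrite measureU0//; exact: lebesgue_rV_set1.
Qed.

End lebesgue_rV_theory.

(** * A nonlocal Poincare inequality *)

Section poincare.
Context {R : realType} {n : nat}.
Variables (m : {finite_measure set 'rV[R]_n -> \bar R}) (delta : R).
Implicit Types (u : 'rV[R]_n -> R) (A B : set 'rV[R]_n).

Definition near_diff u (z : 'rV[R]_n * 'rV[R]_n) : R :=
  if enorm (z.1 - z.2) < delta then (u z.1 - u z.2) ^+ 2 else 0.

Definition near_energy u : \bar R := (\int[m \x m]_z (near_diff u z)%:E)%E.

Definition sqdev A u (c : R) : \bar R := (\int[m]_(x in A) ((u x - c) ^+ 2)%:E)%E.

(** The deviation of a function from any constant propagates from [A] to [B], at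
    the cost of the energy. *)
Definition controls A B : Prop := exists C : R, 0 <= C /\
  forall u, measurable_fun setT u -> forall c,
  (sqdev B u c <= C%:E * (sqdev A u c + near_energy u))%E.

Lemma near_diff_ge0 u z : 0 <= near_diff u z.
Proof. by rewrite /near_diff; case: ifP => // _; exact: sqr_ge0. Qed.

Lemma measurable_enorm_diff :
  measurable_fun setT (fun z : 'rV[R]_n * 'rV[R]_n => enorm (z.1 - z.2)).
Proof.
apply: (measurableT_comp (@measurable_enorm R n)); apply: measurable_fun_rV => i.
under eq_fun do rewrite !mxE.
apply: measurable_funB.
- exact: (measurableT_comp (measurable_rV_coord i) measurable_fst).
- exact: (measurableT_comp (measurable_rV_coord i) measurable_snd).
Qed.

Lemma measurable_near_diff u : measurable_fun setT u ->
  measurable_fun setT (near_diff u).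
Proof.
move=> mu; apply: measurable_fun_ifT => //.
  by apply: measurable_fun_ltr => //; exact: measurable_enorm_diff.
apply: measurable_funX; apply: measurable_funB.
- exact: (measurableT_comp mu measurable_fst).
- exact: (measurableT_comp mu measurable_snd).
Qed.

Lemma sqdev_ge0 A u c : (0 <= sqdev A u c)%E.
Proof. by apply: integral_ge0 => x _; rewrite lee_fin sqr_ge0. Qed.

Lemma near_energy_ge0 u : (0 <= near_energy u)%E.
Proof. by apply: integral_ge0 => z _; rewrite lee_fin near_diff_ge0. Qed.

Lemma measurable_sqdev A u c : measurable_fun setT u ->
  measurable_fun A (fun x => ((u x - c) ^+ 2)%:E).
Proof.
move=> mu; apply: measurable_funTS; apply/measurable_EFinP.
by apply: measurable_funX; exact: measurable_funB.
Qed.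

Lemma near_energyE u : measurable_fun setT u ->
  near_energy u = (\int[m]_x \int[m]_y (near_diff u (x, y))%:E)%E.
Proof.
move=> mu; rewrite /near_energy fubini_tonelli1//.
  by apply/measurable_EFinP; exact: measurable_near_diff.
by move=> z; rewrite lee_fin near_diff_ge0.
Qed.

Lemma measurable_near_diff_section u x : measurable_fun setT u ->
  measurable_fun setT (fun y => (near_diff u (x, y))%:E).
Proof.
move=> mu; apply/measurable_EFinP.
exact: (measurableT_comp (measurable_near_diff mu) (measurable_pair1 x)).
Qed.

Lemma measurable_near_diff_int u : measurable_fun setT u ->
  measurable_fun setT (fun x => (\int[m]_y (near_diff u (x, y))%:E)%E).
Proof.
move=> mu; apply: (@measurable_fun_fubini_tonelli_F _ _ _ _ _ m (EFin \o near_diff u)).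
  by apply/measurable_EFinP; exact: measurable_near_diff.
by move=> z; rewrite /= lee_fin near_diff_ge0.
Qed.

Lemma controls_refl A : controls A A.
Proof.
exists 1; split => // u mu c; rewrite mul1e leeDl//; exact: near_energy_ge0.
Qed.

Lemma controls_trans A B D : controls A B -> controls B D -> controls A D.
Proof.
move=> [C1 [C10 h1]] [C2 [C20 h2]]; exists (C2 * (C1 + 1)).
have C11 : 0 <= C1 + 1 by rewrite addr_ge0.
split => [|u mu c]; first by rewrite mulr_ge0.
apply: (le_trans (h2 u mu c)); rewrite EFinM -muleA lee_wpmul2l ?lee_fin//.
rewrite EFinD ge0_muleDl ?lee_fin// mul1e.
rewrite leeD//; first exact: h1.
by rewrite leeDr// sqdev_ge0.
Qed.

Lemma controls_setU A B D : measurable A -> measurable B -> measurable D ->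
  controls D A -> controls D B -> controls D (A `|` B).
Proof.
move=> mA mB mD [C1 [C10 h1]] [C2 [C20 h2]]; exists (C1 + C2).
split => [|u mu c]; first exact: addr_ge0.
rewrite EFinD ge0_muleDl ?lee_fin//.
apply: le_trans (leeD (h1 u mu c) (h2 u mu c)).
have -> : A `|` B = A `|` (B `\` A).
  apply/seteqP; split => x; last by case; [left|case; right].
  by have [Ax|nAx] := pselect (A x) => -[]; [left|left|left|right].
rewrite /sqdev.
rewrite ge0_integral_setU//.
- rewrite leeD2l// ge0_subset_integral//.
  + exact: measurableD.
  + exact: measurable_sqdev.
  + by move=> x _; rewrite lee_fin sqr_ge0.
- exact: measurableD.
- exact: measurable_sqdev.
- by move=> x _; rewrite lee_fin sqr_ge0.
- by apply/disj_set2P; rewrite setIDA; apply/seteqP; split => // x [[Ax _]].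
Qed.

(** When all distances between [A] and [B] are below [delta], average
    [(u y - c)^2 <= 2 (u x - c)^2 + 2 (u x - u y)^2] over [x] in [A] and
    [y] in [B]. *)
Lemma controls_near A B : measurable A -> measurable B -> (0 < m A)%E ->
  (forall x y, A x -> B y -> enorm (x - y) < delta) -> controls A B.
Proof.
move=> mA mB A0 ABd.
have mAfin : m A \is a fin_num by exact: fin_num_measure.
have mBfin : m B \is a fin_num by exact: fin_num_measure.
pose a := fine (m A); pose b := fine (m B).
have a0 : 0 < a by rewrite fine_gt0// A0 ltey_eq mAfin.
have b0 : 0 <= b by rewrite fine_ge0.
exists (2 * (b + 1) / a); split; first by rewrite divr_ge0 ?mulr_ge0 ?addr_ge0// ltW.
move=> u mu c.
have cstE D (r : \bar R) : measurable D -> m D \is a fin_num ->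
    (\int[m]_(x in D) cst r x = r * (fine (m D))%:E)%E.
  by move=> mD Dfin; rewrite integral_cst// fineK.
pose I x := (\int[m]_y (near_diff u (x, y))%:E)%E.
have I0 x : (0 <= I x)%E by apply: integral_ge0 => y _; rewrite lee_fin near_diff_ge0.
have pt x : A x -> (sqdev B u c <= (2 * b)%:E * ((u x - c) ^+ 2)%:E + 2%:E * I x)%E.
  move=> Ax.
  apply: (@le_trans _ _ (\int[m]_(y in B) ((2 * (u x - c) ^+ 2)%:E +
      2%:E * (near_diff u (x, y))%:E))%E).
    apply: ge0_le_integral => //.
    - by move=> y _; rewrite lee_fin sqr_ge0.
    - exact: measurable_sqdev.
    - apply: emeasurable_funD => //; apply: emeasurable_funM => //.
      by apply: measurable_funTS; exact: measurable_near_diff_section.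
    - move=> y By; rewrite -EFinM -EFinD lee_fin /near_diff/= ABd//.
      by have := sqr_ge0 (u x - c + (u x - u y)); lra.
  rewrite ge0_integralD//.
  - rewrite (cstE B (2 * (u x - c) ^+ 2)%:E)// -/b -!EFinM mulrAC leeD2l//.
    rewrite ge0_integralZl//.
    + rewrite lee_wpmul2l// ge0_subset_integral//.
      * exact: measurable_near_diff_section.
      * by move=> y _; rewrite lee_fin near_diff_ge0.
    + by apply: measurable_funTS; exact: measurable_near_diff_section.
    + by move=> y _; rewrite lee_fin near_diff_ge0.
  - by move=> y _; rewrite lee_fin mulr_ge0 ?sqr_ge0.
  - by move=> y _; rewrite -EFinM lee_fin mulr_ge0 ?near_diff_ge0.
  - apply: emeasurable_funM => //.
    by apply: measurable_funTS; exact: measurable_near_diff_section.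
have mI : measurable_fun A I.
  by apply: measurable_funTS; exact: measurable_near_diff_int.
have key : (sqdev B u c * a%:E <= (2 * b)%:E * sqdev A u c + 2%:E * near_energy u)%E.
  rewrite -(cstE A)//.
  apply: (@le_trans _ _ (\int[m]_(x in A)
      ((2 * b)%:E * ((u x - c) ^+ 2)%:E + 2%:E * I x))%E).
    apply: ge0_le_integral => //.
    - by move=> x _; exact: sqdev_ge0.
    - apply: emeasurable_funD; apply: emeasurable_funM => //.
      exact: measurable_sqdev.
  rewrite ge0_integralD//.
  - rewrite ge0_integralZl//; last 3 first.
    + exact: measurable_sqdev.
    + by move=> x _; rewrite lee_fin sqr_ge0.
    + by rewrite lee_fin mulr_ge0.
    rewrite leeD2l// ge0_integralZl// lee_wpmul2l// near_energyE//.
    rewrite ge0_subset_integral//; exact: measurable_near_diff_int.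
  - by move=> x _; rewrite -EFinM lee_fin mulr_ge0 ?sqr_ge0// mulr_ge0.
  - by apply: emeasurable_funM => //; exact: measurable_sqdev.
  - by move=> x _; rewrite mule_ge0.
  - exact: emeasurable_funM.
rewrite EFinM -muleA [(_^-1%:E * _)%E]muleC muleA lee_pdivlMr//.
apply: (le_trans key).
rewrite [leRHS]ge0_muleDr; [|exact: sqdev_ge0|exact: near_energy_ge0].
apply: leeD.
- by rewrite lee_wpmul2r ?sqdev_ge0// lee_fin; lra.
- by rewrite lee_wpmul2r ?near_energy_ge0// lee_fin; lra.
Qed.

(** If no constant were suitable, then none of the values [u x] with [x] in [A]
    would be, and averaging their deviations over [A] would exceed the energy; the
    slack [eta] makes the excess strict. *)
Lemma small_sqdev A : measurable A -> (0 < m A)%E ->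
  (forall x y, A x -> A y -> enorm (x - y) < delta) ->
  forall u, measurable_fun setT u -> (near_energy u < +oo)%E ->
  forall eta : R, 0 < eta ->
  exists c, (sqdev A u c <= (fine (m A))^-1%:E * (near_energy u + eta%:E))%E.
Proof.
move=> mA A0 Ad u mu Efin eta eta0; apply: contrapT => nc.
have mAfin : m A \is a fin_num by exact: fin_num_measure.
have a0 : 0 < fine (m A) by rewrite fine_gt0// A0 ltey_eq mAfin.
pose I x := (\int[m]_y (near_diff u (x, y))%:E)%E.
have : ((fine (m A))^-1%:E * (near_energy u + eta%:E) * m A <= near_energy u)%E.
  rewrite [leRHS]near_energyE// -integral_cst//.
  apply: (@le_trans _ _ (\int[m]_(x in A) I x)%E); last first.
    apply: ge0_subset_integral => //; first exact: measurable_near_diff_int.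
    by move=> x _; apply: integral_ge0 => y _; rewrite lee_fin near_diff_ge0.
  apply: ge0_le_integral => //.
  - move=> x _; rewrite mule_ge0// ?lee_fin ?invr_ge0 ?ltW//.
    by rewrite (@lt_le_trans _ _ eta%:E) ?lte_fin// leeDr// near_energy_ge0.
  - by apply: measurable_funTS; exact: measurable_near_diff_int.
  move=> x Ax; apply: (@le_trans _ _ (sqdev A u (u x))).
    by rewrite leNgt; apply/negP => /ltW h; apply: nc; exists (u x).
  apply: (@le_trans _ _ (\int[m]_(y in A) (near_diff u (x, y))%:E)%E).
    apply: ge0_le_integral => //.
    - by move=> y _; rewrite lee_fin sqr_ge0.
    - exact: measurable_sqdev.
    - by apply: measurable_funTS; exact: measurable_near_diff_section.
    - by move=> y Ay; rewrite /near_diff/= Ad// lee_fin -opprB sqrrN.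
  apply: ge0_subset_integral => //; first exact: measurable_near_diff_section.
  by move=> y _; rewrite lee_fin near_diff_ge0.
rewrite -(fineK mAfin) muleAC -EFinM mulVf ?gt_eqF// mul1e.
have Ef : near_energy u \is a fin_num by rewrite ge0_fin_numE ?near_energy_ge0.
by rewrite -(fineK Ef) -EFinD lee_fin gerDl leNgt eta0.
Qed.

Lemma controls_set0 A : controls A set0.
Proof.
exists 0; split => // u mu c; rewrite mul0e /sqdev integral_set0.
exact: lexx.
Qed.

Lemma enorm_le_norm (x : 'rV[R]_n) (r : R) : 0 < r -> (forall i, `|x ord0 i| < r) ->
  enorm x <= n%:R * r.
Proof.
move=> r0 xr; rewrite -[leRHS]ger0_norm ?mulr_ge0 ?(ltW r0)//.
rewrite -sqrtr_sqr ler_wsqrtr//.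
apply: (@le_trans _ _ (\sum_(i < n) r ^+ 2)).
  apply: ler_sum => i _; rewrite -real_normK ?num_real// lerXn2r ?nnegrE//.
    exact: ltW.
  exact/ltW/xr.
rewrite sumr_const card_ord -[leLHS]mulr_natl exprMn ler_wpM2r ?sqr_ge0//.
by rewrite -natrX ler_nat; case: (n) => // k; rewrite -mulnn leq_pmulr.
Qed.

Variable Omega : set 'rV[R]_n.
Hypothesis Omega_neq0 : Omega !=set0.
Hypothesis Omega_open : open Omega.
Hypothesis Omega_connected : connected Omega.
Hypothesis Omega_bounded : bounded_set Omega.
Hypothesis delta_gt0 : 0 < delta.
Hypothesis m_open_gt0 : forall U : set 'rV[R]_n, open U -> (Omega `&` U) !=set0 ->
  (0 < m U)%E.
Hypothesis m_Omega : m (~` Omega) = 0%E.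

(** Chains of overlapping balls join any two points of a connected set, and
    finitely many balls cover a bounded one. *)
Theorem nonlocal_poincare : exists C : R, 0 <= C /\
  forall u, measurable_fun setT u -> (near_energy u < +oo)%E ->
  forall eta : R, 0 < eta ->
  exists c, (\int[m]_x ((u x - c) ^+ 2)%:E <= C%:E * (near_energy u + eta%:E))%E.
Proof.
(* [n.+1] rather than [n] covers dimension 0 *)
pose r := delta / (4 * n.+1%:R).
have r0 : 0 < r by rewrite divr_gt0// mulr_gt0.
have near3 (x y : 'rV[R]_n) : (forall i, `|x ord0 i - y ord0 i| < 3 * r) ->
    enorm (x - y) < delta.
  move=> xy; apply: (@le_lt_trans _ _ (n%:R * (3 * r))).
    by apply: enorm_le_norm => [|i]; rewrite ?mulr_gt0// !mxE.
  have -> : delta = n.+1%:R * (4 * r).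
    have k0 : n.+1%:R != 0 :> R by rewrite pnatr_eq0.
    by rewrite /r; move: k0; move: (n.+1%:R) => k k0; field.
  by rewrite -natr1; have := ler0n R n; nra.
have mball (x : 'rV[R]_n) : measurable (ball x r).
  by apply: open_measurable_rV; exact: ball_open.
have ball_gt0 x : Omega x -> (0 < m (ball x r))%E.
  move=> Ox; apply: m_open_gt0; first exact: ball_open.
  by exists x; split => //; exact: ballxx.
have step x y : Omega x -> ball x r y -> controls (ball x r) (ball y r).
  move=> Ox [_ xy]; apply: controls_near => //; first exact: ball_gt0.
  move=> a b [_ xa] [_ yb]; apply: near3 => i.
  have := xy ord0 i; have := xa ord0 i; have := yb ord0 i.
  rewrite /ball/= => h1 h2 h3.
  rewrite (_ : _ - _ = - (x ord0 i - a ord0 i) + (x ord0 i - y ord0 i) +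
    (y ord0 i - b ord0 i)); last by ring.
  rewrite (le_lt_trans (ler_normD _ _))// (_ : 3 * r = r + r + r); last by ring.
  by rewrite ltrD// (le_lt_trans (ler_normD _ _))// ltrD// normrN.
have [x0 Ox0] := Omega_neq0.
pose G := [set x | Omega x /\ controls (ball x0 r) (ball x r)].
have GO : G = Omega.
  apply: Omega_connected.
  - by exists x0; split => //; exact: controls_refl.
  (* [G] is open and closed in [Omega] *)
  - exists (\bigcup_(x in G) ball x r); first by apply: bigcup_open => x _; exact: ball_open.
    apply/seteqP; split => [x Gx|x [Ox [y [Oy cy] yx]]].
      by split; [exact: Gx.1|exists x => //; exact: ballxx].
    by split; [exact: Ox|exact: (controls_trans cy (step _ _ Oy yx))].
  - exists (closure G); first exact: closed_closure.
    apply/seteqP; split => [x Gx|x [Ox cGx]].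
      by split; [exact: Gx.1|exact: subset_closure].
    have [y [[Oy cy] xy]] := cGx (ball x r) (nbhsx_ballx x r r0).
    split; first exact: Ox.
    exact: (controls_trans cy (step _ _ Oy (ball_sym xy))).
have cl : compact (closure Omega).
  apply: bounded_closed_compact; last exact: closed_closure.
  have [M [Mr OM]] := Omega_bounded; exists M; split => // M' MM'.
  have cM : closed [set x : 'rV[R]_n | `|x| <= M'].
    rewrite (_ : [set x | _] = (fun x : 'rV[R]_n => `|x|) @^-1` [set t | t <= M'])//.
    apply: closed_comp; last exact: closed_le.
    by move=> x _; exact: norm_continuous.
  have OM' : Omega `<=` [set x : 'rV[R]_n | `|x| <= M'] by move=> x; exact: OM.
  by move=> x /(closureS OM'); rewrite -(closure_id _).1.
rewrite compact_cover in cl.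
have [x _||D DO cD] := cl _ Omega (fun x => ball x r).
- exact: ball_open.
- move=> x clx; have [y [Oy xy]] := clx _ (nbhsx_ballx x r r0).
  by exists y => //; exact: ball_sym.
have cov (s : seq 'rV[R]_n) : (forall x, x \in s -> Omega x) ->
    measurable (\big[setU/set0]_(x <- s) ball x r) /\
    controls (ball x0 r) (\big[setU/set0]_(x <- s) ball x r).
  elim: s => [|x s IH] sO; first by rewrite big_nil; split => //; exact: controls_set0.
  have [|ms cs] := IH; first by move=> y ys; apply: sO; rewrite inE ys orbT.
  rewrite big_cons; split; first exact: measurableU.
  apply: controls_setU => //; have : G x by rewrite GO; apply: sO; rewrite inE eqxx.
  by case.
have [mB [C [C0 CP]]] := cov (finmap.enum_fset D) (fun x xD => set_mem (DO x xD)).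
set B := \big[setU/set0]_(x <- _) _ in mB CP.
have OB : Omega `<=` B.
  move=> x Ox; have [y yD xy] := cD x (subset_closure Ox).
  by rewrite /B -bigcup_seq; exists y.
pose a := fine (m (ball x0 r)).
have a0 : 0 < a.
  by rewrite fine_gt0// ball_gt0// ltey_eq fin_num_measure.
exists (C * (a^-1 + 1)); split => [|u mu Efin eta eta0].
  by rewrite mulr_ge0// addr_ge0// invr_ge0 ltW.
have [|c cP] := small_sqdev (mball x0) (ball_gt0 _ Ox0) _ mu Efin eta0.
  move=> x y [_ hx] [_ hy]; apply: near3 => i.
  have := hx ord0 i; have := hy ord0 i; rewrite /ball/= => h1 h2.
  rewrite (_ : _ - _ = - (x0 ord0 i - x ord0 i) + (x0 ord0 i - y ord0 i)); last by ring.
  rewrite (le_lt_trans (ler_normD _ _))// (@lt_trans _ _ (r + r))//.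
    by rewrite ltrD// normrN.
  by lra.
exists c; apply: (@le_trans _ _ (sqdev B u c)).
  rewrite /sqdev [leLHS](@ge0_negligible_integral _ _ _ _ _ (~` Omega))//.
  - rewrite setTD setCK ge0_subset_integral//.
    + exact: open_measurable_rV.
    + exact: measurable_sqdev.
    + by move=> x _; rewrite lee_fin sqr_ge0.
  - by apply: measurableC; exact: open_measurable_rV.
  - exact: measurable_sqdev.
  - by move=> x _; rewrite lee_fin sqr_ge0.
apply: (le_trans (CP u mu c)); rewrite EFinM -muleA lee_wpmul2l ?lee_fin//.
have s0 : (0 <= near_energy u + eta%:E)%E.
  by rewrite adde_ge0 ?near_energy_ge0// lee_fin ltW.
rewrite EFinD ge0_muleDl ?lee_fin ?invr_ge0 ?(ltW a0)// mul1e.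
apply: leeD; first exact: cP.
by rewrite leeDl// lee_fin ltW.
Qed.

End poincare.

(** * Integrals of functions of the distance *)

Section pushforward_finite.
Context d1 d2 (X : measurableType d1) (Y : measurableType d2) (R : realType).
Variables (m : {finite_measure set X -> \bar R}) (phi : X -> Y).
Hypothesis mphi : measurable_fun setT phi.

(** This copy of the image measure carries the proof that [phi] is measurable, from
    which its structure of finite measure is inferred. *)
Definition pushforward_fin of measurable_fun setT phi : set Y -> \bar R :=
  pushforward m phi.

Local Notation P := (pushforward_fin mphi).

Let pushforward_measure : {measure set Y -> \bar R} :=
  measure_function_pushforward__canonical__measure_function_Measure m mphi.

HB.instance Definition _ := isMeasure.Build _ _ _ P
  (measure0 pushforward_measure) (measure_ge0 pushforward_measure)
  (@measure_semi_sigma_additive _ _ _ pushforward_measure).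

Let pushforward_fin_fin : fin_num_fun P.
Proof.
move=> A mA; apply: fin_num_measure.
by rewrite -[X in measurable X]setTI; exact: mphi.
Qed.

HB.instance Definition _ := Measure_isFinite.Build _ _ _ P pushforward_fin_fin.

Lemma integral_sqr_pushforward (g : Y -> R) : measurable_fun setT g ->
  (\int[P]_y (g y ^+ 2)%:E = \int[m]_x ((g \o phi) x ^+ 2)%:E)%E.
Proof.
move=> mg; rewrite (@ge0_integral_pushforward _ _ _ _ _ _ mphi)//.
  by apply/measurable_EFinP; exact: measurable_funX.
by move=> x _; rewrite /= lee_fin sqr_ge0.
Qed.

Lemma sqint_pushforward (g : Y -> R) : sqint P g -> sqint m (g \o phi).
Proof.
move=> [mg /integrable_lty g2]; apply: sqintE; first exact: measurableT_comp.
by rewrite -integral_sqr_pushforward//; exact: g2.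
Qed.

Lemma ip_pushforward (g : Y -> R) : sqint P g ->
  ip m (g \o phi) (g \o phi) = ip P g g.
Proof.
move=> Lg; apply: EFin_inj; rewrite !EFin_ip//; last exact: sqint_pushforward.
by rewrite integral_sqr_pushforward//; exact: Lg.1.
Qed.

Variable l : {sigma_finite_measure set Y -> \bar R}.
Hypothesis null : forall A, measurable A -> l A = 0%E -> m (phi @^-1` A) = 0%E.

(** Integrals against [f] of functions of [phi] are integrals over the values of
    [phi]: the Riesz theorem in the space of square integrable functions of the
    image measure provides a conditional expectation of [f], to be multiplied by
    the Radon-Nikodym density of the image measure. *)
Lemma disintegration (f : X -> R) : sqint m f ->
  exists g : Y -> R, l.-integrable setT (EFin \o g) /\
  forall (tau : Y -> R) (M : R), measurable_fun setT tau ->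
    (forall y, `|tau y| <= M) ->
    \int[m]_x (tau (phi x) * f x) = \int[l]_y (tau y * g y).
Proof.
move=> Lf.
have [|c u v Lu Lv||rho [Lrho rhoE]] :=
    @riesz_representation _ _ (@lcomb R Y) (sqint P) (ip P)
      (fun tau => ip m (tau \o phi) f) (ip_sip P) _ (@sqint_complete _ _ _ P).
- by exists (fun=> 0); exact: sqint0.
- by rewrite (_ : _ \o _ = lcomb c (u \o phi) (v \o phi))//
    (sipD (ip_sip m)) //; exact: sqint_pushforward.
- exists (ip m f f) => tau Ltau; rewrite -(ip_pushforward Ltau) mulrC.
  by apply: (cauchy_schwarz (ip_sip m)) => //; exact: sqint_pushforward.
have Pl : P `<< l by apply/null_content_dominatesP => A mA; exact: null.
pose p := Radon_Nikodym_SigmaFinite.f P l.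
have pfin y : p y \is a fin_num by exact: Radon_Nikodym_SigmaFinite.f_fin_num.
have mp : measurable_fun setT p.
  exact: measurable_int (Radon_Nikodym_SigmaFinite.f_integrable _).
have Prho : P.-integrable setT (EFin \o rho).
  have := sqint_integrableM Lrho (_ : sqint P (cst 1)).
  under eq_fun do rewrite mulr1; apply.
  apply: sqintE => //; under eq_integral do rewrite expr1n.
  by rewrite integral_cst// mul1e ltey_eq fin_num_measure.
have ig : l.-integrable setT (fun y => (rho y)%:E * p y)%E.
  have -> : (fun y => (rho y)%:E * p y)%E =
     ((EFin \o rho)^\+ \* p \- (EFin \o rho)^\- \* p)%E.
    apply/funext => y; rewrite /= -muleBl//; first by rewrite -[LHS]/((EFin \o rho) y * p y)%E {1}(funeposneg (EFin \o rho)).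
    exact: add_def_funeposneg.
  apply: integrableB => //.
  - by apply: Radon_Nikodym_SigmaFinite.integrableM => //; exact: integrable_funepos.
  - by apply: Radon_Nikodym_SigmaFinite.integrableM => //; exact: integrable_funeneg.
exists (fun y => rho y * fine (p y)); split.
  by move: ig; apply: eq_integrable => // y _; rewrite /= EFinM fineK.
move=> tau M mtau tauM.
have Ltau : sqint P tau.
  apply: (@le_sqint _ _ _ _ _ (cst M)) => //.
    by move=> y /=; rewrite (le_trans (tauM y))// ler_norm.
  apply: sqintE => //.
  rewrite -[ltLHS]/(\int[P]_x cst (M ^+ 2)%:E x)%E integral_cst//.
  by rewrite lte_mul_pinfty// ?lee_fin ?sqr_ge0// ltey_eq fin_num_measure.
have := rhoE _ Ltau; rewrite /ip /= => <-; congr fine.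
have itr : P.-integrable setT (EFin \o (fun y => rho y * tau y)).
  exact: sqint_integrableM.
rewrite -(Radon_Nikodym_change_of_variables Pl measurableT itr).
apply: ae_eq_integral => //.
- apply: emeasurable_funM; first exact: measurable_int itr.
  apply: measurable_int; exact: Radon_Nikodym_integrable.
- apply/measurable_EFinP; apply: measurable_funM => //; apply: measurable_funM => //.
    exact: Lrho.1.
  exact: measurableT_comp (fine_measurable measurableT) mp.
have := ae_eq_Radon_Nikodym_SigmaFinite Pl measurableT.
apply: filterS => y /(_ I) <- _ /=; rewrite -/p !EFinM fineK//.
by rewrite muleA [X in (X * _)%E]muleC.
Qed.

End pushforward_finite.

(** * Weighted nonlocal energies *)

Section finite_measure_lemmas.
Context d (T : measurableType d) (R : realType).
Variable m : {finite_measure set T -> \bar R}.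

Lemma sqint_cst (c : R) : sqint m (cst c).
Proof.
apply: sqintE => //; rewrite -[ltLHS]/(\int[m]_x cst (c ^+ 2)%:E x)%E integral_cst//.
by rewrite lte_mul_pinfty// ?lee_fin ?sqr_ge0// ltey_eq fin_num_measure.
Qed.

Lemma ip0 d' (T' : measurableType d') (l : {measure set T' -> \bar R}) (f : T' -> R) :
  ip l f (fun=> 0) = 0.
Proof.
rewrite /ip /Rintegral; under eq_integral do rewrite mulr0.
by rewrite integral0.
Qed.

Lemma sqint_integrable (f : T -> R) : sqint m f -> m.-integrable setT (EFin \o f).
Proof.
move=> Lf; have := sqint_integrableM Lf (sqint_cst 1).
by apply: eq_integrable => // x _; rewrite /= mulr1.
Qed.

Lemma sqint_fst (u : T -> R) : sqint m u -> sqint (m \x m)%E (fun z => u z.1).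
Proof.
move=> [mu /integrable_lty u2].
apply: sqintE; first exact: (measurableT_comp mu measurable_fst).
rewrite fubini_tonelli1//; last 2 first.
- apply/measurable_EFinP; apply: measurable_funX.
  exact: (measurableT_comp mu measurable_fst).
- by move=> z; rewrite lee_fin sqr_ge0.
rewrite (eq_integral (fun x => ((u x ^+ 2)%:E * m setT)%E)); last first.
  by move=> x _; rewrite /fubini_F/= -[LHS]/(\int[m]_y cst (u x ^+ 2)%:E y)%E integral_cst.
rewrite ge0_integralZr//.
- have u0 : (0 <= \int[m]_x (u x ^+ 2)%:E)%E.
    by apply: integral_ge0 => x _; rewrite lee_fin sqr_ge0.
  by rewrite lte_mul_pinfty ?ge0_fin_numE ?u2// ltey_eq fin_num_measure.
- by apply/measurable_EFinP; exact: measurable_funX.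
- by move=> x _; rewrite lee_fin sqr_ge0.
Qed.

Lemma sqint_snd (u : T -> R) : sqint m u -> sqint (m \x m)%E (fun z => u z.2).
Proof.
move=> [mu /integrable_lty u2].
apply: sqintE; first exact: (measurableT_comp mu measurable_snd).
rewrite fubini_tonelli1//; last 2 first.
- apply/measurable_EFinP; apply: measurable_funX.
  exact: (measurableT_comp mu measurable_snd).
- by move=> z; rewrite lee_fin sqr_ge0.
rewrite -[ltLHS]/(\int[m]_x cst (\int[m]_y (u y ^+ 2)%:E) x)%E integral_cst//.
have u0 : (0 <= \int[m]_x (u x ^+ 2)%:E)%E.
  by apply: integral_ge0 => x _; rewrite lee_fin sqr_ge0.
by rewrite lte_mul_pinfty ?ge0_fin_numE ?u2// ltey_eq fin_num_measure.
Qed.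

Lemma ae_prod (P : T -> Prop) : (\forall x \ae m, P x) ->
  \forall z \ae (m \x m)%E, P z.1 /\ P z.2.
Proof.
move=> [Z [mZ Z0 hZ]]; exists (Z `*` setT `|` setT `*` Z); split.
- by apply: measurableU; exact: measurableX.
- rewrite measureU0//; [|exact: measurableX..|].
    by transitivity (m Z * m setT)%E; [exact: product_measure1E|rewrite Z0 mul0e].
  by transitivity (m setT * m Z)%E; [exact: product_measure1E|rewrite Z0 mule0].
move=> z /= nz; have [P1|nP1] := pselect (P z.1); last first.
  by left; split => //; exact: hZ.
by right; split => //; apply: hZ => P2; exact: nz.
Qed.

(** Against an antisymmetric kernel both variables contribute equally. *)
Lemma Rintegral_antisym (G : T * T -> R) (v : T -> R) :
  sqint (m \x m)%E G -> sqint m v ->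
  (forall x y, G (y, x) = - G (x, y)) ->
  (forall x, m.-integrable setT (fun y => (G (x, y))%:E)) ->
  \int[(m \x m)%E]_z (G z * (v z.1 - v z.2)) =
  2 * \int[m]_x (v x * \int[m]_y G (x, y)).
Proof.
move=> LG Lv Ganti iG; pose h x := \int[m]_y G (x, y).
have L1 := sqint_fst Lv; have L2 := sqint_snd Lv.
have i1 := sqint_integrableM LG L1; have i2 := sqint_integrableM LG L2.
have F1 x : fubini_F m (EFin \o (fun z => G z * v z.1)) x = (v x * h x)%:E.
  rewrite /fubini_F/=; under eq_integral do rewrite EFinM.
  rewrite integralZr// EFinM muleC /h /Rintegral fineK//.
  exact: integrable_fin_num (iG x).
have ivh : m.-integrable setT (EFin \o (fun x => v x * h x)).
  by apply: eq_integrable (integrable_fubini_F i1) => // x _; exact: F1.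
have E1 : \int[(m \x m)%E]_z (G z * v z.1) = \int[m]_x (v x * h x).
  rewrite /Rintegral -(integral12_prod_meas1 i1); congr fine.
  by apply: eq_integral => x _; exact: F1.
have E2 : \int[(m \x m)%E]_z (G z * v z.2) = - \int[m]_x (v x * h x).
  transitivity (\int[m]_x (- (v x * h x))).
    rewrite /Rintegral -(integral21_prod_meas1 i2); congr fine.
    apply: eq_integral => y _; rewrite /fubini_G/=.
    under eq_integral do rewrite (Ganti y) mulNr mulrC -mulNr EFinM.
    rewrite integralZl//.
    rewrite -mulNr EFinM; congr (_ * _)%E.
    by rewrite /h /Rintegral fineK//; exact: integrable_fin_num (iG y).
  rewrite -[RHS]mulN1r -RintegralZl//.
  by apply: eq_Rintegral => x _; rewrite mulN1r.
rewrite (_ : \int[(m \x m)%E]_z (G z * (v z.1 - v z.2)) =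
  \int[(m \x m)%E]_z (lcomb (-1) (fun z => G z * v z.2) (fun z => G z * v z.1) z)).
  by rewrite Rintegral_lcomb// E1 E2; ring.
by apply: eq_Rintegral => z _; rewrite /lcomb; ring.
Qed.

End finite_measure_lemmas.

Lemma sqint_ae d (X : measurableType d) (R : realType) (l : {measure set X -> \bar R})
    (f g : X -> R) : measurable_fun setT f -> sqint l g ->
  (\forall x \ae l, f x = g x) -> sqint l f.
Proof.
move=> mf [mg g2] fg; apply: sqintE => //.
rewrite (ae_eq_integral (fun x => (g x ^+ 2)%:E))//.
- exact: integrable_lty g2.
- by apply/measurable_EFinP; exact: measurable_funX.
- by apply/measurable_EFinP; exact: measurable_funX.
- by apply: filterS fg => x -> _.
Qed.

(** A multiplicative constant in the rate of convergence is absorbed by dropping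
    finitely many terms. *)
Lemma riesz_fischer_shift d (T : measurableType d) (R : realType)
    (m : {measure set T -> \bar R}) (u_ : (T -> R)^nat) (C : R) :
  (forall n, sqint m (u_ n)) ->
  (forall n, sqdist (@lcomb R T) (ip m) (u_ n) (u_ n.+1) <= C * 16^-1 ^+ n) ->
  exists u, exists N, [/\ sqint m u,
    sqdist (@lcomb R T) (ip m) u (u_ n) @[n --> \oo] --> 0 &
    \forall x \ae m, u_ (n + N)%N x @[n --> \oo] --> u x].
Proof.
move=> Lu du; pose N := Num.truncn `|C|.
have CN : C <= 16 ^+ N.+1.
  rewrite (le_trans (ler_norm C))// (le_trans (ltW (truncnS_gt _)))//.
  rewrite -natrX ler_nat; exact/ltnW/ltn_expl.
have [|n|u [Lu' du' cu]] := @riesz_fischer _ _ _ m (fun n => u_ (n + N.+1)%N).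
- by move=> n; exact: Lu.
- rewrite addSn; apply: (le_trans (du _)).
  apply: (@le_trans _ _ (16 ^+ N.+1 * 16^-1 ^+ (n + N.+1))).
    by rewrite ler_wpM2r// exprn_ge0.
  by rewrite exprD mulrCA -exprMn divff// expr1n mulr1.
exists u, N.+1; split => //.
by have := du'; rewrite (cvg_shiftn N.+1 (fun n => sqdist (@lcomb R T) (ip m) u (u_ n))).
Qed.

Section nonlocal_energy.
Context {R : realType} {n : nat}.
Variables (m : {finite_measure set 'rV[R]_n -> \bar R}).
Variables (kappa : R -> R) (delta g1 g2 : R).
Local Notation T := 'rV[R]_n.
Local Notation m2 := (m \x m)%E.
Implicit Types (u v : T -> R) (w : R -> R).

Hypothesis mkappa : measurable_fun setT kappa.
Hypothesis kappa_ge0 : forall t, 0 <= kappa t.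
Hypothesis kappa_far : forall e, 0 < e -> exists C, 0 <= C /\
  forall t, e <= t -> kappa t <= C.
Hypothesis kappa_near : exists c, 0 < c /\ forall t, 0 < t < delta -> c <= kappa t.
Hypothesis delta_gt0 : 0 < delta.
Hypothesis g1_gt0 : 0 < g1.
Hypothesis g12 : g1 <= g2.

Definition dist (z : T * T) : R := enorm (z.1 - z.2).

(** The weighted energy is the squared norm of this function of pairs of points, so
    that the completeness of the space of square integrable functions applies. *)
Definition wdiff w u (z : T * T) : R := Num.sqrt (w (dist z)) * (u z.1 - u z.2).

Definition finite_energy u : Prop := sqint m u /\ sqint m2 (wdiff kappa u).

Definition lower_bound (t : R) : R := if t < delta then g1 else 0.

(** The bounds hold at every point, which spares null sets of distances. *)
Definition good_weight w : Prop :=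
  measurable_fun setT w /\ forall t, lower_bound t <= w t <= g2.

Lemma g2_ge0 : 0 <= g2. Proof. by rewrite (le_trans (ltW g1_gt0)). Qed.

Lemma good_weight_ge0 w t : good_weight w -> 0 <= w t.
Proof.
by move=> [_ /(_ t)/andP[+ _]]; apply: le_trans; rewrite /lower_bound; case: ifP => // _; exact: ltW.
Qed.

Lemma measurable_dist : measurable_fun setT dist.
Proof. exact: measurable_enorm_diff. Qed.

Lemma measurable_diff u : measurable_fun setT u ->
  measurable_fun setT (fun z : T * T => u z.1 - u z.2).
Proof.
move=> mu; apply: measurable_funB.
- exact: (measurableT_comp mu measurable_fst).
- exact: (measurableT_comp mu measurable_snd).
Qed.

Lemma sqint_diff u : sqint m u -> sqint m2 (fun z : T * T => u z.1 - u z.2).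
Proof.
move=> Lu; have := sqint_lcomb (-1) (sqint_snd Lu) (sqint_fst Lu).
by congr sqint; apply/funext => z; rewrite /lcomb mulN1r addrC.
Qed.

Lemma measurable_weight w : measurable_fun setT w ->
  measurable_fun setT (fun z => w (dist z)).
Proof. by move=> mw; exact: (measurableT_comp mw measurable_dist). Qed.

Lemma measurable_wdiff w u : measurable_fun setT w -> measurable_fun setT u ->
  measurable_fun setT (wdiff w u).
Proof.
move=> mw mu; apply: measurable_funM; last exact: measurable_diff.
apply: (measurableT_comp (continuous_measurable_fun (@sqrt_continuous R))).
exact: measurable_weight.
Qed.

Lemma wdiff_lcomb w c u v : wdiff w (lcomb c u v) = lcomb c (wdiff w u) (wdiff w v).
Proof. by apply/funext => z; rewrite /wdiff /lcomb; ring. Qed.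

Lemma wdiff_sqr w u z : 0 <= w (dist z) ->
  wdiff w u z ^+ 2 = w (dist z) * (u z.1 - u z.2) ^+ 2.
Proof. by move=> w0; rewrite /wdiff exprMn sqr_sqrtr. Qed.

Definition kw w t : R := kappa t * w t.

Lemma kw_ge0 w t : good_weight w -> 0 <= kw w t.
Proof. by move=> gw; rewrite mulr_ge0// good_weight_ge0. Qed.

Lemma measurable_kw w : good_weight w -> measurable_fun setT (kw w).
Proof. by move=> [mw _]; exact: measurable_funM. Qed.

Lemma sqr_le_norm (a b : R) : a ^+ 2 <= b ^+ 2 -> `|a| <= `|b|.
Proof.
by move=> ab; rewrite -ler_sqr ?nnegrE// !real_normK ?num_real.
Qed.

Lemma finite_energy_wdiff w u : good_weight w -> finite_energy u ->
  sqint m2 (wdiff (kw w) u).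
Proof.
move=> gw [Lu Lk]; apply: (le_sqint _ _ (sqintZ (Num.sqrt g2) Lk)).
  by apply: measurable_wdiff; [exact: measurable_kw|exact: Lu.1].
move=> z; apply: sqr_le_norm; rewrite [leRHS]exprMn sqr_sqrtr ?g2_ge0//.
rewrite !wdiff_sqr//; last exact: kw_ge0.
rewrite [leRHS]mulrA ler_wpM2r ?sqr_ge0// /kw [leRHS]mulrC ler_wpM2l//.
by have [_ /(_ (dist z))/andP[]] := gw.
Qed.

(** Only the values of the weight below [delta] matter for the finiteness of the
    energy, since the kernel is bounded beyond [delta]. *)
Lemma wdiff_finite_energy w u : good_weight w -> sqint m u ->
  sqint m2 (wdiff (kw w) u) -> finite_energy u.
Proof.
move=> gw Lu Lw; split => //; have [C [C0 CP]] := kappa_far delta_gt0.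
have i1 := integrable_lcomb g1^-1 Lw.2 (integrable_lcomb C (sqint_diff Lu).2
  (integrable0 m2 setT)).
split; first by apply: measurable_wdiff => //; exact: Lu.1.
move: i1; apply: le_integrable => //.
  apply/measurable_EFinP; apply: measurable_funX.
  by apply: measurable_wdiff => //; exact: Lu.1.
move=> z _; rewrite /= lee_fin [leLHS]ger0_norm ?sqr_ge0// (le_trans _ (ler_norm _))//.
rewrite /lcomb !wdiff_sqr//; last exact: kw_ge0.
rewrite addr0 [X in _ <= X + _]mulrA -mulrDl ler_wpM2r ?sqr_ge0// /kw.
have [_ /(_ (dist z))/andP[+ _]] := gw; rewrite /lower_bound; case: ifPn => [_ w1|].
  rewrite (@le_trans _ _ (kappa (dist z) * (g1^-1 * g1)))//.
    by rewrite mulVf ?gt_eqF// mulr1.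
  rewrite (@le_trans _ _ (kappa (dist z) * (g1^-1 * w (dist z))))//.
    by rewrite ler_wpM2l// ler_wpM2l// invr_ge0 ltW.
  by rewrite mulrCA lerDl.
rewrite -leNgt => /CP kC w0; rewrite (le_trans kC)// lerDr mulr_ge0 ?invr_ge0 ?(ltW g1_gt0)//.
exact: mulr_ge0.
Qed.

Lemma energy_lcomb c u v : finite_energy u -> finite_energy v ->
  finite_energy (lcomb c u v).
Proof.
move=> [Lu Eu] [Lv Ev]; split; first exact: sqint_lcomb.
by rewrite wdiff_lcomb; exact: sqint_lcomb.
Qed.

Lemma energy0 : finite_energy (fun=> 0).
Proof.
split; first exact: sqint0.
rewrite (_ : wdiff _ _ = fun=> 0); first exact: sqint0.
by apply/funext => z; rewrite /wdiff subrr mulr0.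
Qed.

(** ** The quadratic form of the lower level problem *)

Variable S : (T -> R) -> (T -> R).
Hypothesis S_sqint : forall u, sqint m u -> sqint m (S u).
Hypothesis S_lin : forall c u v, sqint m u -> sqint m v ->
  \forall x \ae m, S (lcomb c u v) x = lcomb c (S u) (S v) x.
Hypothesis S_bounded : exists C, 0 <= C /\ forall u, sqint m u ->
  ip m (S u) (S u) <= C * ip m u u.
Hypothesis S_one : 0 < ip m (S (cst 1)) (S (cst 1)).
Hypothesis poincare : exists C, 0 <= C /\
  forall u, measurable_fun setT u -> (near_energy m delta u < +oo)%E ->
  forall eta, 0 < eta ->
  exists c, (\int[m]_x ((u x - c) ^+ 2)%:E <= C%:E * (near_energy m delta u + eta%:E))%E.

Definition aform w u v : R :=
  ip m (S u) (S v) + ip m2 (wdiff (kw w) u) (wdiff (kw w) v).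

Lemma ip_S_lcomb c u v g : sqint m u -> sqint m v -> sqint m g ->
  ip m (S (lcomb c u v)) g = c * ip m (S u) g + ip m (S v) g.
Proof.
move=> Lu Lv Lg; rewrite (ip_ae _ _ Lg (S_lin c Lu Lv)).
- by rewrite (sipD (ip_sip m)) //; exact: S_sqint.
- exact/S_sqint/sqint_lcomb.
- by apply: sqint_lcomb; exact: S_sqint.
Qed.

Lemma aform_sip w : good_weight w ->
  semi_inner_product (@lcomb R T) finite_energy (aform w).
Proof.
move=> gw; split=> [c u v Eu Ev|u v Eu Ev|c u v z Eu Ev Ez|u Eu].
- exact: energy_lcomb.
- rewrite /aform; congr (_ + _).
    by apply: (sipC (ip_sip m)); apply: S_sqint; [exact: Eu.1|exact: Ev.1].
  by apply: (sipC (ip_sip m2)); exact: finite_energy_wdiff.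
- rewrite /aform ip_S_lcomb ?wdiff_lcomb; [|exact: Eu.1|exact: Ev.1|exact/S_sqint/Ez.1].
  by rewrite (sipD (ip_sip m2)); [ring|exact: finite_energy_wdiff..].
- by apply: addr_ge0; apply: (sip_ge0 (ip_sip _)); [exact/S_sqint/Eu.1|exact: finite_energy_wdiff].
Qed.

Lemma le_near_energy w u c : 0 < c -> (forall t, 0 < t < delta -> c <= kappa t) ->
  good_weight w -> finite_energy u ->
  (near_energy m delta u <=
   ((c * g1)^-1 * ip m2 (wdiff (kw w) u) (wdiff (kw w) u))%:E)%E.
Proof.
move=> c0 cP gw Eu; have Lw := finite_energy_wdiff gw Eu.
have cg0 : 0 < c * g1 by rewrite mulr_gt0.
rewrite EFinM EFin_ip// -ge0_integralZl//; last 3 first.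
- by apply/measurable_EFinP; apply: measurable_funX; exact: Lw.1.
- by move=> z _; rewrite lee_fin sqr_ge0.
- by rewrite lee_fin invr_ge0 ltW.
apply: ge0_le_integral => //.
- by move=> z _; rewrite lee_fin near_diff_ge0.
- by apply/measurable_EFinP; apply: measurable_near_diff; exact: Eu.1.1.
- by apply: emeasurable_funM => //; apply/measurable_EFinP; apply: measurable_funX; exact: Lw.1.
move=> z _; rewrite -EFinM lee_fin wdiff_sqr; last exact: kw_ge0.
rewrite /near_diff -/(dist z); case: ifPn => [zd|_]; last first.
  by rewrite mulr_ge0 ?invr_ge0 ?(ltW cg0)// mulr_ge0 ?sqr_ge0// kw_ge0.
have := enorm_ge0 (z.1 - z.2); rewrite le_eqVlt => /orP[/eqP z0|z0].
  have /eqP := enorm0_eq0 (esym z0); rewrite subr_eq0 => /eqP ->.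
  by rewrite subrr expr0n /= !mulr0.
rewrite mulrA ler_peMl ?sqr_ge0// ler_pdivlMl// mulr1 /kw.
apply: ler_pM; rewrite ?(ltW c0) ?(ltW g1_gt0)//.
  by apply: cP; rewrite zd andbT.
by have [_ /(_ (dist z))/andP[+ _]] := gw; rewrite /lower_bound zd.
Qed.

(** By the Poincare inequality [u] is close to a constant [c], and [c S 1] is
    bounded by [S u] and [S (u - c)]. The constant depends on the bounds on the
    weights, not on the weight. *)
Theorem coercivity : exists C, 0 < C /\
  forall w u, good_weight w -> finite_energy u -> ip m u u <= C * aform w u u.
Proof.
have [C [C0 CP]] := poincare; have [CS [CS0 CSP]] := S_bounded.
have [k [k0 kP]] := kappa_near.
pose s1 := ip m (S (cst 1)) (S (cst 1)); pose mT := ip m (cst 1) (cst 1).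
have mT0 : 0 <= mT by apply: (sip_ge0 (ip_sip m)); exact: sqint_cst.
pose K2 := 4 * mT / s1.
pose K1 := 2 + 4 * mT * CS / s1.
have K20 : 0 <= K2 by rewrite divr_ge0 ?mulr_ge0// ltW.
have K10 : 0 <= K1 by rewrite addr_ge0// divr_ge0 ?mulr_ge0// ltW.
have kg0 : 0 < k * g1 by rewrite mulr_gt0.
pose C' := K1 * C * (k * g1)^-1 + K2 + 1.
have C'0 : 0 < C' by rewrite ltr_wpDl// addr_ge0// !mulr_ge0// invr_ge0 ltW.
exists C'; split => // w u gw Eu; have Lu := Eu.1.
set A := ip m u u; pose F := ip m2 (wdiff (kw w) u) (wdiff (kw w) u).
pose B := ip m (S u) (S u).
have B0 : 0 <= B by apply/(sip_ge0 (ip_sip m))/S_sqint.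
have F0 : 0 <= F by apply/(sip_ge0 (ip_sip m2))/finite_energy_wdiff.
have nE := le_near_energy k0 kP gw Eu; rewrite -/F in nE.
suff h eta : 0 < eta -> A <= K1 * (C * ((k * g1)^-1 * F + eta)) + K2 * B.
  have {}h : A <= K1 * (C * ((k * g1)^-1 * F)) + K2 * B.
    apply/ler_addgt0Pr => e e0; have KC0 : 0 < K1 * C + 1 by rewrite ltr_wpDl// mulr_ge0.
    have := h (e / (K1 * C + 1)) (divr_gt0 e0 KC0); move/le_trans; apply.
    have : K1 * C * (e / (K1 * C + 1)) <= e.
      by rewrite mulrCA ler_piMr ?(ltW e0)// ler_pdivrMr// mul1r lerDl.
    by lra.
  apply: (le_trans h); rewrite /aform -/B -/F /C'.
  have a1 : 0 <= K1 * C * (k * g1)^-1 by rewrite !mulr_ge0// invr_ge0 ltW.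
  have := mulr_ge0 a1 B0; have := mulr_ge0 K20 F0.
  rewrite [X in _ -> _ -> _ <= X](_ : _ = K1 * C / (k * g1) * B +
    K1 * C / (k * g1) * F + K2 * B + K2 * F + B + F); last by ring.
  by lra.
move=> eta0.
have [|c] := CP u Lu.1 _ eta eta0; first by rewrite (le_lt_trans nE)// ltry.
pose v := lcomb (- c) (cst 1) u.
have Lv : sqint m v by apply: sqint_lcomb => //; exact: sqint_cst.
have -> : (\int[m]_x ((u x - c) ^+ 2)%:E = (ip m v v)%:E)%E.
  rewrite EFin_ip//; apply: eq_integral => x _.
  by rewrite /v /lcomb /= mulr1 addrC.
have -> : near_energy m delta u = (fine (near_energy m delta u))%:E.
  by rewrite fineK// ge0_fin_numE ?near_energy_ge0// (le_lt_trans nE)// ltry.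
rewrite -EFinD -EFinM lee_fin => vC.
have {}vC : ip m v v <= C * ((k * g1)^-1 * F + eta).
  apply: (le_trans vC); rewrite ler_wpM2l// lerD2r -lee_fin fineK//.
  by rewrite ge0_fin_numE ?near_energy_ge0// (le_lt_trans nE)// ltry.
have LS1 : sqint m (S (cst 1)) by apply: S_sqint; exact: sqint_cst.
have LSu := S_sqint Lu; have LSv := S_sqint Lv.
have c2 : c ^+ 2 * s1 <= 2 * (CS * ip m v v) + 2 * B.
  have -> : c ^+ 2 * s1 = ip m (lcomb (-1) (S v) (S u)) (lcomb (-1) (S v) (S u)).
    pose z := (lcomb c (S (cst 1)) (fun=> 0)).
    have Lz : sqint m z by apply: sqint_lcomb => //; exact: sqint0.
    transitivity (ip m z z).
      rewrite (sip_quad (ip_sip m))//; last exact: sqint0.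
      by rewrite !ip0 mulr0 !add0r.
    apply: ip_ae_sq => //; first exact: sqint_lcomb.
    apply: filterS (S_lin (- c) (sqint_cst m 1) Lu) => x h.
    have {}h : S v x = - c * S (cst 1) x + S u x by exact: h.
    by rewrite /z /lcomb h; ring.
  apply: (le_trans (ip_lcombD _ _ _)) => //.
  by rewrite sqrrN expr1n mul1r lerD2r ler_wpM2l// CSP.
have u2 : A <= 2 * (c ^+ 2 * mT) + 2 * ip m v v.
  have -> : A = ip m (lcomb c (cst 1) v) (lcomb c (cst 1) v).
    by congr (ip m _ _); apply/funext => x; rewrite /v /lcomb /=; ring.
  by apply: ip_lcombD => //; exact: sqint_cst.
have v0 : 0 <= ip m v v by exact: (sip_ge0 (ip_sip m)).
apply: (@le_trans _ _ (K1 * ip m v v + K2 * B)); last first.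
  by rewrite lerD2r ler_wpM2l.
apply: (le_trans u2).
have s10 : s1 != 0 by rewrite gt_eqF.
have : c ^+ 2 * mT <= (2 * (CS * ip m v v) + 2 * B) * mT / s1.
  by rewrite ler_pdivlMr// mulrAC ler_wpM2r.
move=> h; rewrite (_ : K1 * ip m v v + K2 * B =
  2 * ((2 * (CS * ip m v v) + 2 * B) * mT / s1) + 2 * ip m v v).
  by rewrite lerD2r ler_wpM2l.
by rewrite /K1 /K2; field.
Qed.

Lemma aform_ge_wdiff w u : good_weight w -> finite_energy u ->
  ip m2 (wdiff (kw w) u) (wdiff (kw w) u) <= aform w u u.
Proof. by move=> gw Eu; rewrite lerDr; exact/(sip_ge0 (ip_sip m))/S_sqint/Eu.1. Qed.

(** By coercivity a Cauchy sequence converges in L2, and its weighted differences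
    converge as well; almost everywhere convergence identifies their limit. *)
Theorem aform_complete w : good_weight w ->
  sip_complete (@lcomb R T) finite_energy (aform w).
Proof.
move=> gw u_ Eu du; have [C [C0 CP]] := coercivity.
have Ed k : finite_energy (lcomb (-1) (u_ k) (u_ k.+1)) by exact: energy_lcomb.
have Lu k : sqint m (u_ k) by have [] := Eu k.
have LF k : sqint m2 (wdiff (kw w) (u_ k)) by exact: finite_energy_wdiff.
have [|u [N [Lu' du0 cu]]] := riesz_fischer_shift Lu (C := C).
  move=> k; rewrite /sqdist (le_trans (CP w _ gw (Ed k)))// ler_wpM2l//.
    exact: ltW.
  exact: du.
have [|F [N' [LF' dF0 cF]]] := riesz_fischer_shift LF (C := 1).
  move=> k; rewrite mul1r /sqdist -wdiff_lcomb (le_trans (aform_ge_wdiff gw (Ed k)))//.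
  exact: du.
have FE : \forall z \ae m2, wdiff (kw w) u z = F z.
  apply: filterS2 (ae_prod cu) cF => z [c1 c2] cF'.
  have : wdiff (kw w) (u_ k) z @[k --> \oo] --> wdiff (kw w) u z.
    apply: cvgMr; apply: cvgB.
      by rewrite -(cvg_shiftn N (fun k => u_ k z.1)).
    by rewrite -(cvg_shiftn N (fun k => u_ k z.2)).
  move: cF'; rewrite (cvg_shiftn N' (fun k => wdiff (kw w) (u_ k) z)) => cF' cw.
  exact: (cvg_unique _ cw cF').
have Lwu : sqint m2 (wdiff (kw w) u).
  apply: (sqint_ae _ LF' FE); apply: measurable_wdiff; last exact: Lu'.1.
  exact: measurable_kw.
have Eu' : finite_energy u by exact: (wdiff_finite_energy gw).
exists u; split => //; have [CS [CS0 CSP]] := S_bounded.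
apply: (@cvg0_le _ (fun k => CS * sqdist (@lcomb R T) (ip m) u (u_ k) +
   sqdist (@lcomb R (T * T)) (ip m2) F (wdiff (kw w) (u_ k)))).
  rewrite -[X in _ --> X](_ : CS * 0 + 0 = 0); last by rewrite mulr0 addr0.
  by apply: cvgD => //; exact: cvgMr.
move=> k; have Edk : finite_energy (lcomb (-1) u (u_ k)) by exact: energy_lcomb.
rewrite ger0_norm; last exact: (sip_ge0 (aform_sip gw)).
rewrite /sqdist /aform lerD//; first by apply: CSP; exact: Edk.1.
rewrite wdiff_lcomb le_eqVlt; apply/orP; left; apply/eqP.
apply: ip_ae_sq; [exact: sqint_lcomb..|].
by apply: filterS FE => z; rewrite /lcomb => ->.
Qed.

Variable y : T -> R.
Hypothesis Ly : sqint m y.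

Definition euler_lagrange w u : Prop := finite_energy u /\
  forall v, finite_energy v -> aform w u v = ip m (S v) y.

Theorem euler_lagrange_exists w : good_weight w -> exists u, euler_lagrange w u.
Proof.
move=> gw; apply: (riesz_representation (aform_sip gw) _ (aform_complete gw)).
- by exists (fun=> 0); exact: energy0.
- by move=> c u v Eu Ev; apply: ip_S_lcomb => //; [exact: Eu.1|exact: Ev.1].
exists (ip m y y) => v Ev; have LSv := S_sqint Ev.1.
apply: (le_trans (cauchy_schwarz (ip_sip m) LSv Ly)); rewrite mulrC ler_wpM2l//.
  exact: (sip_ge0 (ip_sip m)).
by rewrite lerDl; exact/(sip_ge0 (ip_sip m2))/finite_energy_wdiff.
Qed.

Definition objective w v : R :=
  ip m (lcomb (-1) y (S v)) (lcomb (-1) y (S v)) +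
  ip m2 (wdiff (kw w) v) (wdiff (kw w) v).

(** The Taylor expansion of the quadratic objective at a critical point. *)
Lemma objectiveE w u v : good_weight w -> euler_lagrange w u -> finite_energy v ->
  objective w v = objective w u + sqdist (@lcomb R T) (aform w) v u.
Proof.
move=> gw [Eu uP] Ev; rewrite (sqdistE (aform_sip gw))//.
have oE z : finite_energy z -> objective w z = aform w z z - 2 * ip m (S z) y + ip m y y.
  move=> Ez; have LSz := S_sqint Ez.1; rewrite /objective /aform (sip_quad (ip_sip m))//.
  by rewrite (sipC (ip_sip m) Ly LSz); ring.
rewrite !oE// -!uP// (sipC (aform_sip gw) Ev Eu); ring.
Qed.

(** A minimizer is at distance 0, for the energy form, of the solution provided by
    the Riesz theorem, and Cauchy-Schwarz transfers the equation. *)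
Lemma minimizer_euler_lagrange w u : good_weight w -> finite_energy u ->
  (forall v, finite_energy v -> objective w u <= objective w v) -> euler_lagrange w u.
Proof.
move=> gw Eu umin; have [u0 u0P] := euler_lagrange_exists gw; have [Eu0 u0E] := u0P.
have Ed : finite_energy (lcomb (-1) u u0) by exact: energy_lcomb.
split => // v Ev; rewrite -u0E//.
have d0 : aform w (lcomb (-1) u u0) (lcomb (-1) u u0) = 0.
  apply/eqP; rewrite eq_le (sip_ge0 (aform_sip gw))// andbT.
  have := umin _ Eu0; rewrite (objectiveE gw u0P Eu) /sqdist; lra.
have := cauchy_schwarz (aform_sip gw) Ed Ev; rewrite d0 mul0r.
rewrite (sipD (aform_sip gw))// => h.
have /eqP := le_anti (introT andP (conj h (sqr_ge0 _))).
by rewrite sqrf_eq0 addrC mulN1r subr_eq0 => /eqP.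
Qed.

(** ** Stability of the solutions *)

Section stability.
Variables (sigma_ : nat -> R -> R) (sigma : R -> R).
Hypothesis gw_ : forall k, good_weight (sigma_ k).
Hypothesis gw : good_weight sigma.
Variable l : {sigma_finite_measure set (measurableTypeR R) -> \bar R}.
Hypothesis null : \forall x \ae m, forall A : set (measurableTypeR R),
  measurable A -> l A = 0%E -> m [set z | A (enorm (x - z))] = 0%E.
Hypothesis sigma_cvg : forall g : measurableTypeR R -> R,
  l.-integrable setT (EFin \o g) ->
  \int[l]_t (sigma_ k t * g t) @[k --> \oo] --> \int[l]_t (sigma t * g t).
Variables (u_ : nat -> T -> R) (u : T -> R).
Hypothesis EL_ : forall k, euler_lagrange (sigma_ k) (u_ k).
Hypothesis EL : euler_lagrange sigma u.

Let Eu : finite_energy u. Proof. exact: EL.1. Qed.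
Let Eu_ k : finite_energy (u_ k). Proof. exact: (EL_ k).1. Qed.
Let Lu : sqint m u. Proof. exact: Eu.1. Qed.

Let w_ k := lcomb (-1) u (u_ k).
Let Ew k : finite_energy (w_ k). Proof. exact: (energy_lcomb (-1) Eu (Eu_ k)). Qed.
Let Lw k : sqint m (w_ k). Proof. exact: (Ew k).1. Qed.
Let Q k := aform (sigma_ k) (w_ k) (w_ k).

Let tau k t := sigma t - sigma_ k t.
Let kfar e t := if t < e then 0 else kappa t.
Let knear e t := if t < e then kappa t else 0.

Let knear_ge0 e t : 0 <= knear e t.
Proof. by rewrite /knear; case: ifP. Qed.

Let knear_le e t : knear e t <= kappa t.
Proof. by rewrite /knear; case: ifP. Qed.

Let dd v (z : T * T) := v z.1 - v z.2.

Let tau_le k t : `|tau k t| <= g2.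
Proof.
have [_ /(_ t)/andP[_ h1]] := gw; have [_ /(_ t)/andP[_ h2]] := gw_ k.
have h3 := good_weight_ge0 t gw; have h4 := good_weight_ge0 t (gw_ k).
by rewrite ler_norml /tau; apply/andP; split; lra.
Qed.

Let mtau k : measurable_fun setT (tau k).
Proof. by apply: measurable_funB; [exact: gw.1|exact: (gw_ k).1]. Qed.

Let mkfar e : measurable_fun setT (kfar e).
Proof. by apply: measurable_fun_ifT => //; exact: measurable_fun_ltr. Qed.

Let mknear e : measurable_fun setT (knear e).
Proof. by apply: measurable_fun_ifT => //; exact: measurable_fun_ltr. Qed.

Let wdiff_integrable s v1 v2 : good_weight s -> finite_energy v1 -> finite_energy v2 ->
  m2.-integrable setT (EFin \o (fun z => kw s (dist z) * (dd v1 z * dd v2 z))).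
Proof.
move=> gs E1 E2.
have := sqint_integrableM (finite_energy_wdiff gs E1) (finite_energy_wdiff gs E2).
apply: eq_integrable => // z _; rewrite /= /wdiff mulrACA -expr2 sqr_sqrtr//.
exact: kw_ge0.
Qed.

Let ip_wdiff s v1 v2 : good_weight s ->
  ip m2 (wdiff (kw s) v1) (wdiff (kw s) v2) =
  \int[m2]_z (kw s (dist z) * (dd v1 z * dd v2 z)).
Proof.
move=> gs; apply: eq_Rintegral => z _.
by rewrite /wdiff mulrACA -expr2 sqr_sqrtr//; exact: kw_ge0.
Qed.

(** Subtracting the two Euler-Lagrange equations, tested with the difference of
    the solutions. *)
Let Q_eq k : Q k =
  \int[m2]_z (kappa (dist z) * tau k (dist z) * (dd u z * dd (w_ k) z)).
Proof.
have -> : Q k = aform sigma u (w_ k) - aform (sigma_ k) u (w_ k).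
  rewrite /Q {1}/w_ (sipD (aform_sip (gw_ k)) (-1) Eu (Eu_ k) (Ew k)).
  by rewrite ((EL_ k).2 _ (Ew k)) (EL.2 _ (Ew k)); ring.
rewrite /aform !ip_wdiff// opprD addrACA subrr add0r addrC -mulN1r.
rewrite -Rintegral_lcomb; last 2 first.
- exact: (wdiff_integrable (gw_ k) Eu (Ew k)).
- exact: (wdiff_integrable gw Eu (Ew k)).
by apply: eq_Rintegral => z _; rewrite /lcomb /kw /tau; ring.
Qed.

Let near_energy_part e := \int[m2]_z (knear e (dist z) * (dd u z) ^+ 2).

Let kdd_integrable : m2.-integrable setT
  (EFin \o (fun z => kappa (dist z) * (dd u z) ^+ 2)).
Proof.
by have := Eu.2.2; apply: eq_integrable => // z _; rewrite /= wdiff_sqr.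
Qed.

Let mdd v : measurable_fun setT v -> measurable_fun setT (dd v).
Proof. exact: measurable_diff. Qed.

Let knear_integrable e : m2.-integrable setT
  (EFin \o (fun z => knear e (dist z) * (dd u z) ^+ 2)).
Proof.
move: kdd_integrable; apply: le_integrable => //.
  apply/measurable_EFinP; apply: measurable_funM; first exact: measurable_weight (mknear e).
  by apply: measurable_funX; exact: mdd Lu.1.
move=> z _; rewrite /= lee_fin ger0_norm ?(mulr_ge0 (knear_ge0 _ _) (sqr_ge0 _))//.
by rewrite (le_trans _ (ler_norm _))// ler_wpM2r ?sqr_ge0// knear_le.
Qed.

Let near_integrable e k : m2.-integrable setT (EFin \o
  (fun z => knear e (dist z) * tau k (dist z) * (dd u z * dd (w_ k) z))).
Proof.
have Lk : sqint m2 (wdiff kappa u) by exact: Eu.2.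
have Lkw : sqint m2 (wdiff kappa (w_ k)) by exact: (Ew k).2.
pose t z := if dist z < e then tau k (dist z) else 0.
have mt : measurable_fun setT t.
  apply: measurable_fun_ifT => //.
    by apply: measurable_fun_ltr => //; exact: measurable_dist.
  exact: (measurable_weight (mtau k)).
have tM z : `|t z| <= g2.
  by rewrite /t; case: ifP => _; [exact: tau_le|rewrite normr0 g2_ge0].
have := integrable_bddM mt tM (sqint_integrableM Lk Lkw).
apply: eq_integrable => // z _; rewrite /= /wdiff mulrACA -expr2 sqr_sqrtr//.
by congr EFin; rewrite /t /knear /dd; case: ifP => _; ring.
Qed.

(** By Young's inequality; the weights being at least [g1] at these distances, the
    square of the difference of the solutions is a part of [Q k]. *)
Let near_bound e k : e <= delta ->
  \int[m2]_z (knear e (dist z) * tau k (dist z) * (dd u z * dd (w_ k) z)) <=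
  g2 ^+ 2 / g1 * near_energy_part e + 4^-1 * Q k.
Proof.
move=> ed; have Lkw := finite_energy_wdiff (gw_ k) (Ew k).
have iw := wdiff_integrable (gw_ k) (Ew k) (Ew k).
have i0 := integrable0 m2 setT.
apply: (@le_trans _ _ (\int[m2]_z lcomb (g2 ^+ 2 / g1)
   (fun z => knear e (dist z) * (dd u z) ^+ 2)
   (lcomb 4^-1 (fun z => kw (sigma_ k) (dist z) * (dd (w_ k) z * dd (w_ k) z))
      (fun=> 0)) z)).
  apply: le_Rintegral; [exact: measurableT|exact: near_integrable| |].
    by apply: integrable_lcomb; [exact: knear_integrable|exact: integrable_lcomb].
  move=> z _; rewrite /lcomb addr0 /knear; case: ifPn => [ze|_]; last first.
    rewrite !mul0r mulr0 add0r mulr_ge0 ?invr_ge0// mulr_ge0 ?kw_ge0//.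
    by rewrite -expr2 sqr_ge0.
  have zd : dist z < delta by exact: lt_le_trans ed.
  have s1 : g1 <= sigma_ k (dist z).
    by have [_ /(_ (dist z))/andP[+ _]] := gw_ k; rewrite /lower_bound zd.
  have := tau_le k (dist z); set t := tau k (dist z).
  set a := dd u z; set b := dd (w_ k) z; set s := sigma_ k _ in s1 * => tg.
  rewrite /kw -/s.
  have : t * (a * b) <= g2 ^+ 2 / g1 * a ^+ 2 + 4^-1 * (s * (b * b)).
    have t2 : t ^+ 2 <= g2 ^+ 2.
      by rewrite -real_normK ?num_real// lerXn2r ?nnegrE// g2_ge0.
    apply: (@le_trans _ _ (t ^+ 2 / g1 * a ^+ 2 + 4^-1 * (g1 * (b * b)))).
      rewrite -subr_ge0 [X in 0 <= X](_ : _ = (t * a - g1 * b / 2) ^+ 2 / g1).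
        by rewrite divr_ge0 ?sqr_ge0 ?ltW.
      by field; rewrite gt_eqF.
    rewrite lerD//.
      by rewrite ler_wpM2r ?sqr_ge0// ler_wpM2r// invr_ge0 ltW.
    by rewrite ler_wpM2l// ler_wpM2r// -expr2 sqr_ge0.
  move=> /(ler_wpM2l (kappa_ge0 (dist z))); nra.
rewrite Rintegral_lcomb; [|exact: knear_integrable|exact: integrable_lcomb].
rewrite lerD2l// Rintegral_lcomb// (_ : \int[m2]_x 0 = 0); last first.
  by rewrite /Rintegral integral0.
by rewrite addr0 ler_wpM2l// -(ip_wdiff _ _ (gw_ k)) (aform_ge_wdiff (gw_ k) (Ew k)).
Qed.

Let near_energy_part_cvg0 : near_energy_part k.+1%:R^-1 @[k --> \oo] --> 0.
Proof.
have := @dominated_convergence _ _ _ m2 setT measurableT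
  (fun k z => (knear k.+1%:R^-1 (dist z) * (dd u z) ^+ 2)%:E) (cst 0%E)
  (EFin \o (fun z => kappa (dist z) * (dd u z) ^+ 2)).
move=> [].
- by move=> k; exact: measurable_int (knear_integrable _).
- exact: measurable_cst.
- apply: aeW => z _; apply: cvg_near_cst.
  have := enorm_ge0 (z.1 - z.2); rewrite le_eqVlt => /orP[/eqP z0|z0].
    apply: nearW => k; have /eqP := enorm0_eq0 (esym z0); rewrite subr_eq0 => /eqP h.
    by rewrite /dd h subrr expr0n mulr0.
  near=> k; rewrite /knear ltNge ltW ?mul0r//.
  by near: k; exact: near_infty_natSinv_lt (PosNum z0).
- exact: kdd_integrable.
- apply: aeW => z k _; rewrite /= lee_fin ger0_norm ?(mulr_ge0 (knear_ge0 _ _) (sqr_ge0 _))//.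
  by rewrite ler_wpM2r ?sqr_ge0// knear_le.
move=> _ _; rewrite integral0 => /fine_cvgP[_].
by [].
Unshelve. all: by end_near. Qed.

Section far.
Variables (e C : R).
Hypothesis C_ge0 : 0 <= C.
Hypothesis kappaC : forall t, e <= t -> kappa t <= C.

Let G k (z : T * T) := kfar e (dist z) * tau k (dist z) * dd u z.
Let h k (x : T) := \int[m]_z G k (x, z).

Let kfar_bd t : `|kfar e t| <= C.
Proof. by rewrite /kfar; case: ltP => [_|/kappaC]; rewrite ?normr0// ger0_norm. Qed.

Let Cg2_ge0 : 0 <= C * g2.
Proof. exact: mulr_ge0 C_ge0 g2_ge0. Qed.

Let G_le k z : `|G k z| <= C * g2 * `|dd u z|.
Proof.
rewrite /G normrM ler_wpM2r// normrM.
by apply: ler_pM; [| |exact: kfar_bd|exact: tau_le].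
Qed.

Let mG k : measurable_fun setT (G k).
Proof.
apply: measurable_funM; last exact: mdd Lu.1.
by apply: measurable_funM; [exact: measurable_weight (mkfar e)|
  exact: measurable_weight (mtau k)].
Qed.

Let LG k : sqint m2 (G k).
Proof.
apply: (le_sqint (mG k) _ (sqintZ (C * g2) (sqint_diff Lu))) => z.
by rewrite [leRHS]normrM (ger0_norm Cg2_ge0); exact: G_le.
Qed.

Let Ldd x : sqint m (fun z => dd u (x, z)).
Proof.
have := sqint_lcomb (-1) Lu (sqint_cst m (u x)).
by congr sqint; apply/funext => z; rewrite /lcomb /dd /= mulN1r addrC.
Qed.

Let LGx k x : sqint m (fun z => G k (x, z)).
Proof.
apply: (le_sqint _ _ (sqintZ (C * g2) (Ldd x))) => [|z].
  exact: (measurableT_comp (mG k) (measurable_pair1 x)).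
by rewrite [leRHS]normrM (ger0_norm Cg2_ge0); exact: G_le.
Qed.

Let G_anti k x z : G k (z, x) = - G k (x, z).
Proof.
rewrite /G /dist /dd /= -(enormN (x - z)) opprB.
by ring.
Qed.

Let iG k x : m.-integrable setT (fun z => (G k (x, z))%:E).
Proof. exact: sqint_integrable (LGx k x). Qed.

Let H x := C * g2 * (`|u x| * \int[m]_z 1 + \int[m]_z `|u z|).

Let i1 : m.-integrable setT (EFin \o cst (1 : R)).
Proof. exact: finite_measure_integrable_cst. Qed.

Let inu : m.-integrable setT (EFin \o (fun z => `|u z|)).
Proof. by apply: integrable_norm; exact: sqint_integrable Lu. Qed.

Let H_ge0 x : 0 <= H x.
Proof.
rewrite /H mulr_ge0 ?(mulr_ge0 C_ge0 g2_ge0)// addr_ge0//.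
  by rewrite mulr_ge0//; apply: Rintegral_ge0.
by apply: Rintegral_ge0.
Qed.

Let h_le k x : `|h k x| <= H x.
Proof.
rewrite (le_trans (le_normr_Rintegral measurableT (iG k x)))//.
have -> : H x = \int[m]_z lcomb (C * g2)
    (lcomb `|u x| (cst 1) (fun z => `|u z|)) (fun=> 0) z.
  rewrite Rintegral_lcomb; last 2 first.
  - exact: integrable_lcomb i1 inu.
  - exact: integrable0.
  by rewrite (Rintegral_lcomb _ i1 inu) /H (_ : \int[m]_x0 0 = 0) ?addr0// /Rintegral integral0.
apply: le_Rintegral => //.
- by apply: integrable_norm; exact: iG.
- by apply: integrable_lcomb; [exact: integrable_lcomb i1 inu|exact: integrable0].
move=> z _; rewrite (le_trans (G_le k _))// /lcomb addr0 (ler_wpM2l Cg2_ge0)//.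
by rewrite /dd /= mulr1 ler_normB.
Qed.

Let LH : sqint m H.
Proof.
have Lnu : sqint m (fun z => `|u z|).
  apply: (le_sqint _ _ Lu) => [|z]; last by rewrite normr_id.
  by apply: measurableT_comp => //; exact: Lu.1.
have := sqintZ (C * g2) (sqint_lcomb (\int[m]_z 1) Lnu
  (sqint_cst m (\int[m]_z `|u z|))).
by congr sqint; apply/funext => x; rewrite /H /lcomb /= [X in _ * (X + _)]mulrC.
Qed.

Let mh k : measurable_fun setT (h k).
Proof.
apply: (measurableT_comp (fine_measurable measurableT)).
have : m2.-integrable setT (EFin \o G k).
  have L1 : sqint m2 (fun z => cst (1 : R) z.1) by exact: sqint_fst (sqint_cst m 1).
  have := sqint_integrableM (LG k) L1.
  by apply: eq_integrable => // z _; rewrite /= mulr1.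
by move=> /measurable_fubini_F; exact.
Qed.

Let Lh k : sqint m (h k).
Proof.
apply: (le_sqint (mh k) _ LH) => x; rewrite [leRHS]ger0_norm//.
Qed.

(** The weak-star convergence of the weights applies to the inner integral
    because distances have an absolutely continuous distribution. *)
Let h_cvg0 x : (forall A : set (measurableTypeR R), measurable A ->
  l A = 0%E -> m [set z | A (enorm (x - z))] = 0%E) -> h k x @[k --> \oo] --> 0.
Proof.
move=> nullx.
pose f z := kfar e (enorm (x - z)) * dd u (x, z).
pose phi (z : T) : measurableTypeR R := enorm (x - z).
have mphi : measurable_fun setT phi by exact: measurable_enormB.
have Lf : sqint m f.
  apply: (le_sqint _ _ (sqintZ C (Ldd x))) => [|z].
    apply: measurable_funM; last exact: (Ldd x).1.
    exact: (measurableT_comp (mkfar e) mphi).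
  by rewrite normrM [leRHS]normrM ler_wpM2r// (ger0_norm C_ge0); exact: kfar_bd.
have [g [ig gE]] := disintegration mphi nullx Lf.
have bd w : good_weight w -> forall t, `|w t| <= g2.
  by move=> gw' t; rewrite ger0_norm ?good_weight_ge0//; have [_ /(_ t)/andP[]] := gw'.
have iwf w : good_weight w -> m.-integrable setT
    (EFin \o (fun z => w (phi z) * f z)).
  move=> gw'; apply: (integrable_bddM (M := g2)).
  - exact: (measurableT_comp gw'.1 mphi).
  - by move=> z; exact: bd.
  - exact: sqint_integrable.
have -> : (fun k => h k x) =
    (fun k => \int[l]_t (sigma t * g t) - \int[l]_t (sigma_ k t * g t)).
  apply/funext => k; rewrite -(gE _ _ gw.1 (bd _ gw)) -(gE _ _ (gw_ k).1 (bd _ (gw_ k))).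
  rewrite -RintegralB//; [|exact: iwf..].
  by apply: eq_Rintegral => z _; rewrite /G /f /tau /dist /phi /=; ring.
rewrite -[X in _ --> X](subrr (\int[l]_t (sigma t * g t))).
by apply: cvgB; [exact: cvg_cst|exact: sigma_cvg].
Qed.

Let hh_cvg0 : ip m (h k) (h k) @[k --> \oo] --> 0.
Proof.
have [] := @dominated_convergence _ _ _ m setT measurableT
  (fun k x => (h k x ^+ 2)%:E) (cst 0%E) (EFin \o (fun x => H x ^+ 2)).
- by move=> k; apply/measurable_EFinP; apply: measurable_funX; exact: mh.
- exact: measurable_cst.
- apply: filterS null => x /h_cvg0 hx _; apply: cvg_EFin; first exact: nearW.
  rewrite -[X in _ --> X](mulr0 0).
  exact: (cvgM hx hx).
- exact: LH.2.
- apply: aeW => x k _; rewrite /= lee_fin ger0_norm ?sqr_ge0//.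
  rewrite -[leLHS]real_normK ?num_real// lerXn2r ?nnegrE//.
move=> _ _; rewrite integral0 => /fine_cvgP[_].
by apply: cvg_trans; rewrite /ip; under eq_fun do under eq_Rintegral do rewrite -expr2.
Qed.

Let far_eq k :
  \int[m2]_z (kfar e (dist z) * tau k (dist z) * (dd u z * dd (w_ k) z)) =
  2 * ip m (w_ k) (h k).
Proof.
rewrite -(Rintegral_antisym (LG k) (Lw k) (G_anti k) (iG k)).
by apply: eq_Rintegral => z _; rewrite /G /dd mulrA.
Qed.

Let Q_split k : Q k =
  \int[m2]_z (knear e (dist z) * tau k (dist z) * (dd u z * dd (w_ k) z)) +
  2 * ip m (w_ k) (h k).
Proof.
rewrite Q_eq -far_eq -[X in X + _]mul1r -Rintegral_lcomb; last 2 first.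
- exact: near_integrable.
- have := sqint_integrableM (LG k) (sqint_diff (Lw k)).
  by apply: eq_integrable => // z _; rewrite /= /G /dd mulrA.
apply: eq_Rintegral => z _; rewrite /lcomb /knear /kfar.
by case: ifP => _; ring.
Qed.

(** The far part is twice the scalar product of [w_ k] and [h k]; coercivity
    absorbs [w_ k] once more, and [h k] tends to 0. *)
Lemma stability_bound : e <= delta -> exists A, exists b_ : nat -> R,
  b_ @ \oo --> 0 /\
  forall k, Q k <= 2 * (g2 ^+ 2 / g1) * near_energy_part e + A * b_ k.
Proof.
move=> ed; have [C' [C'0 CP]] := coercivity.
exists (8 * C'), (fun k => ip m (h k) (h k)); split; first exact: hh_cvg0.
move=> k.
have hw : 2 * ip m (w_ k) (h k) <= 4 * C' * ip m (h k) (h k) + 4^-1 * Q k.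
  have := sip_ge0 (ip_sip m) (sqint_lcomb (- (4 * C')) (Lh k) (Lw k)).
  rewrite (sip_quad (ip_sip m) _ (Lh k) (Lw k)) (sipC (ip_sip m) (Lh k) (Lw k)).
  have := CP _ _ (gw_ k) (Ew k); rewrite -/(Q k).
  set a := ip m _ _; set b := ip m _ _; set c := ip m _ _ => h1 h2.
  have : 0 <= a / (4 * C') - 2 * b + 4 * C' * c.
    rewrite [X in 0 <= X](_ : _ = (a + 2 * - (4 * C') * b + (- (4 * C')) ^+ 2 * c) / (4 * C')).
      by rewrite divr_ge0// mulr_ge0// ltW.
    by field; rewrite gt_eqF.
  have : a / (4 * C') <= 4^-1 * Q k.
    by rewrite ler_pdivrMr ?mulr_gt0// (le_trans h1)//; lra.
  by lra.
have := near_bound k ed; have := Q_split k.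
by set I := \int[m2]_z _ => q1 q2; lra.
Qed.

End far.

(** The bound of [stability_bound] tends to the energy of [u] on the pairs of points
    at distance less than [e], which is small with [e]. *)
Theorem stability : sqdist (@lcomb R T) (ip m) u (u_ k) @[k --> \oo] --> 0.
Proof.
have [C [C0 CP]] := coercivity.
apply/cvgr0Pnorm_lt => eps eps0.
pose K := 2 * (g2 ^+ 2 / g1) + 1.
have K0 : 0 < K by rewrite ltr_wpDl// mulr_ge0// divr_ge0 ?sqr_ge0 ?ltW.
have e'0 : 0 < eps / (2 * C * K) by rewrite divr_gt0// !mulr_gt0.
have [j [jd jP]] : exists j, j.+1%:R^-1 <= delta /\
    near_energy_part j.+1%:R^-1 < eps / (2 * C * K).
  have [j [j1 j2]] := filter_ex (filterI (cvgr0_norm_lt _ near_energy_part_cvg0 _ e'0)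
    (near_infty_natSinv_lt (PosNum delta_gt0))).
  by exists j; split; [exact: ltW|exact: le_lt_trans (ler_norm _) j1].
have j0 : 0 < j.+1%:R^-1 :> R by rewrite invr_gt0.
have [Ce [Ce0 CeP]] := kappa_far j0.
have [A [b_ [b0 bP]]] := stability_bound Ce0 CeP jd.
have Ab : C * (A * b_ k) @[k --> \oo] --> 0.
  rewrite -[X in _ --> X](_ : C * (A * 0) = 0); last by rewrite !mulr0.
  by apply: cvgMr; exact: cvgMr.
have e2 : 0 < eps / 2 by rewrite divr_gt0.
have Abe : \forall k \near \oo, `|C * (A * b_ k)| < eps / 2.
  by move/cvgr0Pnorm_lt : Ab => /(_ _ e2).
apply: filterS Abe => k hk.
rewrite ger0_norm; last exact: (sip_ge0 (ip_sip m) (Lw k)).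
rewrite (le_lt_trans (CP _ _ (gw_ k) (Ew k)))// -/(Q k).
rewrite (le_lt_trans (ler_wpM2l (ltW C0) (bP k)))// mulrDr [eps]splitr.
apply: ltr_leD; last exact: ltW (le_lt_trans (ler_norm _) hk).
have ne0 : 0 <= near_energy_part j.+1%:R^-1.
  by apply: Rintegral_ge0 => z _; rewrite (mulr_ge0 (knear_ge0 _ _) (sqr_ge0 _)).
apply: (@le_lt_trans _ _ (C * (K * near_energy_part j.+1%:R^-1))).
  apply: ler_wpM2l; first exact: ltW.
  by apply: ler_wpM2r => //; rewrite /K lerDl.
by rewrite mulrA mulrC -ltr_pdivlMr ?mulr_gt0// (lt_le_trans jP)// -mulrA invfM mulrA.
Qed.

End stability.

(** Compactness of the weights selects the subsequence; the convergence of the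
    solutions is then forced by [stability]. *)
Theorem feasible_compact (l : {finite_measure set (measurableTypeR R) -> \bar R})
    (w_ : nat -> R -> R) (u_ : nat -> T -> R) :
  (\forall x \ae m, forall A : set (measurableTypeR R),
    measurable A -> l A = 0%E -> m [set z | A (enorm (x - z))] = 0%E) ->
  (forall k, good_weight (w_ k)) -> (forall k, euler_lagrange (w_ k) (u_ k)) ->
  exists w u (k : nat -> nat), [/\ good_weight w, euler_lagrange w u,
    forall j, (j <= k j)%N,
    forall g : measurableTypeR R -> R, l.-integrable setT (EFin \o g) ->
      \int[l]_t (w_ (k j) t * g t) @[j --> \oo] --> \int[l]_t (w t * g t) &
    sqdist (@lcomb R T) (ip m) u (u_ (k j)) @[j --> \oo] --> 0].
Proof.
move=> null gw_ EL_.
have lb01 (t : measurableTypeR R) : 0 <= lower_bound t <= g2.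
  by rewrite /lower_bound; case: ifP => _; rewrite ?(ltW g1_gt0)// lexx g2_ge0.
have mlb : measurable_fun setT (lower_bound : measurableTypeR R -> R).
  by apply: measurable_fun_ifT => //; exact: measurable_fun_ltr.
have Llb : sqint l (lower_bound : measurableTypeR R -> R).
  apply: (le_sqint mlb _ (sqint_cst l g2)) => t.
  by have /andP[a b] := lb01 t; rewrite !ger0_norm ?g2_ge0.
have [|||w [k [mw wb kj cw]]] := @weak_star_compact _ (measurableTypeR R) R l
    lower_bound (cst g2) w_ Llb (sqint_cst l g2).
- by move=> t; have /andP[] := lb01 t.
- by move=> j; exact: (gw_ j).1.
- by move=> j t; exact: (gw_ j).2.
have gw : good_weight w by split.
have [u uEL] := euler_lagrange_exists gw.
have gle (v : R -> R) t : good_weight v -> `|v t| <= g2.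
  move=> gv; rewrite ger0_norm ?(good_weight_ge0 _ gv)//.
  by have /andP[] := gv.2 t.
have bdM (v : R -> R) (h : measurableTypeR R -> R) : good_weight v ->
    l.-integrable setT (EFin \o h) ->
    l.-integrable setT (EFin \o (fun t => v t * h t)).
  move=> gv ih; apply: (@integrable_bddM _ (measurableTypeR R) R l v h g2) => //.
    exact: gv.1.
  by move=> t; exact: gle.
have diffE (h : measurableTypeR R -> R) j : l.-integrable setT (EFin \o h) ->
    \int[l]_t ((w_ (k j) t - w t) * h t) =
    \int[l]_t (w_ (k j) t * h t) - \int[l]_t (w t * h t).
  move=> ih; rewrite -RintegralB//; [|exact: bdM..].
  by apply: eq_Rintegral => t _; rewrite mulrBl.
have wcvg (g : measurableTypeR R -> R) : l.-integrable setT (EFin \o g) ->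
    \int[l]_t (w_ (k j) t * g t) @[j --> \oo] --> \int[l]_t (w t * g t).
  move=> ig; apply/subr_cvg0; under eq_fun do rewrite -diffE//.
  apply: (@weak_cvg_L1 _ (measurableTypeR R) R l (fun j t => w_ (k j) t - w t)
    (g2 + g2) g) => //.
  - by move=> j; apply: measurable_funB; [exact: (gw_ _).1|exact: mw].
  - by move=> j t; rewrite (le_trans (ler_normB _ _))// lerD ?gle.
  - move=> h Lh; under eq_fun do rewrite diffE ?sqint_integrable//.
    by apply/subr_cvg0; exact: cw.
exists w, u, k; split => //.
exact: (stability (fun j => gw_ (k j)) gw null wcvg (fun j => EL_ (k j)) uEL).
Qed.

End nonlocal_energy.

(** * Classes of functions and their representatives *)

Section Lspace_representatives.
Context d (T : measurableType d) (R : realType) (mu : {measure set T -> \bar R}).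

Lemma measurable_Lspace p (p1 : (1 <= p)%E) (u : LspaceType mu p1) :
  measurable_fun setT (u : T -> R).
Proof. exact: (@measurable_funPT _ _ _ _ (repr (u : {mfun_ mu, T >-> measurableTypeR R}))). Qed.

Lemma Lspace_ext p (p1 : (1 <= p)%E) (u v : LspaceType mu p1) :
  (\forall x \ae mu, u x = v x) -> u = v.
Proof.
case: u v => [u [[hu]]] [v [[hv]]] uv.
have e : u = v.
  apply/eqP; rewrite -[u]reprK -[v]reprK; apply/eqP/eqmodP => /=.
  by apply/asboolP; apply: filterS uv => x ? _.
move: hv uv; rewrite -e => hv _; by rewrite (Prop_irrelevance hu hv).
Qed.

Lemma ae_eq_finite_norm p (f g : T -> R) : (0 < p)%E -> measurable_fun setT f ->
  measurable_fun setT g -> (\forall x \ae mu, f x = g x) ->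
  finite_norm mu p f -> finite_norm mu p g.
Proof.
move=> p0 mf mg fg; rewrite /finite_norm unlock; case: p p0 => [r r0| |//] /=.
- rewrite (ae_eq_integral (fun x => (`|g x| `^ r)%:E))//.
  + apply/measurable_EFinP; apply: (measurableT_comp (measurable_powR r)).
    exact: measurableT_comp.
  + apply/measurable_EFinP; apply: (measurableT_comp (measurable_powR r)).
    exact: measurableT_comp.
  + by apply: filterS fg => x -> _.
- move=> _; case: ifP => // _; congr (_ < _)%E; apply: eq_ess_sup.
  by apply: filterS fg => x /= ->.
Qed.

Lemma Lspace_class p (p1 : (1 <= p)%E) (f : T -> R) : measurable_fun setT f ->
  finite_norm mu p f -> exists u : LspaceType mu p1, \forall x \ae mu, u x = f x.
Proof.
move=> mf ff; pose F : {mfun T >-> measurableTypeR R} := HB.pack f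
  (isMeasurableFun.Build _ _ T (measurableTypeR R) f mf).
pose c : {mfun_ mu, T >-> measurableTypeR R} := (\pi_({mfun_ mu, T >-> measurableTypeR R}) F)%qT.
have cF : \forall x \ae mu, c x = f x.
  have : (c == \pi_({mfun_ mu, T >-> measurableTypeR R}) F)%qT by [].
  rewrite -[c in (c == _)%qT]reprK => /eqP/eqmodP/asboolP.
  by apply: filterS => x /(_ I).
have fc : finite_norm mu p c.
  apply: ae_eq_finite_norm ff => //; first exact: lt_le_trans p1.
    exact: (@measurable_funPT _ _ _ _ (repr c)).
  by apply: filterS cF => x ->.
pose U : LspaceType mu p1 := HB.pack c (isFinLebesgue.Build _ _ _ _ _ p1 c fc).
by exists U.
Qed.

End Lspace_representatives.

Lemma poweR_half_sqr (R : realType) (X : \bar R) : (0 <= X)%E ->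
  ((X `^ 2^-1) ^+ 2 = X)%E.
Proof.
case: X => [r|_|//]; last by rewrite poweRyr// expe2 mulyy.
by rewrite lee_fin => r0; rewrite poweR_EFin powR12_sqrt// -EFin_expe sqr_sqrtr.
Qed.

Section L2_representatives.
Context d (T : measurableType d) (R : realType) (mu : {measure set T -> \bar R}).

Lemma Lnorm2_sqr (f : T -> R) :
  ('N[mu]_2%:E[EFin \o f] ^+ 2 = \int[mu]_x (f x ^+ 2)%:E)%E.
Proof.
rewrite unlock /Lnorm.body poweR_half_sqr; last by apply: integral_ge0 => x _; rewrite lee_fin powR_ge0.
apply: eq_integral => x _ /=; rewrite powR_mulrn// real_normK ?num_real//.
Qed.

Lemma finite_norm2 (f : T -> R) :
  finite_norm mu 2%:E f <-> (\int[mu]_x (f x ^+ 2)%:E < +oo)%E.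
Proof.
rewrite -Lnorm2_sqr /finite_norm; have := Lnorm_ge0 mu 2%:E (EFin \o f).
case: ('N[mu]_2%:E[EFin \o f])%E => [r|_|//]; last by rewrite expe2 mulyy.
by move=> _; rewrite -EFin_expe !ltry.
Qed.

Lemma sqint_Lspace (u : LspaceType2 mu) : sqint mu u.
Proof.
apply: sqintE; first exact: measurable_Lspace.
by apply/finite_norm2; exact: Lebesgue_finite.
Qed.

Lemma L2_class (f : T -> R) : sqint mu f ->
  exists u : LspaceType2 mu, \forall x \ae mu, u x = f x.
Proof.
move=> [mf f2]; apply: Lspace_class => //; apply/finite_norm2.
exact: integrable_lty f2.
Qed.

Lemma L1_integrable (g : LspaceType1 mu) : mu.-integrable setT (EFin \o g).
Proof.
apply/integrableP; split; first exact/measurable_EFinP/measurable_Lspace.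
by have := Lebesgue_finite (s := g); rewrite /finite_norm Lnorm1.
Qed.

Lemma Linfty_class (f : T -> R) (M : R) : measurable_fun setT f ->
  (forall x, `|f x| <= M) ->
  exists u : LspaceType mu (leey 1%E), \forall x \ae mu, u x = f x.
Proof.
move=> mf fM; apply: Lspace_class => //; rewrite /finite_norm unlock.
case: ifP => [_|]; last by rewrite ltry.
apply: (@le_lt_trans _ _ M%:E); last by rewrite ltry.
by apply/ess_supP; apply: aeW => x /=; rewrite lee_fin.
Qed.

End L2_representatives.

(** * The restricted measures *)

Section finite_copy.
Context d (T : measurableType d) (R : realType) (mu : {measure set T -> \bar R}).

(** This copy of a measure carries the proof of its finiteness, from which its
    structure of finite measure is inferred. *)
Definition finite_copy of fin_num_fun mu : set T -> \bar R := mu.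

Hypothesis fmu : fin_num_fun mu.

HB.instance Definition _ := isMeasure.Build _ _ _ (finite_copy fmu)
  (measure0 mu) (measure_ge0 mu) (@measure_semi_sigma_additive _ _ _ mu).

HB.instance Definition _ := Measure_isFinite.Build _ _ _ (finite_copy fmu) fmu.

Lemma finite_measure_copy :
  exists m : {finite_measure set T -> \bar R}, (m : {measure set T -> \bar R}) = mu.
Proof. by exists (finite_copy fmu); exact: eq_measure. Qed.

End finite_copy.

Lemma integral_mrestr d (T : measurableType d) (R : realType)
    (mu : {measure set T -> \bar R}) (D : set T) (mD : measurable D) (f : T -> \bar R) :
  measurable_fun setT f -> (forall x, (0 <= f x)%E) ->
  (\int[mrestr mu mD]_x f x = \int[mu]_(x in D) f x)%E.
Proof.
move=> mf f0.
rewrite [LHS](@ge0_negligible_integral _ _ _ _ _ (~` D))//; last 2 first.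
- exact: measurableC.
- by rewrite /= /mrestr setICl measure0.
rewrite setTD setCK; apply: eq_measure_integral => A mA AD.
by rewrite /= /mrestr setIidl.
Qed.

(** * The problem on the domain *)

Section fractional_kernel.
Context {R : realType}.
Variables (p : R).
Hypothesis p_ge0 : 0 <= p.

Definition frac_kernel (t : R) : R := t `^ (- p).

Lemma measurable_frac_kernel : measurable_fun setT frac_kernel.
Proof. exact: measurable_powR. Qed.

Lemma frac_kernel_ge0 t : 0 <= frac_kernel t.
Proof. exact: powR_ge0. Qed.

Lemma frac_kernel_decr (e t : R) : 0 < e -> e <= t -> frac_kernel t <= frac_kernel e.
Proof.
move=> e0 et; have t0 : 0 < t by exact: lt_le_trans et.
rewrite /frac_kernel !powRN lef_pV2 ?posrE ?powR_gt0//.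
by apply: ge0_ler_powR => //; rewrite nnegrE ltW.
Qed.

Lemma frac_kernel_far e : 0 < e ->
  exists C, 0 <= C /\ forall t, e <= t -> frac_kernel t <= C.
Proof.
move=> e0; exists (frac_kernel e); split; first exact: frac_kernel_ge0.
by move=> t; exact: frac_kernel_decr.
Qed.

Lemma frac_kernel_near delta : 0 < delta ->
  exists c, 0 < c /\ forall t, 0 < t < delta -> c <= frac_kernel t.
Proof.
move=> d0; exists (frac_kernel delta); split; first exact: powR_gt0.
by move=> t /andP[t0 /ltW td]; exact: frac_kernel_decr.
Qed.

End fractional_kernel.

(** Tonelli's theorem on both sides reduces the identity to [integral_mrestr]. *)
Lemma integral_product_mrestr d (T : measurableType d) (R : realType)
    (mu : {sigma_finite_measure set T -> \bar R}) (D : set T) (mD : measurable D)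
    (m : {finite_measure set T -> \bar R}) (f : T * T -> \bar R) :
  (m : {measure set T -> \bar R}) = mrestr mu mD ->
  measurable_fun setT f -> (forall z, (0 <= f z)%E) ->
  (\int[mu \x mu]_(z in D `*` D) f z = \int[m \x m]_z f z)%E.
Proof.
move=> mE mf f0.
have mDD : measurable (D `*` D) by exact: measurableX.
rewrite integral_mkcond !fubini_tonelli1//; last 2 first.
- by apply/(measurable_restrictT f mDD); exact: measurable_funTS.
- by move=> z; rewrite patchE; case: ifP.
have mintE (g : T -> \bar R) : measurable_fun setT g -> (forall x, (0 <= g x)%E) ->
    (\int[m]_x g x = \int[mu]_(x in D) g x)%E.
  move=> mg g0; rewrite -(integral_mrestr mu mD)//.
  exact: (congr1 (fun k : {measure set T -> \bar R} => (\int[k]_x g x)%E) mE).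
rewrite mintE; last 2 first.
- have := @measurable_fun_fubini_tonelli_F _ _ _ _ _ m f mf f0; exact.
- by move=> x; apply: integral_ge0.
rewrite [RHS]integral_mkcond; apply: eq_integral => x _.
rewrite /fubini_F patchE; case: ifPn => Dx.
  rewrite mintE//; last exact: measurableT_comp.
  rewrite [RHS]integral_mkcond; apply: eq_integral => y _.
  rewrite !patchE; congr (if _ then _ else _).
  by rewrite in_setX Dx.
rewrite integral0_eq// => y _; rewrite patchE ifF//.
by apply/negP; rewrite inE => -[/= /mem_set]; rewrite (negbTE Dx).
Qed.

Lemma fin_num_fun_mrestr d (T : measurableType d) (R : realType)
    (mu : {measure set T -> \bar R}) (D : set T) (mD : measurable D) :
  (mu D < +oo)%E -> fin_num_fun (mrestr mu mD).
Proof.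
move=> D_fin A mA; rewrite ge0_fin_numE; last exact: measure_ge0.
apply: le_lt_trans D_fin; rewrite /mrestr; apply: le_measure; rewrite ?inE//.
exact: measurableI.
Qed.

Section weights.
Context {R : realType}.
Variables (d delta gamma1 gamma2 : R).
Hypotheses (gamma1_gt0 : 0 < gamma1) (gamma12 : gamma1 <= gamma2).
Local Notation good := (good_weight delta gamma1 gamma2).

Lemma lower_bound_itv t : 0 <= lower_bound delta gamma1 t <= gamma2.
Proof.
have g2 : 0 <= gamma2 by exact: le_trans (ltW gamma1_gt0) gamma12.
by rewrite /lower_bound; case: ifP => _; rewrite ?(ltW gamma1_gt0)// lexx.
Qed.

(** Admissible classes are those of the functions that satisfy the bounds
    everywhere: truncation changes a representative on a null set only. *)
Lemma admissible_weight (sigma : Linfty d) : admissible gamma1 gamma2 delta sigma ->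
  exists2 w, good w & \forall t \ae lebesgue_oo d, sigma t = w t.
Proof.
move=> [h1 h2].
exists (fun t => Num.max (lower_bound delta gamma1 t) (Num.min gamma2 (sigma t))).
  split=> [|t].
    apply: measurable_maxr.
      by apply: measurable_fun_ifT => //; exact: measurable_fun_ltr.
    exact: (measurable_minr (measurable_cst gamma2) (measurable_Lspace sigma)).
  have /andP[_ lb] := lower_bound_itv t.
  by rewrite le_max lexx/= ge_max lb ge_min lexx.
apply: filterS2 h1 h2 => t /andP[s0 sg] sd.
rewrite (min_idPr sg) (max_idPr _)// /lower_bound; case: ifP => //.
Qed.

Lemma weight_admissible w : good w -> exists2 sigma : Linfty d,
  admissible gamma1 gamma2 delta sigma & \forall t \ae lebesgue_oo d, sigma t = w t.
Proof.
move=> [mw wb]; have w0 t : 0 <= w t.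
  by have /andP[+ _] := wb t; apply: le_trans; have /andP[] := lower_bound_itv t.
have [|sigma sw] := @Linfty_class _ (measurableTypeR R) R (lebesgue_oo d) w gamma2 mw.
  by move=> t; rewrite ger0_norm//; have /andP[] := wb t.
exists sigma => //; split; apply: filterS sw => t ->.
  by rewrite w0; have /andP[] := wb t.
by move=> td; have /andP[+ _] := wb t; rewrite /lower_bound td.
Qed.

Lemma integral_weight (l : {finite_measure set (measurableTypeR R) -> \bar R})
    (sigma : Linfty d) w (g : L1 d) :
  (l : {measure set (measurableTypeR R) -> \bar R}) = lebesgue_oo d -> good w ->
  (\forall t \ae lebesgue_oo d, sigma t = w t) ->
  (\int[lebesgue_oo d]_t (sigma t * g t)%:E)%E = (\int[l]_t (w t * g t))%:E.
Proof.
move=> lE [mw wb] sw.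
have [ms mg] := (measurable_Lspace sigma, measurable_Lspace g).
rewrite (ae_eq_integral (fun t : measurableTypeR R => (w t * g t)%:E)) //; last 3 first.
- by apply/measurable_EFinP; exact: measurable_funM.
- by apply/measurable_EFinP; exact: measurable_funM.
- by apply: filterS sw => t -> _.
rewrite [RHS](congr1 (fun k : {measure set (measurableTypeR R) -> \bar R} =>
  (\int[k]_t (w t * g t))%:E) lE).
rewrite /Rintegral fineK//; apply: integrable_fin_num => //.
apply: (@integrable_bddM _ (measurableTypeR R) R _ w g gamma2) => //.
  move=> t; have /andP[h1 h2] := wb t; rewrite ger0_norm//.
  by apply: le_trans h1; have /andP[] := lower_bound_itv t.
exact: L1_integrable.
Qed.

End weights.

Section domain.
Context {R : realType} {N : nat} {Omega : set 'rV[R]_N} (oOmega : open Omega).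
Hypothesis N_gt0 : (0 < N)%N.
Hypothesis Omega_bounded : bounded_set Omega.
Local Notation d := (diameter Omega).

Lemma le_diameter x z : Omega x -> Omega z -> enorm (x - z) <= d.
Proof.
move=> Ox Oz; apply: ub_le_sup; last by exists (x, z).
have [M [_ OM]] := Omega_bounded.
exists (N%:R * (2 * (`|M| + 2))) => _ [[a b] [/= Oa Ob] <-].
have M1 : M < `|M| + 1 by rewrite ltr_pwDr// ler_norm.
have bd y i : Omega y -> `|y ord0 i| < `|M| + 2.
  move=> Oy; apply: (@le_lt_trans _ _ `|y|).
    rewrite [leRHS]/Num.norm/= mx_normrE.
    exact: (le_bigmax _ (fun ij => `|y ij.1 ij.2|) (ord0, i)).
  by rewrite (le_lt_trans (OM _ M1 _ Oy))// ltrD2l ltr1n.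
apply: enorm_le_norm => [|i]; first by rewrite mulr_gt0// ltr_wpDl.
rewrite !mxE (le_lt_trans (ler_normB _ _))// mulr_natl mulr2n.
by rewrite ltrD// bd.
Qed.

(** Distances between points of the domain lie between 0 and the diameter; the two
    end points, which the weights do not see, form a null set. *)
Lemma null_distances (A : set (measurableTypeR R)) : measurable A ->
  lebesgue_oo d A = 0%E -> exists A' : set R, [/\ measurable A',
    lebesgue_measure A' = 0%E &
    forall x z, Omega x -> Omega z -> A (enorm (x - z)) -> A' (enorm (x - z))].
Proof.
move=> mA A0; exists (A `&` `]0, d[%classic `|` [set 0] `|` [set d]); split.
- by apply: measurableU => //; apply: measurableU => //; exact: measurableI.
- rewrite measureU0//; last exact: lebesgue_measure_set1.
    by rewrite measureU0//; [exact: measurableI|exact: lebesgue_measure_set1].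
  by apply: measurableU => //; exact: measurableI.
- move=> x z Ox Oz Axz; have := le_diameter Ox Oz; have := enorm_ge0 (x - z).
  rewrite !le_eqVlt => /orP[/eqP e0|e0] /orP[/eqP ed|ed].
  + by right.
  + by left; right.
  + by right.
  + by left; left; split => //=; rewrite in_itv/= e0.
Qed.

Lemma lebesgue_dom_null_distances : \forall x \ae lebesgue_dom oOmega,
  forall A : set (measurableTypeR R), measurable A -> lebesgue_oo d A = 0%E ->
  lebesgue_dom oOmega [set z | A (enorm (x - z))] = 0%E.
Proof.
have mO := open_measurable_rV oOmega.
exists (~` Omega); split; first exact: measurableC.
  by rewrite /= /lebesgue_dom /mrestr setICl measure0.
apply: subsetC => x Ox A mA A0.
have [A' [mA' A'0 AA']] := null_distances mA A0.
have mS (B : set R) : measurable B -> measurable [set z | B (enorm (x - z))].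
  by move=> mB; rewrite -[X in measurable X]setTI; exact: measurable_enormB.
rewrite /lebesgue_dom /= /mrestr.
apply: (subset_null _ _ _ (lebesgue_rV_null_radii x N_gt0 mA' A'0)).
- by apply: measurableI => //; exact: mS.
- exact: mS.
- by move=> z [/= Az Oz]; exact: AA'.
Qed.

Lemma weighted_seminorm_ae (sigma w : R -> R) s (u : L2 oOmega) :
  measurable_fun setT sigma -> measurable_fun setT w ->
  (\forall t \ae lebesgue_oo d, sigma t = w t) ->
  weighted_seminorm sigma s u = weighted_seminorm w s u.
Proof.
move=> ms mw [Z [mZ Z0 sw]].
have mO := open_measurable_rV oOmega.
have [Z' [mZ' Z'0 ZZ']] := null_distances mZ Z0.
have mu := measurable_Lspace u.
have mint (v : R -> R) : measurable_fun setT v ->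
    measurable_fun (Omega `*` Omega) (fun z => (`|u z.1 - u z.2| ^+ 2 /
      enorm (z.1 - z.2) `^ (N%:R + 2 * s) * v (enorm (z.1 - z.2)))%:E).
  move=> mv; apply: measurable_funTS; apply/measurable_EFinP.
  apply: measurable_funM; last exact: measurable_weight.
  apply: measurable_funM.
    apply: measurable_funX; apply: measurableT_comp => //; exact: measurable_diff.
  under eq_fun do rewrite -powRN.
  exact: (measurable_weight (measurable_powR _)).
congr (_ `^ _)%E; apply: ae_eq_integral; [exact: measurableX|exact: mint..|].
pose B := [set z : 'rV[R]_N * 'rV[R]_N | Z' (enorm (z.1 - z.2))].
have mB : measurable B.
  by rewrite -[X in measurable X]setTI; exact: measurable_dist.
exists B; split => //.
  apply/product_measure_eq0 => //; apply: aeW => x.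
  by rewrite xsectionE; exact: lebesgue_rV_null_radii.
apply: subsetCl => z nB [Oz1 Oz2]; congr (_ * _)%:E; apply: contrapT => ne.
by apply: nB; apply: ZZ' => //; apply: sw.
Qed.

End domain.
(** The lower level problem is rephrased for functions instead of classes: [m]
    is the Lebesgue measure on the domain, bundled as a finite measure, and
    [L2of] chooses the class of a function. *)
Section lower_level.
Context {R : realType} {N : nat} {Omega : set 'rV[R]_N} (oOmega : open Omega).
Variables (s : R) (S : L2 oOmega -> L2 oOmega) (ydelta : L2 oOmega).
Hypothesis N_gt0 : (0 < N)%N.
Hypothesis Omega_neq0 : Omega !=set0.
Hypothesis Omega_connected : connected Omega.
Hypothesis Omega_bounded : bounded_set Omega.
Hypothesis S_linear : L2linear S.
Hypothesis S_bounded : L2bounded S.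
Hypothesis S_inj : set_inj (ae_constant oOmega) S.
Variable m : {finite_measure set 'rV[R]_N -> \bar R}.
Hypothesis mE : (m : {measure set 'rV[R]_N -> \bar R}) = lebesgue_dom oOmega.
Variable L2of : ('rV[R]_N -> R) -> L2 oOmega.
Hypothesis L2ofP : forall f, sqint m f -> \forall x \ae m, L2of f x = f x.
Local Notation T := 'rV[R]_N.
Local Notation m2 := (m \x m)%E.
Local Notation d := (diameter Omega).

Let aeE (P : T -> Prop) : (\forall x \ae m, P x) = (\forall x \ae lebesgue_dom oOmega, P x).
Proof. exact: (congr1 (fun k : {measure set T -> \bar R} => \forall x \ae k, P x) mE). Qed.

Let intE (f : T -> \bar R) : (\int[m]_x f x = \int[lebesgue_dom oOmega]_x f x)%E.
Proof. exact: (congr1 (fun k : {measure set T -> \bar R} => (\int[k]_x f x)%E) mE). Qed.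

Let sqint_L2 (u : L2 oOmega) : sqint m u.
Proof. by rewrite mE; exact: sqint_Lspace. Qed.

Let L2_ext (u v : L2 oOmega) : (\forall x \ae m, u x = v x) -> u = v.
Proof. by rewrite aeE; exact: Lspace_ext. Qed.

Let L2ofK (u : L2 oOmega) : L2of u = u.
Proof. by apply: L2_ext; apply: L2ofP. Qed.

Lemma L2dist_sqr (u v : L2 oOmega) :
  (L2dist u v ^+ 2 = (ip m (lcomb (-1) v u) (lcomb (-1) v u))%:E)%E.
Proof.
rewrite EFin_ip; last by apply: sqint_lcomb.
rewrite (Lnorm2_sqr _ (fun x => u x - v x)) -intE.
by apply: eq_integral => x _; rewrite /lcomb mulN1r addrC.
Qed.

(** ** The operator on functions *)

Definition raw_operator (f : T -> R) : T -> R := S (L2of f).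

Lemma raw_operator_sqint f : sqint m f -> sqint m (raw_operator f).
Proof. by move=> _; exact: sqint_L2. Qed.

Lemma raw_operator_lin c u v : sqint m u -> sqint m v ->
  \forall x \ae m, raw_operator (lcomb c u v) x =
    lcomb c (raw_operator u) (raw_operator v) x.
Proof.
move=> Lu Lv; rewrite aeE; apply: S_linear; rewrite -aeE.
move: (L2ofP Lu) (L2ofP Lv) (L2ofP (sqint_lcomb c Lu Lv)).
by apply: filterS3 => x -> -> ->.
Qed.

Lemma raw_operator_bounded : exists C, 0 <= C /\ forall u, sqint m u ->
  ip m (raw_operator u) (raw_operator u) <= C * ip m u u.
Proof.
have [C CP] := S_bounded; exists (C ^+ 2); split; first exact: sqr_ge0.
move=> u Lu; have -> : ip m u u = ip m (L2of u) (L2of u).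
  by apply: ip_ae_sq => //; apply: filterS (L2ofP Lu) => x ->.
have nrm (f : L2 oOmega) : exists2 r, 0 <= r &
    'N[lebesgue_dom oOmega]_2%:E[EFin \o f]%E = r%:E /\ ip m f f = r ^+ 2.
  have := Lnorm_ge0 (lebesgue_dom oOmega) 2%:E (EFin \o f).
  have := Lnorm2_sqr (lebesgue_dom oOmega) f.
  rewrite -intE -EFin_ip//.
  case: ('N[_]_2%:E[_])%E => [r|//|//] h r0; exists r => //; split => //.
  by move: h; rewrite -EFin_expe => -[].
have [a a0 [Na ->]] := nrm (S (L2of u)); have [b b0 [Nb ->]] := nrm (L2of u).
have := CP (L2of u); rewrite Na Nb -EFinM lee_fin => ab.
by rewrite -exprMn ler_sqr ?nnegrE// (le_trans a0).
Qed.

(** Otherwise [S] would map the constants 0 and 1 to the same class. *)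
Lemma raw_operator_one : 0 < ip m (raw_operator (cst 1)) (raw_operator (cst 1)).
Proof.
rewrite lt_neqAle (sip_ge0 (ip_sip m)) ?andbT; last exact: sqint_L2.
apply/negP => /eqP/esym ip1.
have L1 : sqint m (cst 1) by exact: sqint_cst.
have L0 : sqint m (fun=> 0) by exact: sqint0.
have S1 : \forall x \ae m, raw_operator (cst 1) x = 0.
  by apply: (ip_eq0 (sqint_L2 _)); rewrite ip1.
have S0 : \forall x \ae m, raw_operator (fun=> 0) x = 0.
  have := raw_operator_lin (-1) L0 L0.
  rewrite (_ : lcomb _ _ _ = fun=> 0).
    by apply: filterS => x -> ; rewrite /lcomb mulN1r addNr.
  by apply/funext => x; rewrite /lcomb mulr0 addr0.
have cst_ae c : sqint m (cst c) -> L2of (cst c) \in ae_constant oOmega.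
  by move=> Lc; apply/mem_set; exists c; rewrite -aeE; exact: L2ofP.
have /S_inj : S (L2of (cst 1)) = S (L2of (cst 0)).
  apply: L2_ext; move: S1 S0; apply: filterS2 => x; rewrite /raw_operator => -> e.
  exact: esym e.
move=> /(_ (cst_ae 1 L1) (cst_ae 0 L0)) e10.
have := L2ofP L1; rewrite e10 => e1.
have [Z [mZ Z0 hZ]] : \forall x \ae m, False.
  move: e1 (L2ofP L0); apply: filterS2 => x -> /= /eqP.
  by rewrite oner_eq0.
have ZT : Z = setT by apply/seteqP; split => // x _; apply: hZ.
have : (0 < m setT)%E.
  rewrite (congr1 (fun k : {measure set T -> \bar R} => k setT) mE).
  by rewrite /= /lebesgue_dom /= /mrestr setTI lebesgue_rV_open_gt0.
by rewrite -ZT Z0 ltxx.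
Qed.

(** ** The energies *)

Local Notation kernel := (frac_kernel (N%:R + 2 * s)).
Local Notation wenergy w u := (@wdiff R N (kw kernel w) u).

Let kernel_ge0 (w : R -> R) t : 0 <= w t -> 0 <= kw kernel w t.
Proof. by move=> w0; rewrite mulr_ge0// frac_kernel_ge0. Qed.

Let measurable_wenergy (w : R -> R) u : measurable_fun setT w -> measurable_fun setT u ->
  measurable_fun setT (wenergy w u).
Proof.
move=> mw mu; apply: measurable_wdiff => //; apply: measurable_funM => //.
exact: measurable_frac_kernel.
Qed.

Lemma weighted_seminorm_sqr (w : R -> R) (u : L2 oOmega) : measurable_fun setT w ->
  (forall t, 0 <= w t) ->
  (weighted_seminorm w s u ^+ 2 = \int[m2]_z (wenergy w u z ^+ 2)%:E)%E.
Proof.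
move=> mw w0; have mu := measurable_Lspace u.
have E (z : T * T) : `|u z.1 - u z.2| ^+ 2 / enorm (z.1 - z.2) `^ (N%:R + 2 * s) *
    w (enorm (z.1 - z.2)) = wenergy w u z ^+ 2.
  rewrite wdiff_sqr ?kernel_ge0// real_normK ?num_real// /kw /frac_kernel powRN.
  by rewrite [_ / _]mulrC mulrAC.
rewrite /weighted_seminorm poweR_half_sqr; last first.
  by apply: integral_ge0 => z _; rewrite E lee_fin sqr_ge0.
rewrite -(integral_product_mrestr mE)//; last 2 first.
- by apply/measurable_EFinP; apply: measurable_funX; exact: measurable_wenergy.
- by move=> z; rewrite lee_fin sqr_ge0.
by apply: eq_integral => z _; rewrite E.
Qed.

(** The Slobodeckij seminorm is the energy of the constant weight 1. *)
Lemma HsP (u : L2 oOmega) : Hs oOmega s u <-> finite_energy m kernel u.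
Proof.
have e1 : kw kernel (cst 1) = kernel by apply/funext => t; rewrite /kw mulr1.
have m1 : measurable_fun setT (cst 1 : R -> R) by exact: measurable_cst.
have := weighted_seminorm_sqr u m1 (fun=> ler01); rewrite e1 => E.
have -> : Hs oOmega s u <-> (weighted_seminorm (cst 1%R) s u ^+ 2 < +oo)%E.
  rewrite /Hs; have : (0 <= weighted_seminorm (cst 1%R) s u)%E by exact: poweR_ge0.
  rewrite -[X in X <-> _]/(is_true (weighted_seminorm (cst 1%R) s u < +oo)%E).
  case: (weighted_seminorm _ _ _) => [r|_|//]; last by rewrite expe2 mulyy.
  by move=> _; rewrite -EFin_expe !ltry.
rewrite E; split => [h|[_ h]]; last exact: integrable_lty h.2.
split; first exact: sqint_L2.
by apply: sqintE => //; rewrite -e1; apply: measurable_wenergy => //; exact: measurable_Lspace.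
Qed.


(** ** Solutions of the lower level problem *)

Variables (delta gamma1 gamma2 : R).
Hypotheses (s_gt0 : 0 < s) (gamma1_gt0 : 0 < gamma1) (gamma12 : gamma1 <= gamma2).
Hypothesis delta_gt0 : 0 < delta.

Let p_ge0 : 0 <= N%:R + 2 * s.
Proof. by rewrite addr_ge0// mulr_ge0// ltW. Qed.

Let mkernel := @measurable_frac_kernel R (N%:R + 2 * s).
Let kernel0 := @frac_kernel_ge0 R (N%:R + 2 * s).
Let kernel_far := frac_kernel_far p_ge0.
Let kernel_near := frac_kernel_near p_ge0 delta_gt0.

Let poincare : exists C, 0 <= C /\
  forall u, measurable_fun setT u -> (near_energy m delta u < +oo)%E ->
  forall eta, 0 < eta ->
  exists c, (\int[m]_x ((u x - c) ^+ 2)%:E <= C%:E * (near_energy m delta u + eta%:E))%E.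
Proof.
have mAE (A : set T) : m A = lebesgue_rV N (A `&` Omega).
  exact: (congr1 (fun k : {measure set T -> \bar R} => k A) mE).
apply: (nonlocal_poincare Omega_neq0 oOmega Omega_connected Omega_bounded delta_gt0).
- move=> U oU UO; rewrite mAE setIC; apply: lebesgue_rV_open_gt0 => //.
  exact: openI.
- by rewrite mAE setICl measure0.
Qed.

Local Notation good := (good_weight delta gamma1 gamma2).
Local Notation obj := (objective m kernel raw_operator ydelta).
Local Notation EL := (euler_lagrange m kernel raw_operator ydelta).

Let Ly : sqint m ydelta. Proof. exact: sqint_L2. Qed.

Lemma lower_solution_exists w : good w -> exists u, EL w u.
Proof.
exact: (euler_lagrange_exists mkernel kernel0 kernel_far kernel_near delta_gt0
  gamma1_gt0 gamma12 raw_operator_sqint raw_operator_lin raw_operator_bounded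
  raw_operator_one poincare Ly).
Qed.

Let good_ge0 w t : good w -> 0 <= w t.
Proof. by move=> gw; exact: (good_weight_ge0 gamma1_gt0 _ gw). Qed.

Lemma lower_objectiveE (sigma : Linfty d) w (u : L2 oOmega) : good w ->
  (\forall t \ae lebesgue_oo d, sigma t = w t) -> Hs oOmega s u ->
  lower_objective s S ydelta sigma u = (obj w u)%:E.
Proof.
move=> gw sw /HsP Eu; rewrite /lower_objective L2dist_sqr.
rewrite (weighted_seminorm_ae N_gt0 Omega_bounded s u (measurable_Lspace sigma) gw.1 sw).
rewrite weighted_seminorm_sqr; [|exact: gw.1|by move=> t; exact: good_ge0].
rewrite -EFin_ip; last first.
  exact: (finite_energy_wdiff mkernel kernel0 gamma1_gt0 gamma12 gw Eu).
by rewrite -EFinD /objective /raw_operator L2ofK.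
Qed.

Lemma objective_L2of w u : good w -> finite_energy m kernel u ->
  finite_energy m kernel (L2of u) /\ obj w (L2of u) = obj w u.
Proof.
move=> gw Eu; have uE := L2ofP Eu.1.
have wE (v : R -> R) : \forall z \ae m2, wdiff v (L2of u) z = wdiff v u z.
  by apply: filterS (ae_prod uE) => z [e1 e2]; rewrite /wdiff e1 e2.
have EL2 : finite_energy m kernel (L2of u).
  split; first exact: sqint_L2.
  apply: sqint_ae Eu.2 (wE _); apply: measurable_wdiff => //.
  exact: (sqint_L2 _).1.
split => //; rewrite /objective; congr (_ + _).
  by rewrite /raw_operator L2ofK.
by apply: ip_ae_sq (wE _); exact: (finite_energy_wdiff mkernel kernel0 gamma1_gt0 gamma12 gw).
Qed.

Lemma solves_lower_euler_lagrange (sigma : Linfty d) w (u : L2 oOmega) : good w ->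
  (\forall t \ae lebesgue_oo d, sigma t = w t) ->
  solves_lower s S ydelta sigma u -> EL w u.
Proof.
move=> gw sw [Hu umin]; have Eu := (HsP u).1 Hu.
apply: (minimizer_euler_lagrange mkernel kernel0 kernel_far kernel_near delta_gt0
  gamma1_gt0 gamma12 raw_operator_sqint raw_operator_lin raw_operator_bounded
  raw_operator_one poincare Ly gw Eu) => v Ev.
have [Ev' <-] := objective_L2of gw Ev; have Hv := (HsP _).2 Ev'.
by have := umin _ Hv; rewrite !(lower_objectiveE gw sw).
Qed.

Lemma euler_lagrange_solves_lower (sigma : Linfty d) w u : good w ->
  (\forall t \ae lebesgue_oo d, sigma t = w t) ->
  EL w u -> solves_lower s S ydelta sigma (L2of u).
Proof.
move=> gw sw uEL; have [Eu' oE] := objective_L2of gw uEL.1.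
have Hu := (HsP _).2 Eu'; split => // v Hv; have Ev := (HsP _).1 Hv.
rewrite !(lower_objectiveE gw sw)// lee_fin oE.
rewrite (objectiveE mkernel kernel0 gamma1_gt0 gamma12 raw_operator_sqint
  raw_operator_lin Ly gw uEL Ev) lerDl.
apply: (sip_ge0 (aform_sip mkernel kernel0 gamma1_gt0 gamma12 raw_operator_sqint
  raw_operator_lin gw)).
exact: (energy_lcomb _ Ev uEL.1).
Qed.

Variable l : {finite_measure set (measurableTypeR R) -> \bar R}.
Hypothesis lE : (l : {measure set (measurableTypeR R) -> \bar R}) = lebesgue_oo d.

Local Notation feasible_pairs := (feasible s gamma1 gamma2 delta S ydelta).

Let feasible_L2of w u : good w -> EL w u -> exists2 sigma : Linfty d,
  feasible_pairs (sigma, L2of u) & \forall t \ae lebesgue_oo d, sigma t = w t.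
Proof.
move=> gw uEL; have [sigma asigma sw] := weight_admissible d gamma1_gt0 gamma12 gw.
by exists sigma => //; split => //; exact: (euler_lagrange_solves_lower gw sw uEL).
Qed.

Lemma feasible_neq0 : feasible_pairs !=set0.
Proof.
have gw : good (cst gamma2).
  split; first exact: measurable_cst.
  by move=> t; rewrite lexx andbT; have /andP[] := lower_bound_itv delta gamma1_gt0 gamma12 t.
have [u uEL] := lower_solution_exists gw.
by have [sigma fs _] := feasible_L2of gw uEL; exists (sigma, L2of u).
Qed.

(** The class version of [feasible_compact]: truncated representatives of the
    weights satisfy the bounds everywhere, and classes of the limits are feasible. *)
Theorem feasible_subsequence (p_ : nat -> Linfty d * L2 oOmega) :
  (forall k, feasible_pairs (p_ k)) ->
  exists p (k : nat -> nat), [/\ feasible_pairs p, forall j, (j <= k j)%N,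
    weak_star_cvg (fun j => (p_ (k j)).1) p.1 &
    sqdist (@lcomb R T) (ip m) p.2 (p_ (k j)).2 @[j --> \oo] --> 0].
Proof.
move=> fp_.
have /choice[w_ w_P] : forall k, exists w, good w /\
    \forall t \ae lebesgue_oo d, (p_ k).1 t = w t.
  by move=> k; have [w] := admissible_weight gamma1_gt0 gamma12 (fp_ k).1; exists w.
have null : \forall x \ae m, forall A : set (measurableTypeR R), measurable A ->
    l A = 0%E -> m [set z | A (enorm (x - z))] = 0%E.
  rewrite aeE; apply: filterS (lebesgue_dom_null_distances oOmega N_gt0 Omega_bounded).
  move=> x h A mA A0; transitivity (lebesgue_dom oOmega [set z | A (enorm (x - z))]).
    exact: (congr1 (fun k : {measure set T -> \bar R} => k _) mE).
  apply: h => //; rewrite -A0; symmetry.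
  exact: (congr1 (fun k : {measure set (measurableTypeR R) -> \bar R} => k A) lE).
have EL_ k : EL (w_ k) (p_ k).2.
  by have [gw sw] := w_P k; exact: (solves_lower_euler_lagrange gw sw (fp_ k).2).
have [w [u [k [gw uEL kj wcvg ucvg]]]] := feasible_compact mkernel kernel0
  kernel_far kernel_near delta_gt0 gamma1_gt0 gamma12 raw_operator_sqint
  raw_operator_lin raw_operator_bounded raw_operator_one poincare Ly null
  (fun k => (w_P k).1) EL_.
have [sigma fsigma sw] := feasible_L2of gw uEL.
exists (sigma, L2of u), k; split => //.
- move=> g /=; rewrite (integral_weight gamma1_gt0 gamma12 g lE gw sw).
  under eq_fun do rewrite (integral_weight gamma1_gt0 gamma12 g lE (w_P _).1 (w_P _).2).
  apply: cvg_EFin; first exact: nearW.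
  apply: (wcvg g).
  rewrite (congr1 (fun k : {measure set (measurableTypeR R) -> \bar R} =>
    k.-integrable setT (EFin \o g)) lE).
  exact: L1_integrable.
- apply: cvg_trans ucvg; apply: near_eq_cvg; apply: nearW => j.
  rewrite /sqdist; apply: ip_ae_sq => /=.
  - exact: (sqint_lcomb _ uEL.1.1 (sqint_L2 _)).
  - exact: (sqint_lcomb _ (sqint_L2 _) (sqint_L2 _)).
  by apply: filterS (L2ofP uEL.1.1) => x e; rewrite /lcomb e.
Qed.

End lower_level.

(** * The bilevel problem *)

Lemma limn_einf_le_cvg (R : realType) (a b : nat -> R) (c : R) :
  (forall k, a k <= b k) -> b @ \oo --> c ->
  (limn_einf (EFin \o a) <= c%:E)%E.
Proof.
move=> ab bc'; have bc : (EFin \o b @ \oo --> c%:E)%E.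
  by apply: cvg_EFin => //; exact: nearW.
have [<- _] := cvg_limn_einf_sup bc; rewrite !limn_einf_lim.
apply: lee_lim; [exact: is_cvg_einfs|exact: is_cvg_einfs|].
apply: nearW => n; apply: le_ereal_inf_tmp => _ [k nk <-].
by apply: (@le_trans _ _ (a k)%:E); [apply: ereal_inf_lbound; exists k|rewrite lee_fin].
Qed.

Theorem proposition3p6 (R : realType) (N : nat) (N_gt0 : (0 < N)%N)
    (s : R) (s01 : 0 < s < 1)
    (Omega : set 'rV[R]_N) (Omega_neq0 : Omega !=set0) (oOmega : open Omega)
    (Omega_connected : connected Omega) (Omega_bounded : bounded_set Omega)
    (Omega_lipschitz : lipschitz_boundary Omega)
    (gamma1 gamma2 delta : R) (gamma1_gt0 : 0 < gamma1)
    (gamma12 : gamma1 <= gamma2) (delta_gt0 : 0 < delta)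
    (S : L2 oOmega -> L2 oOmega) (S_linear : L2linear S) (S_bounded : L2bounded S)
    (ydelta udag : L2 oOmega)
    (S_inj : set_inj (ae_constant oOmega) S)
    (reg : Linfty (diameter Omega) -> R)
    (reg_ge0 : forall sigma, 0 <= reg sigma)
    (reg_lsc : weak_star_seq_lsc reg) :
  exists p : Linfty (diameter Omega) * L2 oOmega,
    solves_bilevel s gamma1 gamma2 delta S ydelta udag reg p.
Proof.
have s_gt0 : 0 < s by case/andP: s01.
pose d := diameter Omega.
have mO := open_measurable_rV oOmega.
have [m mE] : exists m : {finite_measure set 'rV[R]_N -> \bar R},
    (m : {measure set 'rV[R]_N -> \bar R}) = lebesgue_dom oOmega.
  by apply/finite_measure_copy/fin_num_fun_mrestr; exact: lebesgue_rV_bounded.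
have [l lE] : exists l : {finite_measure set (measurableTypeR R) -> \bar R},
    (l : {measure set (measurableTypeR R) -> \bar R}) = lebesgue_oo d.
  apply/finite_measure_copy/fin_num_fun_mrestr.
  by rewrite [ltLHS](lebesgue_measure_itv `]0, d[)/=; case: ifP => _; rewrite ltry.
have sqint_L2 (u : L2 oOmega) : sqint m u by rewrite mE; exact: sqint_Lspace.
have /choice[L2of L2ofP] : forall f : 'rV[R]_N -> R, exists u : L2 oOmega,
    sqint m f -> \forall x \ae m, u x = f x.
  move=> f; have [Lf|nLf] := pselect (sqint m f); last by exists ydelta.
  have [|u uf] := @L2_class _ _ R (lebesgue_dom oOmega) f; first by rewrite -mE.
  exists u => _; rewrite (congr1 (fun k : {measure set 'rV[R]_N -> \bar R} =>
    \forall x \ae k, u x = f x) mE).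
  exact: uf.
pose D (u : L2 oOmega) := lcomb (-1) (udag : 'rV[R]_N -> R) u.
pose val (p : Linfty d * L2 oOmega) : R := 2^-1 * ip m (D p.2) (D p.2) + reg p.1.
have valE p : upper_objective udag reg p = (val p)%:E.
  by rewrite /upper_objective (L2dist_sqr mE) -EFinM -EFinD.
have LD u : sqint m (D u) by exact: sqint_lcomb.
have val_ge0 p : 0 <= val p.
  by rewrite addr_ge0// mulr_ge0// (sip_ge0 (ip_sip m)).
pose F := feasible s gamma1 gamma2 delta S ydelta.
have [p0 Fp0] : F !=set0.
  exact: (feasible_neq0 ydelta N_gt0 Omega_neq0 Omega_connected Omega_bounded S_linear
    S_bounded S_inj mE L2ofP s_gt0 gamma1_gt0 gamma12 delta_gt0).
pose V := inf (val @` F).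
have infV : has_inf (val @` F).
  by split; [exists (val p0), p0|exists 0 => _ [p _ <-]].
have /choice[p_ p_P] : forall k : nat, exists p, F p /\ val p < V + k.+1%:R^-1.
  move=> k; have k0 : 0 < k.+1%:R^-1 :> R by rewrite invr_gt0.
  by have [_ [p Fp <-] pV] := inf_adherent k0 infV; exists p.
have [p [k [Fp kj scvg ucvg]]] := feasible_subsequence (ydelta := ydelta) N_gt0 Omega_neq0 Omega_connected
  Omega_bounded S_linear S_bounded S_inj mE L2ofP s_gt0 gamma1_gt0 gamma12 delta_gt0
  lE (fun k => (p_P k).1).
exists p; split=> [//|q Fq]; rewrite !valE lee_fin.
apply: (@le_trans _ _ V); last by apply: ge_inf; [exact: infV.2|exists q].
have Dcvg : ip m (D (p_ (k j)).2) (D (p_ (k j)).2) @[j --> \oo] --> ip m (D p.2) (D p.2).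
  apply: cvg_ip => //; apply: cvg_trans ucvg; apply: near_eq_cvg; apply: nearW => j.
  by rewrite /sqdist; congr (ip m _ _); apply/funext => x; rewrite /D /lcomb; ring.
have := reg_lsc _ _ scvg.
move/le_trans => /(_ (V - 2^-1 * ip m (D p.2) (D p.2))%:E).
rewrite lee_fin lerBrDl; apply.
apply: (@limn_einf_le_cvg _ _
  (fun j => V + j.+1%:R^-1 - 2^-1 * ip m (D (p_ (k j)).2) (D (p_ (k j)).2))).
- move=> j; rewrite lerBrDl (le_trans (ltW (p_P (k j)).2))// lerD2l.
  by rewrite lef_pV2 ?posrE// ler_nat ltnS.
- apply: cvgB; last exact: cvgMr.
  rewrite -[X in _ --> X]addr0; apply: cvgD; first exact: cvg_cst.
  exact: cvg_harmonic.
Qed.
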